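(* There is an absolute constant $C>0$ and a randomized algorithm with the following guarantee. Let $n$ be a positive integer, let $H\in\mathbb{R}^{n\times n}$ be a positive semidefinite Hankel matrix, let $E\in\mathbb{R}^{n\times n}$ be an arbitrary (not necessarily Hankel) matrix, and let $\epsilon>0$. Given $n$, $\epsilon$ and query access to individual entries of $B=H+E$, the algorithm runs in $\mathrm{polylog}(n,1/\epsilon)$ time and returns a factored representation of a Hankel matrix $\widehat{H}\in\mathbb{R}^{n\times n}$ of rank $O(\log n\log(1/\epsilon))$ such that, with probability at least $9/10$, $$\|H-\widehat{H}\|_F\le C\|E\|_F+\epsilon\|H\|_F.$$
   Context: A matrix $A\in\mathbb{R}^{n\times n}$ is Hankel if $A_{i,j}=A_{k,l}$ whenever $i+j=k+l$ (it is constant along anti-diagonals). $\|\cdot\|_F$ denotes the Frobenius norm. The algorithm only reads entries of $H+E$ it queries; running time is measured in this query model. *)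

(* Defs.v *)
From HB Require Import structures.
From mathcomp Require Import all_boot all_order all_algebra.
From mathcomp Require Import reals exp.

Set Implicit Arguments.
Unset Strict Implicit.
Unset Printing Implicit Defensive.

Import Order.TTheory GRing.Theory Num.Theory.
Local Open Scope ring_scope.

Definition hankel (R : realType) (n : nat) (A : 'M[R]_n) : Prop :=
  forall i j k l : 'I_n, (i + j = k + l)%N -> A i j = A k l.

Definition psd (R : realType) (n : nat) (A : 'M[R]_n) : Prop :=
  A^T = A /\ forall x : 'cV[R]_n, 0 <= (x^T *m A *m x) 0 0.

Definition frob (R : realType) (n : nat) (A : 'M[R]_n) : R :=
  Num.sqrt (\sum_i \sum_j A i j ^+ 2).

(* Randomized real RAM with an entry oracle. The memory consists of natural
   number cells N[0], N[1], ... and real cells X[0], X[1], ...; the arguments of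
   the instructions are addresses. Programs contain no real constants, and
   neither integer multiplication nor rounding of reals is primitive: after t
   steps every N-cell has O(t + log(inputs and program constants)) bits, so unit
   cost is not a way to hide long computations. *)
Inductive instr : Type :=
| NConst (a c : nat)          (* N[a] := c *)
| NAdd (a b c : nat)          (* N[a] := N[b] + N[c] *)
| NSub (a b c : nat)          (* N[a] := N[b] - N[c], truncated at 0 *)
| NHalf (a b : nat)           (* N[a] := floor (N[b] / 2) *)
| NLoad (a b : nat)           (* N[a] := N[N[b]] *)
| NStore (a b : nat)          (* N[N[a]] := N[b] *)
| RNat (x a : nat)            (* X[x] := N[a] *)
| RAdd (x y z : nat)          (* X[x] := X[y] + X[z] *)
| RSub (x y z : nat)          (* X[x] := X[y] - X[z] *)
| RMul (x y z : nat)          (* X[x] := X[y] * X[z] *)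
| RDiv (x y z : nat)          (* X[x] := X[y] / X[z], 0 if X[z] = 0 *)
| RLoad (x a : nat)           (* X[x] := X[N[a]] *)
| RStore (a x : nat)          (* X[N[a]] := X[x] *)
| Query (x a b : nat)         (* X[x] := entry (N[a], N[b]) of the input *)
| Flip (a : nat).             (* N[a] := fair random bit *)

Inductive test : Type :=
| NLt (a b : nat)             (* N[a] < N[b] *)
| RLt (x y : nat).            (* X[x] < X[y] *)

Inductive cmd : Type :=
| Skip
| Do of instr
| Seq of cmd & cmd
| If of test & cmd & cmd
| While of test & cmd.

(* [coins] is the number of random bits consumed so far. *)
Record state (R : realType) : Type := State {
  nmem : nat -> nat;
  rmem : nat -> R;
  coins : nat }.

Definition upd (V : Type) (f : nat -> V) (a : nat) (v : V) : nat -> V :=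
  fun b => if b == a then v else f b.

Definition setN (R : realType) (s : state R) (a v : nat) : state R :=
  State (upd (nmem s) a v) (rmem s) (coins s).

Definition setX (R : realType) (s : state R) (x : nat) (v : R) : state R :=
  State (nmem s) (upd (rmem s) x v) (coins s).

Definition step (R : realType) (B : nat -> nat -> R) (w : nat -> bool)
    (i : instr) (s : state R) : state R :=
  let N := nmem s in
  let X := rmem s in
  match i with
  | NConst a c => setN s a c
  | NAdd a b c => setN s a (N b + N c)%N
  | NSub a b c => setN s a (N b - N c)%N
  | NHalf a b => setN s a (N b)./2
  | NLoad a b => setN s a (N (N b))
  | NStore a b => setN s (N a) (N b)
  | RNat x a => setX s x (N a)%:R
  | RAdd x y z => setX s x (X y + X z)
  | RSub x y z => setX s x (X y - X z)
  | RMul x y z => setX s x (X y * X z)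
  | RDiv x y z => setX s x (X y / X z)
  | RLoad x a => setX s x (X (N a))
  | RStore a x => setX s (N a) (X x)
  | Query x a b => setX s x (B (N a) (N b))
  | Flip a => State (upd N a (w (coins s) : nat)) X (coins s).+1
  end.

Definition holds (R : realType) (b : test) (s : state R) : bool :=
  match b with
  | NLt a b => (nmem s a < nmem s b)%N
  | RLt x y => rmem s x < rmem s y
  end.

(* [exec B w c s t s']: with input oracle [B] and coin tosses [w], command [c]
   started in [s] halts in [s'] after [t] steps. Every instruction, every query,
   every coin toss and every evaluation of a test is one step. *)
Inductive exec (R : realType) (B : nat -> nat -> R) (w : nat -> bool) :
    cmd -> state R -> nat -> state R -> Prop :=
| ExecSkip s : exec B w Skip s 1 s
| ExecDo i s : exec B w (Do i) s 1 (step B w i s)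
| ExecSeq c1 c2 s s1 s2 t1 t2 :
    exec B w c1 s t1 s1 -> exec B w c2 s1 t2 s2 ->
    exec B w (Seq c1 c2) s (t1 + t2)%N s2
| ExecIf b c1 c2 s s' t :
    exec B w (if holds b s then c1 else c2) s t s' ->
    exec B w (If b c1 c2) s t.+1 s'
| ExecWhileF b c s : ~~ holds b s -> exec B w (While b c) s 1 s
| ExecWhileT b c s s1 s2 t1 t2 :
    holds b s -> exec B w c s t1 s1 -> exec B w (While b c) s1 t2 s2 ->
    exec B w (While b c) s (t1 + t2).+1 s2.

Lemma exec_det (R : realType) (B : nat -> nat -> R) (w : nat -> bool)
    (c : cmd) (s s1 s2 : state R) (t1 t2 : nat) :
  exec B w c s t1 s1 -> exec B w c s t2 s2 -> t1 = t2 /\ s1 = s2.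
Proof.
move=> h; elim: h t2 s2 => {c s t1 s1}.
- by move=> s t s' h; inversion h.
- by move=> i s t s' h; inversion h.
- move=> c1 c2 s s1 s2 t1 t2 _ IH1 _ IH2 t s' h.
  inversion h as [| |? ? ? u1 ? v1 v2 h1 h2| | |]; subst.
  case: (IH1 _ _ h1) => e1 e2; subst.
  by case: (IH2 _ _ h2) => -> ->.
- move=> b c1 c2 s s' t _ IH t' s'' h.
  inversion h as [| | |? ? ? ? ? ? h1| |]; subst.
  by case: (IH _ _ h1) => -> ->.
- move=> b c s nb t' s' h.
  inversion h as [| | | | |? ? ? ? ? ? ? hb]; subst => //.
  by rewrite hb in nb.
- move=> b c s s1 s2 t1 t2 hb _ IH1 _ IH2 t' s' h.
  inversion h as [| | | |? ? ? nb|? ? ? u1 ? v1 v2 ? h1 h2]; subst.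
    by rewrite hb in nb.
  case: (IH1 _ _ h1) => e1 e2; subst.
  by case: (IH2 _ _ h2) => -> ->.
Qed.

Definition halts_within (R : realType) (B : nat -> nat -> R) (w : nat -> bool)
    (T : nat) (c : cmd) (s s' : state R) : Prop :=
  exists2 t : nat, (t <= T)%N & exec B w c s t s'.

Definition oracle (R : realType) (n : nat) (B : 'M[R]_n) (i j : nat) : R :=
  match insub i : option 'I_n, insub j : option 'I_n with
  | Some i', Some j' => B i' j'
  | _, _ => 0
  end.

Definition init (R : realType) (n : nat) (eps : R) : state R :=
  State (upd (fun _ => 0%N) 0%N n) (upd (fun _ => 0) 0%N eps) 0.

(* Within polylogarithmic time one cannot write down n x r factors, so a
   factored representation is implicit: the memory [s] left by the algorithm,
   with the number r of columns in N[0], such that the programs [cU] and [cV],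
   given a row index in N[1] and a column index in N[2], compute in at most [T]
   steps any entry of U and V, where A = U V^T. These programs run
   deterministically and without access to the input: every query is answered
   by 0 and every coin toss by false. *)
Definition width (R : realType) (s : state R) : nat := nmem s 0.

Definition computes_entries (R : realType) (c : cmd) (T : nat) (s : state R)
    (n r : nat) (U : 'M[R]_(n, r)) : Prop :=
  forall (i : 'I_n) (l : 'I_r), exists2 s' : state R,
    halts_within (fun _ _ => 0) (fun _ => false) T c
      (setN (setN s 1 i) 2 l) s' &
    rmem s' 0 = U i l.

Definition factored_rep (R : realType) (cU cV : cmd) (T : nat) (s : state R)
    (n : nat) (A : 'M[R]_n) : Prop :=
  exists U V : 'M[R]_(n, width s),
    [/\ A = U *m V^T, computes_entries cU T s U & computes_entries cV T s V].

(* The logarithms in O(.) and polylog(.) are shifted by 1, and log (1/eps) is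
   cut off at 0, so that the bounds are meaningful for n = 1 and eps near or
   above 1. *)
Definition log_n (R : realType) (n : nat) : R := 1 + ln n%:R.

Definition log_eps (R : realType) (eps : R) : R := 1 + Num.max 0 (ln eps^-1).

Definition polylog (R : realType) (T : nat -> R -> nat) : Prop :=
  exists (K : R) (p : nat), forall (n : nat) (eps : R), (0 < n)%N -> 0 < eps ->
    (T n eps)%:R <= K * (log_n R n * log_eps eps) ^+ p.

(* A run of at most T steps tosses at most T coins, so T uniform bits determine
   it and give its exact distribution. *)
Definition coin_prob (R : realType) (T : nat) (P : pred (T.-tuple bool)) : R :=
  #|[set w | P w]|%:R / 2 ^+ T.

(* Main.v *)
(* A positive semidefinite Hankel matrix is, up to a perturbation, a moment
   matrix: H_ij is a positive combination of terms lam^(i+j) with lam real.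
   Interpolating x |-> x^k at d points of each shell
   1 - (4/5)^j <= x <= 1 - (4/5)^(j+1) has an error bounded by a binomial
   probability, so O(log n log(1/eps)) fixed nodes x_a (with their opposites and
   inverses) span a space S of Hankel matrices that contains H up to eps |H|_F.
   It remains to project B = H + E onto S approximately from few entries. The
   Gram matrix of the nodes is a geometric sum, hence the reproducing kernel of S
   is computable in polylogarithmic time, and a stochastic iteration (randomized
   Kaczmarz) contracts the expected squared distance to the projection down to
   the order of |B - P B|_F^2, provided entries are sampled in proportion to their
   leverage. The leverage of (i, j) is at most 4 rank / (1 + min(i+j, 2n-2-i-j))^2,
   because S is invariant under shifts and average leverage in an s x s window is
   at most rank / s^2; so it suffices to draw a dyadic scale and then an entry
   uniformly on that scale. Markov's inequality gives probability 9/10. *)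
Require Import Defs.
From mathcomp Require Import all_boot all_order all_algebra.
From mathcomp Require Import boolp reals exp.
From mathcomp Require Import spectral sesquilinear complex.
From mathcomp Require Import ring lra zify.
Set Implicit Arguments.
Unset Strict Implicit.
Unset Printing Implicit Defensive.
Import Order.TTheory GRing.Theory Num.Theory.
Local Open Scope ring_scope.

(** * Reproducing kernels *)

(** The error of approximating H must be relative to |H|_F although the atoms are unknown. So the
    interpolation error of one atom at (i, j) is compared with a power of lam at a coarsened
    position with even exponents: summed over the atoms with their nonnegative weights, this is an
    entry of H itself, and at most 256 positions share a coarsening. Near lam = 0 no such comparison
    is possible; there the error decays geometrically away from the corner and is charged to H_00.
    The inversion of lam carries the argument to the opposite corner when |lam| > 1.

    A singular H need not be a moment matrix, because mass may escape to infinity. The approximation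
    is therefore stated for the projection onto a space that depends on n and eps only: along H + t
    H0 with H0 positive definite it is a quadratic inequality in t, which survives t -> 0.

    The machine offers only field operations, comparisons and coins. Hence the nodes are fixed
    rationals, Gram-Schmidt works with coefficients and avoids square roots, division by zero covers
    linear dependence, and powers come from binary splitting. *)

Section Kernel.
Variable R : realType.

Definition dot (I : finType) (f g : I -> R) : R := \sum_p f p * g p.

Definition lincomb (I : Type) (r : nat) (u : nat -> I -> R) (c : nat -> R) (p : I) : R :=
  \sum_(a < r) c a * u a p.

(** With [G] the Gram matrix and [K] the kernel built so far, these are the coefficients of [u l]
    minus its projection onto the earlier vectors. *)
Definition gram_dir (r : nat) (G K : nat -> nat -> R) (l a : nat) : R :=
  (a == l)%:R - \sum_(b < r) K a b * G b l.

(** The squared norm of that direction, taken as its inner product with [u l] alone; the two agree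
    because the direction is orthogonal to the earlier vectors. *)
Definition gram_den (r : nat) (G K : nat -> nat -> R) (l : nat) : R :=
  \sum_(a < r) gram_dir r G K l a * G a l.

(* Gram-Schmidt in coefficient space; a vector that depends on its predecessors
   has [gram_den = 0] and contributes nothing, since x / 0 = 0. *)
Fixpoint gram_kernel (r : nat) (G : nat -> nat -> R) (l : nat) : nat -> nat -> R :=
  if l is l'.+1 then
    let K := gram_kernel r G l' in
    fun a b => K a b + gram_dir r G K l' a * gram_dir r G K l' b / gram_den r G K l'
  else fun _ _ => 0.

Lemma dotC (I : finType) (f g : I -> R) : dot f g = dot g f.
Proof. by apply: eq_bigr => p _; rewrite mulrC. Qed.

Lemma dot_ge0 (I : finType) (f : I -> R) : 0 <= dot f f.
Proof. by apply: sumr_ge0 => p _; rewrite -expr2 sqr_ge0. Qed.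

Lemma dot_eq0 (I : finType) (f : I -> R) : dot f f = 0 -> forall p, f p = 0.
Proof.
move=> /eqP; rewrite psumr_eq0 => [/allP h p|p _]; last by rewrite -expr2 sqr_ge0.
by have := h p (mem_index_enum p); rewrite /= mulf_eq0 orbb => /eqP.
Qed.

Lemma eq_dot (I : finType) (f f' g g' : I -> R) :
  f =1 f' -> g =1 g' -> dot f g = dot f' g'.
Proof. by move=> ef eg; apply: eq_bigr => p _; rewrite ef eg. Qed.

Lemma dot_lincombr (I : finType) (r : nat) (u : nat -> I -> R) (c : nat -> R) (f : I -> R) :
  dot f (lincomb r u c) = \sum_(a < r) c a * dot f (u a).
Proof.
rewrite /dot; under eq_bigr => p _ do rewrite mulr_sumr.
rewrite exchange_big; apply: eq_bigr => a _; rewrite mulr_sumr.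
by apply: eq_bigr => p _; rewrite mulrCA.
Qed.

Lemma dotDr (I : finType) (f g h : I -> R) : dot f (fun p => g p + h p) = dot f g + dot f h.
Proof. by rewrite -big_split; apply: eq_bigr => p _; rewrite mulrDr. Qed.

Lemma dotBr (I : finType) (f g h : I -> R) : dot f (fun p => g p - h p) = dot f g - dot f h.
Proof. by rewrite -sumrB; apply: eq_bigr => p _; rewrite mulrBr. Qed.

Lemma dotZr (I : finType) (c : R) (f g : I -> R) : dot f (fun p => c * g p) = c * dot f g.
Proof. by rewrite mulr_sumr; apply: eq_bigr => p _; rewrite mulrCA. Qed.

Lemma dot_addZ (I : finType) (s : R) (f g : I -> R) :
  dot (fun p => f p + s * g p) (fun p => f p + s * g p) =
  dot f f + (2 * s * dot g f + s ^+ 2 * dot g g).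
Proof. by rewrite /dot !mulr_sumr -!big_split; apply: eq_bigr => p _ /=; ring. Qed.

Lemma dot_CS (I : finType) (f g : I -> R) : dot f g ^+ 2 <= dot f f * dot g g.
Proof.
have [g0|gn0] := eqVneq (dot g g) 0.
  have -> : dot f g = 0 by rewrite /dot big1 // => p _; rewrite (dot_eq0 g0) mulr0.
  by rewrite g0 mulr0 expr0n.
have gp : 0 < dot g g by rewrite lt_neqAle eq_sym gn0 dot_ge0.
have := dot_ge0 (fun p => dot g g * f p - dot f g * g p).
rewrite dotBr !dotZr ![dot (fun p => _ - _) _]dotC !dotBr !dotZr (dotC g f).
set a := dot f f; set b := dot f g; set c := dot g g => h.
have : 0 <= c * (a * c - b ^+ 2) by move: h; apply: etrans; congr (_ <= _); ring.
by rewrite pmulr_rge0 // subr_ge0.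
Qed.

Variables (I : finType) (r : nat) (u : nat -> I -> R).
Let G a b := dot (u a) (u b).

Definition kernel (l : nat) (p q : I) : R :=
  \sum_(a < r) \sum_(b < r) gram_kernel r G l a b * u a p * u b q.

Let dir l p := lincomb r u (gram_dir r G (gram_kernel r G l) l) p.
Let den l := gram_den r G (gram_kernel r G l) l.

Lemma gram_kernelC l a b : gram_kernel r G l a b = gram_kernel r G l b a.
Proof. by elim: l a b => //= l IH a b; rewrite IH [X in _ + X / _]mulrC. Qed.

Lemma gram_kernel_supp l a b : (l <= a)%N -> gram_kernel r G l a b = 0.
Proof.
elim: l a b => //= l IH a b la.
rewrite IH 1?ltnW // {1}/gram_dir gtn_eqF // big1 => [|c _]; last by rewrite IH 1?ltnW ?mul0r.
by rewrite subrr !mul0r addr0.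
Qed.

Lemma kernelC l p q : kernel l p q = kernel l q p.
Proof.
rewrite /kernel exchange_big; apply: eq_bigr => a _; apply: eq_bigr => b _.
by rewrite gram_kernelC mulrAC.
Qed.

Lemma kernel_apply l p f :
  dot (kernel l p) f = lincomb r u (fun a => \sum_(b < r) gram_kernel r G l a b * dot (u b) f) p.
Proof.
rewrite /dot /kernel /lincomb; under eq_bigr => q _ do rewrite mulr_suml.
rewrite exchange_big; apply: eq_bigr => a _.
under eq_bigr => q _ do rewrite mulr_suml.
rewrite exchange_big /= mulr_suml; apply: eq_bigr => b _.
rewrite mulr_sumr mulr_suml; apply: eq_bigr => q _.
ring.
Qed.

Lemma dirE l p : (l < r)%N -> dir l p = u l p - dot (kernel l p) (u l).
Proof.
move=> lr; rewrite kernel_apply /dir /lincomb.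
under eq_bigr => a _ do rewrite mulrBl.
rewrite sumrB; congr (_ - _).
rewrite (bigD1 (Ordinal lr)) //= eqxx mul1r big1 ?addr0 // => a.
by rewrite -val_eqE /= => /negPf ->; rewrite mul0r.
Qed.

Lemma kernelS l p q : kernel l.+1 p q = kernel l p q + dir l p * dir l q / den l.
Proof.
rewrite /kernel /dir /lincomb mulr_suml mulr_suml -big_split; apply: eq_bigr => a _.
rewrite mulr_sumr mulr_suml -big_split; apply: eq_bigr => b _ /=.
rewrite -/(den l); ring.
Qed.

Definition reproducing l := forall a, (a < l)%N -> forall p, dot (kernel l p) (u a) = u a p.

Lemma dir_orth l a : (l < r)%N -> reproducing l -> (a < l)%N -> dot (dir l) (u a) = 0.
Proof.
move=> lr rep al.
rewrite (eq_dot (f' := fun p => u l p - dot (kernel l p) (u l)) (g' := u a)) //; last first.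
  by move=> p; rewrite dirE.
rewrite dotC dotBr.
have -> : dot (u a) (fun p => dot (kernel l p) (u l)) = dot (u l) (u a).
  rewrite /dot; under eq_bigr => p _ do rewrite mulr_sumr.
  rewrite exchange_big /=; apply: eq_bigr => q _.
  rewrite -[u a q in RHS](rep _ al) mulr_sumr; apply: eq_bigr => p _.
  by rewrite (kernelC l p q); ring.
by rewrite (dotC (u a)) subrr.
Qed.

Lemma denE l : den l = dot (dir l) (u l).
Proof. by rewrite dotC dot_lincombr; apply: eq_bigr => a _; rewrite (dotC (u l)). Qed.

Lemma den_dir l : (l < r)%N -> reproducing l -> den l = dot (dir l) (dir l).
Proof.
move=> lr rep; rewrite denE; apply/eqP; rewrite -subr_eq0 -dotBr; apply/eqP.
rewrite (eq_dot (f' := dir l) (g' := fun p => dot (kernel l p) (u l))) //; last first.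
  by move=> p; rewrite dirE // opprB addrC subrK.
rewrite (eq_dot (f' := dir l) (g' := lincomb r u (fun a => \sum_(b < r) gram_kernel r G l a b * dot (u b) (u l)))) //; last first.
  by move=> p; rewrite kernel_apply.
rewrite dot_lincombr big1 // => a _.
have [al|la] := ltnP a l; first by rewrite (dir_orth lr rep al) mulr0.
by rewrite big1 ?mul0r // => b _; rewrite gram_kernel_supp ?mul0r.
Qed.

(** The new rank-one term vanishes against the earlier vectors, and on [u l] it supplies exactly the
    part [dir l] that the old kernel misses. *)
Lemma kernel_reproducing l : (l <= r)%N -> reproducing l.
Proof.
elim: l => [|l IH] lr a; first by rewrite ltn0.
have rep := IH (ltnW lr).
move=> al p.
have -> : dot (kernel l.+1 p) (u a) = dot (kernel l p) (u a) + dir l p / den l * dot (dir l) (u a).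
  rewrite /dot mulr_sumr -big_split; apply: eq_bigr => q _ /=.
  by rewrite kernelS; ring.
move: al; rewrite ltnS leq_eqVlt => /orP[/eqP ->|al]; last by rewrite rep // dir_orth // mulr0 addr0.
(* For a dependent vector the direction has norm zero, hence vanishes pointwise, and [u l] is
   already reproduced. *)
have [d0|dn0] := eqVneq (den l) 0.
  have z : dir l p = 0 by apply: dot_eq0; rewrite -den_dir.
  rewrite z !mul0r addr0; apply/esym/eqP; rewrite -subr_eq0 -dirE //; exact/eqP.
by rewrite -denE divfK // dirE // addrC subrK.
Qed.

(** Each step adds the squares of the values of a unit vector, or nothing when the direction
    vanishes, so the trace grows by at most 1. *)
Lemma kernel_trace l : (l <= r)%N -> \sum_p kernel l p p <= l%:R.
Proof.
elim: l => [|l IH] lr.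
  by rewrite big1 // => p _; rewrite /kernel big1 // => a _; rewrite big1 // => b _; rewrite !mul0r.
under eq_bigr => p _ do rewrite kernelS.
rewrite big_split /= -natr1; apply: lerD; [exact: IH (ltnW lr)|rewrite -mulr_suml -/(dot _ _)].
rewrite -(den_dir lr (kernel_reproducing (ltnW lr))).
by have [->|h] := eqVneq (den l) 0; rewrite ?mul0r ?divff.
Qed.

Definition rkernel := kernel r.

Lemma rkernel_lincomb c p : dot (rkernel p) (lincomb r u c) = lincomb r u c p.
Proof.
rewrite dot_lincombr; apply: eq_bigr => a _.
by rewrite kernel_reproducing.
Qed.

Lemma rkernelE q p :
  rkernel p q = lincomb r u (fun a => \sum_(b < r) gram_kernel r G r a b * u b p) q.
Proof.
rewrite /rkernel kernelC /kernel /lincomb; apply: eq_bigr => a _; rewrite mulr_suml.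
by apply: eq_bigr => b _; rewrite mulrAC.
Qed.

(** A row of the kernel lies in the span, so the kernel reproduces it. *)
Lemma rkernel_norm p : dot (rkernel p) (rkernel p) = rkernel p p.
Proof.
rewrite -[RHS]/(rkernel p p) [RHS]rkernelE -rkernel_lincomb.
by apply: eq_dot => // q; rewrite rkernelE.
Qed.

Lemma rkernelC p q : rkernel p q = rkernel q p. Proof. exact: kernelC. Qed.

Lemma rkernel_trace : \sum_p rkernel p p <= r%:R.
Proof. exact: kernel_trace. Qed.

End Kernel.

(** * Leverage of exponential sums *)

Section Leverage.
Variable R : realType.

Lemma sum_fiber_le (I J : finType) (h : I -> J) (F : J -> R) (m : nat) :
  (forall q, 0 <= F q) -> (forall q, #|[set p | h p == q]| <= m)%N ->
  \sum_p F (h p) <= m%:R * \sum_q F q.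
Proof.
move=> F0 hm; rewrite (partition_big h predT) //= mulr_sumr.
apply: ler_sum => q _.
rewrite (eq_bigr (fun=> F q)) => [|p /eqP -> //].
rewrite sumr_const -[leLHS]mulr_natl ler_wpM2r // ler_nat.
by apply: leq_trans (hm q); apply/eq_leq/eq_card => p; rewrite !inE.
Qed.

Lemma sum_inj_le (I J : finType) (h : I -> J) (F : J -> R) :
  (forall q, 0 <= F q) -> injective h -> \sum_p F (h p) <= \sum_q F q.
Proof.
move=> F0 hi; rewrite -[leRHS]mul1r; apply: (sum_fiber_le (m := 1)) => // q.
apply/card_le1_eqP => p p'; rewrite !inE => /eqP e /eqP e'; apply: hi.
by rewrite e e'.
Qed.

Definition expmx (n : nat) (x : nat -> R) (a : nat) (p : 'I_n * 'I_n) : R :=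
  x a ^+ (p.1 + p.2).

Definition expsum (r : nat) (x c : nat -> R) (k : nat) : R := \sum_(a < r) c a * x a ^+ k.

(* The span of the exponentials is invariant under shifts, so the s x s window
   can be placed such that k falls on a position of at most average leverage. *)
Lemma expsum_window (n s k r : nat) (x c : nat -> R) :
  (0 < s <= n)%N -> (2 * s.-1 <= k <= 2 * (n - s))%N ->
  (s ^ 2)%:R * expsum r x c k ^+ 2 <=
    r%:R * \sum_(p : 'I_n * 'I_n) expsum r x c (p.1 + p.2) ^+ 2.
Proof.
move=> /andP[s0 sn] /andP[ks kn].
pose kap := rkernel r (@expmx s x).
have card_s : #|{: 'I_s * 'I_s}| = (s ^ 2)%N by rewrite card_prod card_ord.
have s2 : 0 < (s ^ 2)%:R :> R by rewrite ltr0n expn_gt0 s0.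
have [p0 hp0] : exists p0, (s ^ 2)%:R * kap p0 p0 <= r%:R.
  apply/existsP; rewrite -[X in is_true X]negbK negb_exists; apply/negP => /forallP h.
  have : \sum_(p : 'I_s * 'I_s) r%:R < \sum_p (s ^ 2)%:R * kap p p.
    apply: ltr_sum => [|p _]; last by rewrite ltNge.
    by apply/hasP; exists (Ordinal s0, Ordinal s0); rewrite ?mem_index_enum.
  rewrite sumr_const card_s -[ltLHS]mulr_natl -mulr_sumr ltr_pM2l //.
  by rewrite ltNge rkernel_trace.
have i0 := ltn_ord p0.1; have j0 := ltn_ord p0.2.
pose e := (k - (p0.1 + p0.2))%N.
have ek : (e + (p0.1 + p0.2) = k)%N by rewrite /e; lia.
(* Only the total shift [e] matters to an exponential sum. It is split into a row shift and a column
   shift that both keep the window inside the matrix. *)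
pose al := minn e (n - s); pose be := (e - al)%N.
have ab : (al + be = e)%N by rewrite /be /al; lia.
have al_le : (al <= n - s)%N by rewrite /al; lia.
have be_le : (be <= n - s)%N by rewrite /be /al /e; lia.
pose c' a := c a * x a ^+ e.
have fE (q : 'I_s * 'I_s) : lincomb r (@expmx s x) c' q = expsum r x c (e + (q.1 + q.2)).
  by apply: eq_bigr => a _; rewrite /c' /expmx -mulrA -exprD.
have Fk : expsum r x c k = dot (kap p0) (lincomb r (@expmx s x) c').
  by rewrite rkernel_lincomb fE ek.
have tau0 : 0 <= kap p0 p0 by rewrite /kap -rkernel_norm dot_ge0.
have := dot_CS (kap p0) (lincomb r (@expmx s x) c').
rewrite -Fk rkernel_norm => /(ler_wpM2l (ltW s2)) /le_trans; apply.
rewrite mulrA; apply: le_trans (_ : _ <= r%:R * dot (lincomb r (@expmx s x) c') (lincomb r (@expmx s x) c')) _.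
  by rewrite ler_wpM2r ?dot_ge0.
rewrite ler_wpM2l // /dot.
have li (i : 'I_s) : (i + al < n)%N by have := ltn_ord i; lia.
have lj (i : 'I_s) : (i + be < n)%N by have := ltn_ord i; lia.
pose h (q : 'I_s * 'I_s) := (Ordinal (li q.1), Ordinal (lj q.2)).
rewrite (eq_bigr (fun q => expsum r x c ((h q).1 + (h q).2) ^+ 2)) => [|q _].
  apply: (sum_inj_le (h := h) (F := fun p => expsum r x c (p.1 + p.2) ^+ 2)) => [q|].
    exact: sqr_ge0.
  move=> [q1 q2] [t1 t2] [] /eqP; rewrite eqn_add2r => /eqP /val_inj -> /eqP.
  by rewrite eqn_add2r => /eqP /val_inj ->.
rewrite fE -expr2 /=; congr (expsum _ _ _ _ ^+ 2); lia.
Qed.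

(** The length of the anti-diagonal [k] of an n x n matrix, for k <= 2n-2. *)
Definition depth (n k : nat) : nat := (minn k (2 * n - 2 - k)).+1.

(** The window bound is applied to the kernel row at [p], whose value at [p] and whose squared norm
    both equal the leverage tau: s^2 tau^2 <= r tau gives s^2 tau <= r, and the depth is at most 2
    s. *)
Lemma rkernel_leverage (n r : nat) (x : nat -> R) (p : 'I_n * 'I_n) :
  rkernel r (@expmx n x) p p * (depth n (p.1 + p.2))%:R ^+ 2 <= 4 * r%:R.
Proof.
set tau := rkernel _ _ p p; set k := (p.1 + p.2)%N.
have i1 := ltn_ord p.1; have i2 := ltn_ord p.2.
pose s := (minn k (2 * n - 2 - k))./2.+1.
have tau0 : 0 <= tau by rewrite /tau -rkernel_norm dot_ge0.
have [t0|tn0] := eqVneq tau 0; first by rewrite t0 mul0r mulr_ge0.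
have tp : 0 < tau by rewrite lt_neqAle eq_sym tn0.
pose c a := \sum_(b < r) gram_kernel r (fun a b => dot (@expmx n x a) (@expmx n x b)) r a b * expmx x b p.
have cE q : rkernel r (@expmx n x) p q = expsum r x c (q.1 + q.2) by rewrite rkernelE.
have : (s ^ 2)%:R * expsum r x c k ^+ 2 <=
    r%:R * \sum_(p : 'I_n * 'I_n) expsum r x c (p.1 + p.2) ^+ 2.
  by apply: expsum_window; rewrite /s /k; lia.
rewrite -cE -/tau.
have -> : \sum_(p : 'I_n * 'I_n) expsum r x c (p.1 + p.2) ^+ 2 = tau.
  by rewrite /tau -rkernel_norm; apply: eq_bigr => q _; rewrite cE expr2.
rewrite expr2 mulrA ler_pM2r // => h.
have sd : ((depth n k)%:R : R) ^+ 2 <= 4 * (s ^ 2)%:R.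
  rewrite -natrX -[4]/(4%:R) -natrM ler_nat (_ : 4 * s ^ 2 = (2 * s) ^ 2)%N; last by rewrite expnMn.
  rewrite leq_exp2r // /depth /s; lia.
apply: le_trans (ler_wpM2l tau0 sd) _.
by rewrite mulrCA (mulrC tau) ler_wpM2l.
Qed.

End Leverage.

(** * Coin tosses and sampling *)

Section Coins.
Variable R : realType.

(** Expectation over [m] fair bits, as a recursion on lists so that it splits at any position into
    independent blocks; [avg_tuple] links it to the uniform tuples of [coin_prob]. *)
Fixpoint avg (m : nat) (F : seq bool -> R) : R :=
  if m is m'.+1 then (avg m' (fun s => F (false :: s)) + avg m' (fun s => F (true :: s))) / 2
  else F [::].

Lemma eq_avg m F G : (forall s, size s = m -> F s = G s) -> avg m F = avg m G.
Proof.
elim: m F G => [|m IH] F G h /=; first by apply: h.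
by congr ((_ + _) / 2); apply: IH => s sz; apply: h; rewrite /= sz.
Qed.

Lemma le_avg m F G : (forall s, size s = m -> F s <= G s) -> avg m F <= avg m G.
Proof.
elim: m F G => [|m IH] F G h /=; first by apply: h.
by rewrite ler_pM2r ?invr_gt0 ?ltr0n //; apply: lerD; apply: IH => s sz; apply: h; rewrite /= sz.
Qed.

Lemma avg_cat a b F : avg (a + b) F = avg a (fun u => avg b (fun v => F (u ++ v))).
Proof. by elim: a F => //= a IH F; rewrite !IH. Qed.

Lemma avgD m F G : avg m (fun s => F s + G s) = avg m F + avg m G.
Proof. by elim: m F G => //= m IH F G; rewrite !IH; field. Qed.

Lemma avgZ m a F : avg m (fun s => a * F s) = a * avg m F.
Proof. by elim: m F => //= m IH F; rewrite !IH; field. Qed.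

Lemma avg_const m a : avg m (fun=> a) = a.
Proof. by elim: m => //= m IH; rewrite !IH; field. Qed.

Lemma avg_tuple m F : avg m F = (\sum_(w : m.-tuple bool) F w) / 2 ^+ m.
Proof.
elim: m F => [|m IH] F.
  rewrite expr0 divr1 (bigD1 [tuple]) //= big1 ?addr0 // => w /eqP[].
  exact: tuple0.
rewrite /= !IH -mulrDl -mulrA -invfM -exprSr; congr (_ / _).
pose h (p : bool * m.-tuple bool) : m.+1.-tuple bool := [tuple of p.1 :: p.2].
rewrite (reindex h) /=; last first.
  exists (fun w : m.+1.-tuple bool => (thead w, [tuple of behead w])) => [[c w] _|w _].
    rewrite /h /=; congr (_, _); exact: val_inj.
  by rewrite [RHS]tuple_eta; exact: val_inj.
by rewrite -(pair_bigA _ (fun c (w : m.-tuple bool) => F (c :: w))) big_bool addrC.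
Qed.

(* The binary number read off the first [min c b] bits of [g]; all [b] bits are consumed. *)
Fixpoint rbits (c : nat) (g : nat -> bool) (b : nat) : nat :=
  if b is b'.+1 then
    if (b' < c)%N then (rbits c g b' + rbits c g b' + g b')%N else rbits c g b'
  else 0%N.

Lemma eq_rbits c g g' b : (forall k, (k < b)%N -> g k = g' k) -> rbits c g b = rbits c g' b.
Proof.
elim: b => //= b IH h; rewrite IH => [|k kb]; first by rewrite h.
by apply: h; rewrite ltnW.
Qed.

Lemma rbits_ge c g b : (c <= b)%N -> rbits c g b = rbits c g c.
Proof.
move=> /subnKC <-; elim: (b - c)%N => [|k IH]; rewrite ?addn0 // addnS /= IH.
by rewrite ltnNge leq_addr.
Qed.

Lemma rbits_le c c' g b : (b <= c)%N -> (b <= c')%N -> rbits c g b = rbits c' g b.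
Proof.
elim: b => //= b IH bc bc'; rewrite bc bc' IH //; exact: ltnW.
Qed.

Lemma sum_double n (F : nat -> R) :
  \sum_(v < n + n) F v = \sum_(v < n) (F (v + v)%N + F (v + v + 1)%N).
Proof.
elim: n => [|n IH]; first by rewrite !big_ord0.
by rewrite addnS addSn !big_ord_recr /= IH -addrA addn1.
Qed.

Lemma avg_rbits_full c (F : nat -> R) :
  avg c (fun s => F (rbits c (nth false s) c)) = (\sum_(v < 2 ^ c) F v) / 2 ^+ c.
Proof.
elim: c F => [|c IH] F; first by rewrite big_ord_recl big_ord0 addr0 divr1.
rewrite -{1}addn1 avg_cat.
rewrite (eq_avg (G := fun s => (F (rbits c (nth false s) c + rbits c (nth false s) c)%N +
   F (rbits c (nth false s) c + rbits c (nth false s) c + 1)%N) / 2)); last first.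
  move=> s sz /=; rewrite ltnSn !nth_cat sz ltnn subnn /=.
  have e b : rbits c.+1 (nth false (s ++ [:: b])) c = rbits c (nth false s) c.
    rewrite (rbits_le (c' := c)) //; apply: eq_rbits => k kc.
    by rewrite nth_cat sz kc.
  by rewrite !e addn0.
rewrite (IH (fun v => (F (v + v)%N + F (v + v + 1)%N) / 2)) expnS mul2n -addnn sum_double.
by rewrite -mulr_suml exprSr invfM mulrAC mulrA.
Qed.

Lemma avg_rbits c b (F : nat -> R) : (c <= b)%N ->
  avg b (fun s => F (rbits c (nth false s) b)) = (\sum_(v < 2 ^ c) F v) / 2 ^+ c.
Proof.
move=> cb; rewrite -avg_rbits_full -{1}(subnKC cb) avg_cat; apply: eq_avg => s sz.
rewrite (eq_avg (G := fun=> F (rbits c (nth false s) c))) ?avg_const // => v _.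
by rewrite rbits_ge //; congr F; apply: eq_rbits => k kc; rewrite nth_cat sz kc.
Qed.

(** Scale, row, column and side are read from consecutive blocks of lengths L, L, L and 1, whatever
    the scale is, so every iteration consumes the same number of bits. *)
Definition draw_scale (Lam L : nat) (g : nat -> bool) := rbits Lam g L.
Definition draw_row (m L : nat) (g : nat -> bool) := rbits m (fun k => g (L + k)%N) L.
Definition draw_col (m L : nat) (g : nat -> bool) := rbits m (fun k => g (L + L + k)%N) L.
Definition draw_side (L : nat) (g : nat -> bool) := g (L + L + L)%N.

(** The second and third conditions say that [m] is the ceiling of log2 (i+j+1). The last one means
    i+j <= n-1, or i+j <= n-2 on the mirrored side. Hence each entry of the matrix arises from
    exactly one accepted (m, i, j, side), and the main anti-diagonal belongs to the unmirrored
    side. *)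
Definition accept (n L m i j : nat) (side : bool) : bool :=
  [&& (m <= L)%N, (i + j < 2 ^ m)%N, (2 ^ m < 2 * (i + j + 1))%N &
    (i + j + 1 + side <= n)%N].

Definition mirror (n : nat) (side : bool) (i : nat) : nat := if side then (n - 1 - i)%N else i.

Definition sampled (T : Type) (n L Lam : nat) (g : nat -> bool) (F : nat -> nat -> nat -> T) (z : T) : T :=
  let m := draw_scale Lam L g in
  let i := draw_row m L g in
  let j := draw_col m L g in
  let side := draw_side L g in
  if accept n L m i j side then F m (mirror n side i) (mirror n side j) else z.

(** Independence of the blocks. A scale above [L] must contribute 0, since [L] bits are too few for
    a uniform index below 2^m. *)
Lemma avg_blocks L (F : nat -> nat -> nat -> bool -> R) Lam :
  (Lam <= L)%N ->
  (forall m i j b, (L < m)%N -> F m i j b = 0) ->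
  avg (L + (L + (L + 1))) (fun s => let g := nth false s in
     let m := draw_scale Lam L g in
     F m (draw_row m L g) (draw_col m L g) (draw_side L g)) =
  (\sum_(m < 2 ^ Lam) (\sum_(i < 2 ^ m) \sum_(j < 2 ^ m) (F m i j false + F m i j true))
     / 4 ^+ m) / (2 * 2 ^+ Lam).
Proof.
move=> LL F0; rewrite avg_cat.
pose F1 m := (\sum_(i < 2 ^ m) \sum_(j < 2 ^ m) (F m i j false + F m i j true)) / 4 ^+ m / 2.
pose F2 m i := (\sum_(j < 2 ^ m) (F m i j false + F m i j true)) / 2 ^+ m / 2.
pose F3 m i j := (F m i j false + F m i j true) / 2.
rewrite (eq_avg (G := fun s => F1 (rbits Lam (nth false s) L))).
  by rewrite (avg_rbits F1) // -mulr_suml invfM mulrA.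
move=> s sz /=.
have em t : size t = (L + (L + 1))%N -> draw_scale Lam L (nth false (s ++ t)) = rbits Lam (nth false s) L.
  by move=> _; apply: eq_rbits => k kL; rewrite nth_cat sz kL.
set m := rbits Lam (nth false s) L in em *.
rewrite (eq_avg (G := fun t => F m (draw_row m L (nth false (s ++ t))) (draw_col m L (nth false (s ++ t)))
    (draw_side L (nth false (s ++ t))))) => [|t st]; last by rewrite em.
have [mL|Lm] := leqP m L; last first.
  rewrite (eq_avg (G := fun=> 0)) ?avg_const => [|t _]; last by rewrite F0.
  by rewrite /F1 big1 ?mul0r // => i _; rewrite big1 // => j _; rewrite !F0 ?addr0.
rewrite avg_cat (eq_avg (G := fun t => F2 m (rbits m (nth false t) L))).
  rewrite (avg_rbits (F2 m)) // /F2 /F1 -!mulr_suml.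
  have -> : 4 = 2 * 2 :> R by ring.
  by rewrite exprMn invfM; ring.
move=> t st /=.
rewrite avg_cat (eq_avg (G := fun v => F3 m (rbits m (nth false t) L) (rbits m (nth false v) L))).
  by rewrite (avg_rbits (F3 m _)) // -!mulr_suml mulrAC.
move=> v sv /=.
have ei b : draw_row m L (nth false (s ++ t ++ v ++ [:: b])) = rbits m (nth false t) L.
  apply: eq_rbits => k kL; rewrite nth_cat sz ltnNge leq_addr /= addKn.
  by rewrite nth_cat st kL.
have ej b : draw_col m L (nth false (s ++ t ++ v ++ [:: b])) = rbits m (nth false v) L.
  apply: eq_rbits => k kL; rewrite -addnA nth_cat sz ltnNge leq_addr /= addKn.
  rewrite nth_cat st ltnNge leq_addr /= addKn.
  by rewrite nth_cat sv kL.
have eb b : draw_side L (nth false (s ++ t ++ v ++ [:: b])) = b.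
  rewrite /draw_side -addnA nth_cat sz ltnNge leq_addr /= addKn.
  rewrite nth_cat st ltnNge leq_addr /= addKn.
  by rewrite nth_cat sv ltnn subnn.
by rewrite !ei !ej !eb.
Qed.

(** After the sums are exchanged, a given position is accepted only at the scale
    [up_log 2 (i + j + 1)], which is at most [L]. *)
Lemma sum_scales n L (side : bool) (h : nat -> nat -> R) :
  (n <= 2 ^ L)%N ->
  \sum_(m < L.+1) \sum_(i < 2 ^ m) \sum_(j < 2 ^ m)
     (if accept n L m i j side then h i j else 0) =
  \sum_(i < n) \sum_(j < n) (if (i + j + 1 + side <= n)%N then h i j else 0).
Proof.
move=> nL.
have ext (k N : nat) (P : nat -> bool) (F : nat -> R) : (k <= N)%N ->
    (forall i, P i -> (i < k)%N) ->
    \sum_(i < k) (if P i then F i else 0) = \sum_(i < N) (if P i then F i else 0).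
  move=> kN Pk; rewrite (big_ord_widen N (fun i => if P i then F i else 0) kN).
  rewrite [RHS](bigID (fun i : 'I_N => (i < k)%N)) /= [X in _ + X]big1 ?addr0 // => i.
  by case: ifP => // /Pk ->.
pose N := (2 ^ L)%N.
have step (m : 'I_L.+1) : \sum_(i < 2 ^ m) \sum_(j < 2 ^ m) (if accept n L m i j side then h i j else 0)
   = \sum_(i < N) \sum_(j < N) (if accept n L m i j side then h i j else 0).
  have mN : (2 ^ m <= N)%N by rewrite leq_pexp2l // -ltnS.
  rewrite (eq_bigr (fun i : 'I__ => if (i < 2 ^ m)%N then \sum_(j < N) (if accept n L m i j side then h i j else 0) else 0)).
    rewrite (@ext _ N (fun i => i < 2 ^ m)%N (fun i => \sum_(j < N) (if accept n L m i j side then h i j else 0))) //.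
    apply: eq_bigr => i _; case: ifP => // ni; rewrite big1 // => j _.
    case: ifP => // /and4P[_ a _ _]; move: ni; rewrite ltnNge => /negbFE.
    by move=> le_i; exfalso; lia.
  move=> i _; rewrite ltn_ord; apply: (@ext _ N (fun j => accept n L m i j side) (h i)) => // j /and4P[_ a _ _]; lia.
rewrite (eq_bigr _ (fun m _ => step m)) exchange_big /=.
have inner (i : 'I_N) : \sum_(m < L.+1) \sum_(j < N) (if accept n L m i j side then h i j else 0)
    = \sum_(j < N) (if (i + j + 1 + side <= n)%N then h i j else 0).
  rewrite exchange_big; apply: eq_bigr => j _ /=.
  case: ifP => hij; last by rewrite big1 // => m _; rewrite /accept hij !andbF.
  have k0 : (0 < i + j + 1)%N by rewrite addn1.
  have := up_logP (i + j + 1)%N (isT : (1 < 2)%N).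
  have := @up_log_gtn 2 (i + j + 1)%N.
  set e := up_log 2 (i + j + 1) => lo hi.
  have eL : (e < L.+1)%N by rewrite ltnS; apply: up_log_min => //; lia.
  rewrite (bigD1 (Ordinal eL)) //= /accept big1 => [|m].
    rewrite hij -(ltnS e) eL.
    have -> : (i + j < 2 ^ e)%N by lia.
    have -> : (2 ^ e < 2 * (i + j + 1))%N.
      have [e0|ep] := posnP e; first by rewrite e0; lia.
      case: (leqP (i + j + 1) 1) => [h1|h1].
        have : (e <= 0)%N by apply: up_log_min => //; lia.
        by rewrite leqNgt ep.
      have := lo isT h1; rewrite -(ltn_pmul2l (isT : 0 < 2)%N) -expnS prednK //.
    by rewrite addr0.
  rewrite -val_eqE /= => ne; case: ifP => // /and4P[_ a b _]; exfalso.
  have me : (e <= m)%N by apply: up_log_min => //; lia.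
  have ml : (e < m)%N by rewrite ltn_neqAle eq_sym ne.
  have : (2 * 2 ^ e <= 2 ^ m)%N by rewrite -expnS leq_pexp2l.
  by lia.
rewrite (eq_bigr _ (fun i _ => inner i)).
rewrite [LHS](eq_bigr (fun i : 'I_N => if (i < n)%N then \sum_(j < N) (if (i + j + 1 + side <= n)%N then h i j else 0) else 0)); last first.
  move=> i _; case: ifP => // ni; rewrite big1 // => j _; case: ifP => // hh; exfalso; lia.
rewrite -(@ext n N (fun i => i < n)%N (fun i => \sum_(j < N) (if (i + j + 1 + side <= n)%N then h i j else 0))) //.
apply: eq_bigr => i _; rewrite ltn_ord; apply/esym/(@ext _ _ (fun j => (i + j + 1 + side <= n)%N) (h i)) => // j hh; lia.
Qed.

(** An entry of scale [m] is drawn with probability 1 / (2 * 2^Lam * 4^m), which the weight 4^m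
    cancels; rejected draws count as 0. *)
Lemma avg_sampled n L Lam (h : nat -> nat -> R) :
  (Lam <= L)%N -> (L < 2 ^ Lam)%N -> (n <= 2 ^ L)%N ->
  avg (L + (L + (L + 1)))
    (fun s => sampled n L Lam (nth false s) (fun m i j => 4 ^+ m * h i j) 0) =
  (\sum_(i < n) \sum_(j < n) h i j) / (2 * 2 ^+ Lam).
Proof.
move=> LL Ll nL.
pose F m i j b := if accept n L m i j b then 4 ^+ m * h (mirror n b i) (mirror n b j) else 0.
have F0 m i j b : (L < m)%N -> F m i j b = 0 by move=> Lm; rewrite /F /accept [(m <= L)%N]leqNgt Lm.
rewrite [LHS](avg_blocks LL F0); congr (_ / _).
pose X (m : nat) : R := \sum_(i < 2 ^ m) \sum_(j < 2 ^ m)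
  ((if accept n L m i j false then h i j else 0) +
   (if accept n L m i j true then h (mirror n true i) (mirror n true j) else 0)).
rewrite (eq_bigr (fun m : 'I__ => X m)) => [|m _]; last first.
  rewrite mulr_suml; apply: eq_bigr => i _; rewrite mulr_suml; apply: eq_bigr => j _.
  have n0 : 4 ^+ m != 0 :> R by rewrite expf_neq0 // pnatr_eq0.
  by rewrite /F /=; do 2?case: ifP => _; rewrite ?addr0 ?add0r -?mulrDr ?mul0r // mulrAC divff ?mul1r.
rewrite -(subnKC Ll) big_split_ord /= [X in _ + X]big1 ?addr0 => [|m _]; last first.
  rewrite /X big1 // => i _; rewrite big1 // => j _.
  have acc0 : forall b, accept n L (L.+1 + m) i j b = false by move=> b; rewrite /accept; case: leqP => //; lia.
  by rewrite !acc0 addr0.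
rewrite /X; under eq_bigr => m _ do under eq_bigr => i _ do rewrite big_split.
under eq_bigr => m _ do rewrite big_split.
rewrite big_split /= (sum_scales false h nL).
rewrite (sum_scales true (fun i j => h (mirror n true i) (mirror n true j)) nL).
have -> : \sum_(i < n) \sum_(j < n) (if (i + j + 1 + true <= n)%N then
    h (mirror n true i) (mirror n true j) else 0) =
    \sum_(i < n) \sum_(j < n) (if (i + j + 1 + false <= n)%N then 0 else h i j).
  rewrite [LHS](reindex_inj rev_ord_inj); apply: eq_bigr => i _.
  rewrite [LHS](reindex_inj rev_ord_inj); apply: eq_bigr => j _ /=.
  have li := ltn_ord i; have lj := ltn_ord j.
  have -> : (n - i.+1 + (n - j.+1) + 1 + true <= n)%N = ~~ (i + j + 1 + false <= n)%N by lia.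
  rewrite if_neg; case: ifP => // _; rewrite /mirror.
  have -> : (n - 1 - (n - i.+1) = i)%N by lia.
  by have -> : (n - 1 - (n - j.+1) = j)%N by lia.
rewrite -big_split; apply: eq_bigr => i _; rewrite -big_split; apply: eq_bigr => j _ /=.
by case: ifP; rewrite ?addr0 ?add0r.
Qed.

Lemma markov_coins T (F : seq bool -> R) (A : R) :
  (forall s, 0 <= F s) -> avg T F <= A ->
  9 / 10 <= coin_prob R (fun w : T.-tuple bool => F w <= 10 * A).
Proof.
move=> F0; rewrite avg_tuple /coin_prob.
have p2 : 0 < 2 ^+ T :> R by rewrite exprn_gt0.
rewrite ler_pdivrMr // => hA; rewrite ler_pdivlMr //.
set S := [set w | _].
have cardT : (#|S| + #|~: S| = 2 ^ T)%N by rewrite cardsC card_tuple card_bool.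
have h : 10 * A * #|~: S|%:R <= A * 2 ^+ T.
  apply: le_trans hA; rewrite (bigID (mem (~: S))) /=.
  apply: le_trans (_ : \sum_(w in ~: S) F w <= _); last first.
    by rewrite lerDl sumr_ge0.
  rewrite mulr_natr -[leLHS]sumr_const; apply: ler_sum => w.
  by rewrite !inE -ltNge => /ltW.
have cR : #|S|%:R = 2 ^+ T - #|~: S|%:R :> R.
  by rewrite -natrX -cardT natrD addrK.
have A0 : 0 <= A.
  have : 0 <= A * 2 ^+ T by apply: le_trans hA; apply: sumr_ge0.
  by rewrite pmulr_lge0.
(* The bound on the complement cannot be divided by A = 0; in that case F vanishes everywhere and
   the event is certain. *)
rewrite cR; move: A0; rewrite le_eqVlt => /orP[/eqP A0|Ap].
  suff -> : ~: S = set0 by rewrite cards0; lra.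
  apply/setP => w; rewrite !inE -A0 mulr0; apply/negbTE; rewrite negbK.
  move: hA; rewrite -A0 mul0r => hA.
  apply: le_trans hA; rewrite (bigD1 w) //= lerDl; exact: sumr_ge0.
have : A * (10 * #|~: S|%:R) <= A * 2 ^+ T by move: h; apply: etrans; congr (_ <= _); ring.
rewrite ler_pM2l //; lra.
Qed.

Lemma coin_prob_le T (P Q : pred (T.-tuple bool)) :
  (forall w, P w -> Q w) -> coin_prob R P <= coin_prob R Q.
Proof.
move=> PQ; rewrite ler_pM2r ?invr_gt0 ?exprn_gt0 // ler_nat subset_leq_card //.
by apply/subsetP => w; rewrite !inE; exact: PQ.
Qed.

End Coins.

(** * Stochastic projection *)

Section Descent.
Variable R : realType.

Lemma eq_gram_kernel r (G G' : nat -> nat -> R) l : G =2 G' ->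
  gram_kernel r G l =2 gram_kernel r G' l.
Proof.
move=> e; elim: l => //= l IH a b.
have ed c : gram_dir r G (gram_kernel r G l) l c = gram_dir r G' (gram_kernel r G' l) l c.
  by congr (_ - _); apply: eq_bigr => k _; rewrite IH e.
rewrite IH !ed; congr (_ + _ / _); apply: eq_bigr => k _; by rewrite ed e.
Qed.

Lemma pow4E m : 4 ^+ m = (2 ^ m)%:R * (2 ^ m)%:R :> R.
Proof. by rewrite -natrM -expnMn natrX. Qed.

(** The product of two exponentials in i+j separates into a factor in i and a factor in j, so their
    inner product is the square of a geometric sum. *)
Definition gramx (n : nat) (x : nat -> R) (a b : nat) : R :=
  (\sum_(i < n) (x a * x b) ^+ i) * (\sum_(i < n) (x a * x b) ^+ i).

Lemma dot_expmx n (x : nat -> R) a b : dot (@expmx R n x a) (@expmx R n x b) = gramx n x a b.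
Proof.
rewrite /dot -(pair_bigA _ (fun i j : 'I_n => expmx x a (i, j) * expmx x b (i, j))) /=.
rewrite /gramx mulr_suml; apply: eq_bigr => i _; rewrite mulr_sumr; apply: eq_bigr => j _.
by rewrite /expmx /= -!exprMn exprD.
Qed.

Variables (n r L Lam : nat) (x : nat -> R) (B : nat -> nat -> R).
Hypotheses (r0 : (0 < r)%N) (LamL : (Lam <= L)%N) (LLam : (L < 2 ^ Lam)%N) (nL : (n <= 2 ^ L)%N).

Let K := gram_kernel r (gramx n x) r.
Let u := @expmx R n x.
Let kap := rkernel r u.

(** A multiple of the kernel row at (i, j) is added to the current function. The factor 4^m undoes
    the sampling probability; 16 r bounds 4^m times the leverage, because 2^m < 2 depth at accepted
    scales and the leverage is at most 4 r / depth^2. *)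
Definition sgd_update (c : nat -> R) (m i j a : nat) : R :=
  c a + (B i j - expsum r x c (i + j)) * ((2 ^ m)%:R * (2 ^ m)%:R) / (16 * r%:R) *
    \sum_(b < r) K a b * x b ^+ (i + j).

Definition sgd_step (c : nat -> R) (g : nat -> bool) : nat -> R :=
  sampled n L Lam g (sgd_update c) c.

Definition sgd_bits : nat := (L + (L + (L + 1)))%N.

Fixpoint sgd_run (t : nat) (w : nat -> bool) : nat -> R :=
  if t is t'.+1 then sgd_step (sgd_run t' w) (fun k => w (t' * sgd_bits + k)%N) else fun=> 0.

Definition input_fun (p : 'I_n * 'I_n) : R := B p.1 p.2.
Definition proj_fun (p : 'I_n * 'I_n) : R := dot (kap p) input_fun.
Definition residual (p : 'I_n * 'I_n) : R := input_fun p - proj_fun p.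
Definition deviation (c : nat -> R) (p : 'I_n * 'I_n) : R := expsum r x c (p.1 + p.2) - proj_fun p.

(** The deviation lies in the span, so its inner product with the update direction is its value at
    the sampled entry. *)
Lemma kap_deviation c p : dot (kap p) (deviation c) = deviation c p.
Proof.
rewrite /deviation dotBr; congr (_ - _).
  exact: (rkernel_lincomb r u c p).
pose d a := \sum_(b < r) gram_kernel r (fun a b => dot (u a) (u b)) r a b * dot (u b) input_fun.
rewrite (eq_dot (f' := kap p) (g' := lincomb r u d)) //; last by move=> q; rewrite /proj_fun kernel_apply.
by rewrite rkernel_lincomb /proj_fun kernel_apply.
Qed.

Lemma sgd_update_expsum c m (p q : 'I_n * 'I_n) :
  deviation (sgd_update c m p.1 p.2) q =
  deviation c q + 4 ^+ m / (16 * r%:R) * (residual p - deviation c p) * kap p q.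
Proof.
rewrite /deviation /kap rkernelE /expsum /sgd_update.
under eq_bigr => a _ do rewrite mulrDl.
rewrite big_split /= addrAC; congr (_ + _).
rewrite /lincomb mulr_sumr; apply: eq_bigr => a _; rewrite [in RHS]mulrA; congr (_ * _).
have -> : \sum_(b < r) K a b * x b ^+ (p.1 + p.2) = \sum_(b < r) gram_kernel r (fun a b => dot (u a) (u b)) r a b * u b p.
  apply: eq_bigr => b _; congr (_ * _); apply: eq_gram_kernel => s t.
  by rewrite dot_expmx.
by congr (_ * _); rewrite /residual /input_fun pow4E /expsum; ring.
Qed.

(** Let a be the residual and b the deviation at [p]. A step of weight om changes the squared norm
    by 2 om (a-b) b + om^2 (a-b)^2 kap(p,p). Since om kap(p,p) <= 1, this is at most om (a^2 - b^2),
    which is linear in squares and hence averages well. *)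
Lemma sgd_update_err c m (p : 'I_n * 'I_n) : (2 ^ m < 2 * depth n (p.1 + p.2))%N ->
  dot (deviation (sgd_update c m p.1 p.2)) (deviation (sgd_update c m p.1 p.2)) <=
  dot (deviation c) (deviation c) +
    4 ^+ m * ((residual p ^+ 2 - deviation c p ^+ 2) / (16 * r%:R)).
Proof.
move=> hm.
set s := 4 ^+ m / (16 * r%:R) * (residual p - deviation c p).
rewrite (eq_dot (f' := fun q => deviation c q + s * kap p q) (g' := fun q => deviation c q + s * kap p q)); last 2 first.
- by move=> q; rewrite sgd_update_expsum.
- by move=> q; rewrite sgd_update_expsum.
rewrite dot_addZ rkernel_norm kap_deviation lerD2l.
have rp : 0 < r%:R :> R by rewrite ltr0n.
set om := 4 ^+ m / (16 * r%:R) in s *.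
have om0 : 0 <= om by rewrite divr_ge0 ?exprn_ge0 ?mulr_ge0.
have lev : om * kap p p <= 1.
  have := rkernel_leverage r x p; rewrite -/u -/kap.
  set dd := (depth _ _)%:R => lev; rewrite /om mulrAC ler_pdivrMr ?mulr_gt0 // mul1r.
  have : 4 ^+ m <= 4 * dd ^+ 2.
    rewrite pow4E -expr2.
    have -> : 4 * dd ^+ 2 = (2 * dd) ^+ 2 by ring.
    by rewrite lerXn2r ?nnegrE ?mulr_ge0 // -natrM ler_nat ltnW.
  have t0 : 0 <= kap p p by rewrite /kap -rkernel_norm dot_ge0.
  move=> /(ler_wpM2r t0) /le_trans; apply.
  have -> : 4 * dd ^+ 2 * kap p p = 4 * (kap p p * dd ^+ 2) by ring.
  have -> : 16 * r%:R = 4 * (4 * r%:R) :> R by ring.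
  by rewrite ler_wpM2l.
have -> : 4 ^+ m * ((residual p ^+ 2 - deviation c p ^+ 2) / (16 * r%:R)) = om * (residual p ^+ 2 - deviation c p ^+ 2).
  by rewrite /om; ring.
rewrite /s -[rkernel r u p p]/(kap p p); set a := residual p; set b := deviation c p.
have -> : 2 * (om * (a - b)) * b + (om * (a - b)) ^+ 2 * kap p p
   = om * (2 * (a - b) * b) + (om * (a - b) ^+ 2) * (om * kap p p) by ring.
apply: le_trans (_ : _ <= om * (2 * (a - b) * b) + om * (a - b) ^+ 2) _.
  by rewrite lerD2l ler_piMr // mulr_ge0 // sqr_ge0.
by rewrite le_eqVlt; apply/orP; left; apply/eqP; ring.
Qed.

(** The factor 1 / (16 r) of the step times the factor 1 / (2 * 2^Lam) of the sampling. *)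
Definition sgd_rate : R := (32 * r%:R * 2 ^+ Lam)^-1.

Lemma avg_sgd_step c :
  avg sgd_bits (fun s => dot (deviation (sgd_step c (nth false s))) (deviation (sgd_step c (nth false s)))) <=
  (1 - sgd_rate) * dot (deviation c) (deviation c) + sgd_rate * dot residual residual.
Proof.
(* The entrywise gain, extended by 0 to all pairs of natural numbers as the sampling average
   requires. *)
pose h i j : R := if insub (i, j).1 is Some i' then if insub (i, j).2 is Some j' then
   ((residual (i', j') ^+ 2 - deviation c (i', j') ^+ 2) / (16 * r%:R)) else 0 else 0.
have hE (p : 'I_n * 'I_n) : h p.1 p.2 = (residual p ^+ 2 - deviation c p ^+ 2) / (16 * r%:R).
  by rewrite /h !valK -surjective_pairing.
apply: le_trans (_ : avg sgd_bits (fun s => dot (deviation c) (deviation c) +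
   sampled n L Lam (nth false s) (fun m i j => 4 ^+ m * h i j) 0) <= _).
  apply: le_avg => s _; rewrite /sgd_step /sampled.
  case: ifP => [/and4P[mL a1 a2 a3]|_]; last by rewrite addr0.
  set m := draw_scale _ _ _ in mL a1 a2 a3 *; set i := draw_row _ _ _ in a1 a2 a3 *.
  set j := draw_col _ _ _ in a1 a2 a3 *; set b := draw_side _ _ in a3 *.
  have li : (mirror n b i < n)%N by rewrite /mirror; case: (b) a3 => a3; lia.
  have lj : (mirror n b j < n)%N by rewrite /mirror; case: (b) a3 => a3; lia.
  rewrite (hE (Ordinal li, Ordinal lj)).
  apply: (@sgd_update_err c m (Ordinal li, Ordinal lj)) => /=.
  apply: leq_trans a2 _; rewrite leq_mul2l /= /depth /mirror; case: (b) a3 => a3; lia.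
rewrite avgD avg_const avg_sampled // -/(dot _ _).
have -> : \sum_(i < n) \sum_(j < n) h i j = (dot residual residual - dot (deviation c) (deviation c)) / (16 * r%:R).
  rewrite pair_bigA /= (eq_bigr _ (fun p _ => hE p)) -mulr_suml sumrB.
  by congr ((_ - _) / _); apply: eq_bigr => p _; rewrite expr2.
have rn : r%:R != 0 :> R by rewrite pnatr_eq0 -lt0n.
have pn : 2 ^+ Lam != 0 :> R by rewrite expf_neq0 // pnatr_eq0.
rewrite le_eqVlt; apply/orP; left; apply/eqP; rewrite /sgd_rate; field.
by rewrite rn pn.
Qed.

Lemma eq_sampled (T : Type) g g' (F : nat -> nat -> nat -> T) z :
  (forall k, (k < sgd_bits)%N -> g k = g' k) -> sampled n L Lam g F z = sampled n L Lam g' F z.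
Proof.
rewrite /sgd_bits => e; rewrite /sampled.
have -> : draw_scale Lam L g = draw_scale Lam L g' by apply: eq_rbits => k kL; apply: e; lia.
have e2 m : draw_row m L g = draw_row m L g' by apply: eq_rbits => k kL; apply: e; lia.
have e3 m : draw_col m L g = draw_col m L g' by apply: eq_rbits => k kL; apply: e; lia.
have -> : draw_side L g = draw_side L g' by apply: e; lia.
by rewrite !e2 !e3.
Qed.

Lemma eq_sgd_run t w w' : (forall k, (k < t * sgd_bits)%N -> w k = w' k) -> sgd_run t w = sgd_run t w'.
Proof.
elim: t => //= t IH e; rewrite IH => [|k kt]; last by apply: e; rewrite mulSn; lia.
by apply: eq_sampled => k kb; apply: e; rewrite mulSn; lia.
Qed.

Definition start_err := dot (deviation (fun=> 0)) (deviation (fun=> 0)).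

Lemma sgd_rate_bounds : 0 < sgd_rate <= 1.
Proof.
have p : 0 < 32 * r%:R * 2 ^+ Lam :> R by rewrite !mulr_gt0 ?exprn_gt0 // ltr0n.
rewrite invr_gt0 p /= invf_le1 // -natrX -!natrM ler1n !muln_gt0 r0 expn_gt0 //.
Qed.

(** The squared norm of the residual is a fixed point of the one-step bound, so the noise does not
    accumulate over the iterations. *)
Lemma avg_sgd_run t :
  avg (t * sgd_bits) (fun s => dot (deviation (sgd_run t (nth false s))) (deviation (sgd_run t (nth false s)))) <=
  (1 - sgd_rate) ^+ t * start_err + dot residual residual.
Proof.
have /andP[e0 e1] := sgd_rate_bounds.
elim: t => [|t IH]; first by rewrite /= expr0 mul1r lerDl dot_ge0.
rewrite mulSn addnC avg_cat.
pose Phi s := dot (deviation (sgd_run t (nth false s))) (deviation (sgd_run t (nth false s))).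
apply: le_trans (_ : avg (t * sgd_bits) (fun s => (1 - sgd_rate) * Phi s + sgd_rate * dot residual residual) <= _).
  apply: le_avg => s sz.
  rewrite (eq_avg (G := fun v => dot (deviation (sgd_step (sgd_run t (nth false s)) (nth false v)))
     (deviation (sgd_step (sgd_run t (nth false s)) (nth false v))))); first exact: avg_sgd_step.
  move=> v sv /=.
  have -> : sgd_run t (nth false (s ++ v)) = sgd_run t (nth false s).
    by apply: eq_sgd_run => k kt; rewrite nth_cat sz kt.
  have -> // : sgd_step (sgd_run t (nth false s)) (fun k => nth false (s ++ v) (t * sgd_bits + k)) =
    sgd_step (sgd_run t (nth false s)) (nth false v).
  by apply: eq_sampled => k kb; rewrite nth_cat sz ltnNge leq_addr /= addKn.
rewrite avgD avg_const avgZ.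
have IH' : avg (t * sgd_bits) Phi <= (1 - sgd_rate) ^+ t * start_err + dot residual residual by [].
have e1' : 0 <= 1 - sgd_rate by rewrite subr_ge0.
have h := ler_wpM2l e1' IH'.
apply: le_trans (_ : _ <= (1 - sgd_rate) * ((1 - sgd_rate) ^+ t * start_err + dot residual residual) +
  sgd_rate * dot residual residual) _; first by rewrite lerD2r; exact: h.
rewrite exprS.
by rewrite le_eqVlt; apply/orP; left; apply/eqP; ring.
Qed.

Lemma sgd_run_prob t T : (t * sgd_bits <= T)%N ->
  9 / 10 <= coin_prob R (fun w : T.-tuple bool =>
    dot (deviation (sgd_run t (nth false w))) (deviation (sgd_run t (nth false w))) <=
      10 * ((1 - sgd_rate) ^+ t * start_err + dot residual residual)).
Proof.
move=> tT.
apply: (@markov_coins _ T (fun s => dot (deviation (sgd_run t (nth false s))) (deviation (sgd_run t (nth false s))))).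
  by move=> s; exact: dot_ge0.
rewrite -(subnKC tT) avg_cat.
rewrite (eq_avg (G := fun s => dot (deviation (sgd_run t (nth false s))) (deviation (sgd_run t (nth false s))))).
  exact: avg_sgd_run.
move=> s sz; rewrite (eq_avg (G := fun=> dot (deviation (sgd_run t (nth false s))) (deviation (sgd_run t (nth false s))))) ?avg_const // => v _.
have -> // : sgd_run t (nth false (s ++ v)) = sgd_run t (nth false s).
by apply: eq_sgd_run => k kt; rewrite nth_cat sz kt.
Qed.

End Descent.

(** * Moments of Hankel matrices *)

Section Moments.
Variable R : realType.

Lemma diag_mxX (F : comNzRingType) n (d : 'rV[F]_n.+1) k :
  diag_mx d ^+ k = diag_mx (\row_j d 0 j ^+ k).
Proof.
elim: k => [|k IH].
  by rewrite expr0 -[1]/(1%:M) -diag_const_mx; congr diag_mx; apply/rowP => j; rewrite !mxE.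
by rewrite exprS IH -[_ * _]/(_ *m _) mulmx_diag; congr diag_mx; apply/rowP => j; rewrite !mxE exprS.
Qed.

(** The spectral measure of [S] at [u]: after diagonalisation over the complex numbers, the weights
    are the squared moduli of the coordinates of [u], and the eigenvalues are real because [S] is
    hermitian. *)
Lemma sym_moments n (S : 'M[R]_n.+1) (u : 'cV[R]_n.+1) : S^T = S ->
  exists m lam : 'I_n.+1 -> R, (forall a, 0 <= m a) /\
    forall k, (u^T *m S ^+ k *m u) 0 0 = \sum_a m a * lam a ^+ k.
Proof.
move=> symS.
pose f := real_complex R.
pose SC : 'M[R[i]]_n.+1 := map_mx f S.
have symC : SC \is symmetricmx.
  by apply/is_hermitianmxP; rewrite expr0 scale1r; apply/matrixP => i j; rewrite !mxE /= -{1}symS mxE.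
have realC : SC \is a realmx.
  by apply/mxOverP => i j; rewrite mxE complex_real.
have /orthomx_spectralP := symmetric_normalmx symC realC.
have := hermitian_spectral_diag_real (realsym_hermsym symC realC).
have := spectral_unitarymx SC; have := spectral_unit SC.
set P := spectralmx SC; set d := spectral_diag SC => unP unitP dreal SE.
pose v := P *m map_mx f u.
exists (fun a => complex.Re (`|v a 0| ^+ 2)), (fun a => complex.Re (d 0 a)); split.
  move=> a; have : 0 <= `|v a 0| ^+ 2 by rewrite exprn_ge0.
  by rewrite lecE => /andP[].
move=> k; apply: (@complexI R); rewrite rmorph_sum.
have mR a : (complex.Re (`|v a 0| ^+ 2))%:C%C = `|v a 0| ^+ 2.
  by rewrite RRe_real // realX // normr_real.
have dR a : (complex.Re (d 0 a))%:C%C = d 0 a by rewrite RRe_real //; exact: (mxOverP dreal).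
rewrite [RHS](eq_bigr (fun a => `|v a 0| ^+ 2 * d 0 a ^+ k)) => [|a _]; last first.
  by rewrite rmorphM rmorphXn; congr (_ * _ ^+ _); [exact: mR|exact: dR].
have SX : SC ^+ k = invmx P *m diag_mx d ^+ k *m P.
  elim: k => [|k IH]; first by rewrite !expr0 mulmx1 mulVmx.
  rewrite exprS IH {1}SE exprS -![_ * _]/(_ *m _) !mulmxA mulmxK //.
have -> : ((u^T *m S ^+ k *m u) 0 0)%:C%C = (map_mx f (u^T *m S ^+ k *m u)) 0 0 by rewrite [RHS]mxE.
rewrite !map_mxM rmorphXn /= -/SC SX diag_mxX.
have vt : (map_mx f u^T) *m invmx P = map_mx Num.conj v^T.
  rewrite invmx_unitary // /v trmx_mul map_mxM; congr (_ *m _).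
  by apply/matrixP => i j; rewrite !mxE; apply/esym/conj_Creal; rewrite complex_real.
rewrite !mulmxA vt -mulmxA -/v -mulmxA mul_diag_mx mxE; apply: eq_bigr => a _.
by rewrite !mxE normCK; ring.
Qed.

(** Elimination of the first coordinate: the Schur complement of the corner is again symmetric and
    positive definite. *)
Lemma cholesky n (H : 'M[R]_n) : H^T = H ->
  (forall x : 'cV_n, x != 0 -> 0 < (x^T *m H *m x) 0 0) ->
  exists G : 'M_n, H = G^T *m G.
Proof.
elim: n H => [|n IH] H symH pd; first by exists 0; apply/matrixP => - [].
pose H1 : 'M[R]_(1 + n) := H.
pose al := (ulsubmx H1) 0 0; pose b := dlsubmx H1; pose D := drsubmx H1.
have symH1 : H1^T = H1 by exact: symH.
have ulE : ulsubmx H1 = al%:M by rewrite [LHS]mx11_scalar.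
have urE : ursubmx H1 = b^T by rewrite /b trmx_dlsub symH1.
have HE : H1 = block_mx al%:M b^T b D by rewrite -ulE -urE submxK.
have symD : D^T = D by rewrite /D trmx_drsub symH1.
have al0 : 0 < al.
  pose x : 'cV[R]_(1 + n) := col_mx 1%:M 0.
  have x0 : x != 0.
    by apply/eqP => /matrixP /(_ (lshift n 0) 0) /eqP; rewrite col_mxEu !mxE eqxx oner_eq0.
  have : 0 < (x^T *m H1 *m x) 0 0 by exact: pd.
  rewrite HE /x tr_col_mx mul_row_block mul_row_col.
  by rewrite !trmx0 !trmx1 !mul0mx !mulmx0 !mul1mx !addr0 mulmx1 mxE eqxx mulr1n.
have aln : al != 0 by rewrite gt_eqF.
pose S := D - al^-1 *: (b *m b^T).
have [G' GE] : exists G' : 'M_n, S = G'^T *m G'.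
  apply: IH => [|y y0].
    by rewrite /S linearB /= linearZ /= trmx_mul trmxK symD.
  (* The first coordinate minimises the form for the given [y], and the minimum is the value of the
     Schur complement at [y]. *)
  pose x : 'cV_(1 + n) := col_mx (- al^-1 *: (b^T *m y)) y.
  have x0 : x != 0.
    apply: contra y0 => /eqP x0; apply/eqP.
    by rewrite -[y](col_mxKd (- al^-1 *: (b^T *m y))) -/x x0 linear0.
  have : 0 < (x^T *m H1 *m x) 0 0 by exact: pd.
  rewrite HE -mulmxA mul_block_col.
  rewrite mul_scalar_mx scalerA mulrN mulfV // scaleN1r addNr.
  rewrite -scalemxAr mulmxA scaleNr addrC scalemxAl -mulmxBl -/S.
  by rewrite tr_col_mx mul_row_col mulmx0 add0r mulmxA.
have sq : Num.sqrt al * Num.sqrt al = al by rewrite -expr2 sqr_sqrtr // ltW.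
have sqn : Num.sqrt al != 0 by rewrite gt_eqF // sqrtr_gt0.
pose G : 'M[R]_(1 + n) := block_mx (Num.sqrt al)%:M ((Num.sqrt al)^-1 *: b^T) 0 G'.
exists G; suff : H1 = G^T *m G by [].
rewrite HE /G tr_block_mx mulmx_block.
have -> : ((Num.sqrt al)^-1 *: b^T)^T = (Num.sqrt al)^-1 *: b.
  by apply/matrixP => i j; rewrite !mxE.
rewrite -GE trmx0 tr_scalar_mx !mul0mx !mulmx0 !addr0; congr block_mx.
- by rewrite -scalar_mxM sq.
- by rewrite mul_scalar_mx scalerA mulfV // scale1r.
- by rewrite mul_mx_scalar scalerA mulfV // scale1r.
- by rewrite -scalemxAl -scalemxAr scalerA -invfM sq /S addrC subrK.
Qed.

(** Since H is Hankel, the shift e_k -> e_(k+1) is symmetric for the inner product that H defines.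
    In the coordinates given by [G] it becomes a symmetric matrix [S] with G e_k = S^k u, so H_ij =
    u^T S^(i+j) u is a moment of the spectral measure. *)
Lemma hankel_pd_moments n (H : 'M[R]_n.+1) : hankel H -> H^T = H ->
  (forall x : 'cV_n.+1, x != 0 -> 0 < (x^T *m H *m x) 0 0) ->
  exists m lam : 'I_n.+1 -> R, (forall a, 0 <= m a) /\
    forall i j, H i j = \sum_a m a * lam a ^+ (i + j).
Proof.
move=> hk symH pd.
have [G GE] := cholesky symH pd.
have unH : H \in unitmx.
  rewrite -row_free_unit; apply: inj_row_free => v vH; apply/eqP.
  rewrite -[_ == 0]negbK; apply/negP => v0.
  have vt0 : v^T != 0 by apply: contra v0 => /eqP e; rewrite -[v]trmxK e trmx0.
  by have := pd _ vt0; rewrite trmxK vH mul0mx mxE ltxx.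
have unG : G \in unitmx by move: unH; rewrite GE unitmx_mul => /andP[].
(* The common value on anti-diagonal [k], read at one position inside the matrix. *)
pose h k : R := H (inord (minn k n)) (inord (k - minn k n)).
have hE (i j : 'I_n.+1) : H i j = h (i + j)%N.
  by have li := ltn_ord i; have lj := ltn_ord j; apply: hk; rewrite !inordK; lia.
(* The moment of order 2n+1 is free; we take 0. *)
pose H' : 'M[R]_n.+1 := \matrix_(i, j) if (i + j < n + n)%N then h (i + j).+1 else 0.
have symH' : H'^T = H' by apply/matrixP => i j; rewrite !mxE addnC.
pose S := (invmx G)^T *m H' *m invmx G.
have symS : S^T = S by rewrite /S !trmx_mul trmxK symH' mulmxA.
pose e (k : nat) : 'cV[R]_n.+1 := delta_mx (inord k) 0.
have Se k : (k < n)%N -> S *m (G *m e k) = G *m e k.+1.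
  move=> kn; rewrite /S -mulmxA (mulKmx unG).
  have -> : (invmx G)^T *m H' *m e k = (invmx G)^T *m (H *m e k.+1).
    rewrite -mulmxA; congr (_ *m _); rewrite -!colE; apply/colP => i; rewrite !mxE hE.
    have li := ltn_ord i.
    rewrite !inordK; [|lia|lia]; rewrite addnS ifT //; lia.
  by rewrite GE !mulmxA -trmx_mul mulmxV // trmx1 mul1mx.
pose u := G *m e 0.
have Su k : (k <= n)%N -> S ^+ k *m u = G *m e k.
  elim: k => [|k IH] kn; first by rewrite expr0 mul1mx.
  by rewrite exprS -[_ * _]/(_ *m _) -mulmxA IH ?Se // ltnW.
have [m [lam [m0 mE]]] := sym_moments u symS.
exists m, lam; split=> // i j; rewrite -mE.
have SXT k : (S ^+ k)^T = S ^+ k.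
  elim: k => [|k IH]; first by rewrite expr0 trmx1.
  by rewrite {1}exprS -[_ * _]/(_ *m _) trmx_mul IH symS exprSr.
have eE (k : 'I_n.+1) : G *m e k = S ^+ k *m u by rewrite Su // -ltnS.
have -> : u^T *m S ^+ (i + j) *m u = (G *m e i)^T *m (G *m e j).
  by rewrite (eE i) (eE j) [(S ^+ i *m u)^T]trmx_mul SXT exprD -[_ * _]/(_ *m _) !mulmxA.
rewrite trmx_mul -mulmxA [X in _ *m X]mulmxA -GE -[H *m e j]colE /e trmx_delta -rowE !mxE !inord_val //.
Qed.

End Moments.

(** * Approximation by fixed nodes *)

Section Interpolation.
Variable R : realType.

(** The coefficients are those of Lagrange interpolation at [x]. The remainder obeys a recursion in
    [d] and [k] of the shape of Pascal's rule, whence the binomial coefficient. *)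
Lemma interpolation_remainder (d : nat) (y : nat -> R) (x b th : R) :
  `|x| <= b -> 0 <= th ->
  (forall l, (l < d)%N -> `|y l| <= b) -> (forall l, (l < d)%N -> `|x - y l| <= th) ->
  (forall l l', (l < l')%N -> (l' < d)%N -> y l != y l') ->
  exists c : nat -> R, forall k,
    `|x ^+ k - expsum d y c k| <= 'C(k, d)%:R * b ^+ (k - d) * th ^+ d.
Proof.
move=> xb th0; have b0 : 0 <= b by apply: le_trans xb.
elim: d => [|d IH] yb yth yd.
  exists (fun=> 0) => k; rewrite /expsum big_ord0 subr0 bin0 expr0 mulr1 mul1r subn0 normrX.
  by rewrite lerXn2r ?nnegrE.
have [|||c hc] := IH.
- by move=> l ld; apply: yb; exact: ltnW.
- by move=> l ld; apply: yth; exact: ltnW.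
- by move=> l l' ll ld; apply: yd => //; exact: ltnW.
(* One more node rescales the old coefficients; the new one makes the sum equal to 1, so that k = 0
   is exact. *)
pose e l := c l * (x - y d) / (y l - y d).
pose c' l := if (l < d)%N then e l else 1 - \sum_(l < d) e l.
have cE k : expsum d.+1 y c' k = \sum_(l < d) e l * y l ^+ k + (1 - \sum_(l < d) e l) * y d ^+ k.
  rewrite /expsum big_ord_recr /= {2}/c' ltnn; congr (_ + _).
  by apply: eq_bigr => l _; rewrite /c' ltn_ord.
exists c'; elim=> [|k IHk].
  rewrite cE expr0 mulr1; under eq_bigr => l _ do rewrite expr0 mulr1.
  rewrite [X in 1 - X](_ : _ = 1); last by ring.
  by rewrite subrr normr0 bin0n !mul0r.
have rec : x ^+ k.+1 - expsum d.+1 y c' k.+1 =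
    (x - y d) * (x ^+ k - expsum d y c k) + y d * (x ^+ k - expsum d.+1 y c' k).
  have h : \sum_(l < d) e l * y l ^+ k.+1 - y d * \sum_(l < d) e l * y l ^+ k = (x - y d) * expsum d y c k.
    rewrite /expsum !mulr_sumr -sumrB; apply: eq_bigr => l _; rewrite /e exprS.
    have : y l - y d != 0 by rewrite subr_eq0 yd.
    by move=> ?; field.
  rewrite !cE !exprS; move: h; set E1 := \sum_(l < d) e l * y l ^+ k.+1.
  set E0 := \sum_(l < d) e l * y l ^+ k => h.
  have -> : E1 = (x - y d) * expsum d y c k + y d * E0 by rewrite -h subrK.
  ring.
rewrite rec; apply: le_trans (ler_normD _ _) _; rewrite !normrM subSS.
apply: le_trans (_ : _ <= th * ('C(k, d)%:R * b ^+ (k - d) * th ^+ d) +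
    b * ('C(k, d.+1)%:R * b ^+ (k - d.+1) * th ^+ d.+1)) _.
  by apply: lerD; apply: ler_pM => //; [exact: yth|exact: yb].
rewrite le_eqVlt; apply/orP; left; apply/eqP.
rewrite binS natrD exprS; have [kd|dk] := leqP k d.
  by rewrite (bin_small (n := k) (m := d.+1)) //; ring.
have -> : (k - d = (k - d.+1).+1)%N by lia.
rewrite !exprS; ring.
Qed.

(** As 1 - de <= (1 - de/2)^2, half of the decay pays for the binomial coefficient: C(k,d) (1 -
    de/2)^(k-d) (de/2)^d is a probability. There remains (1 - de/2)^(k-d) 2^-d, and 1/2 <= 5/6 (1 -
    de/2) because de <= 4/5. This is the origin of the rate 5/6. *)
Lemma binomial_tail (k d : nat) (de : R) : 0 <= de <= 4 / 5 ->
  'C(k, d)%:R * (1 - de) ^+ (k - d) * (de / 4) ^+ d <= (5 / 6) ^+ d * (1 - de / 2) ^+ k.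
Proof.
move=> /andP[d0 d1].
have q0 : 0 <= 1 - de / 2 by lra.
have [kd|dk] := ltnP k d.
  by rewrite bin_small // !mul0r mulr_ge0 // exprn_ge0 //; lra.
set y := 1 - de / 2 in q0 *.
have bin1 : 'C(k, d)%:R * (y ^+ (k - d) * (de / 2) ^+ d) <= 1.
  have y1 : (y + de / 2) ^+ k = 1 by rewrite /y subrK expr1n.
  rewrite -[leRHS]y1 [(y + _) ^+ k]exprDn; have dk1 : (d < k.+1)%N by [].
  rewrite (bigD1 (Ordinal dk1)) //= -[X in _ <= X + _]mulr_natl lerDl; apply: sumr_ge0 => i _.
  by rewrite mulrn_wge0 // mulr_ge0 // exprn_ge0 //; lra.
apply: le_trans (_ : _ <= 'C(k, d)%:R * (y ^+ 2) ^+ (k - d) * (de / 4) ^+ d) _.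
  rewrite ler_wpM2r ?exprn_ge0 //; first lra.
  rewrite ler_wpM2l // lerXn2r ?nnegrE //; [lra|exact: sqr_ge0|].
  rewrite /y expr2; nra.
have -> : 'C(k, d)%:R * (y ^+ 2) ^+ (k - d) * (de / 4) ^+ d =
   ('C(k, d)%:R * (y ^+ (k - d) * (de / 2) ^+ d)) * (y ^+ (k - d) * 2^-1 ^+ d).
  have -> : (y ^+ 2) ^+ (k - d) = y ^+ (k - d) * y ^+ (k - d) by rewrite expr2 exprMn.
  have -> : (de / 4) ^+ d = (de / 2) ^+ d * 2^-1 ^+ d by rewrite -exprMn; congr (_ ^+ _); field.
  ring.
have y0 : 0 <= y ^+ (k - d) * 2^-1 ^+ d by rewrite mulr_ge0 ?exprn_ge0 // invr_ge0.
apply: le_trans (ler_wpM2r y0 bin1) _; rewrite mul1r.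
have -> : y ^+ k = y ^+ (k - d) * y ^+ d by rewrite -exprD subnK.
rewrite mulrCA ler_wpM2l ?exprn_ge0 // -exprMn lerXn2r ?nnegrE //; rewrite ?invr_ge0 // /y; lra.
Qed.

Lemma bin_le_exp k d : ('C(k, d) <= k ^ d)%N.
Proof.
elim: k d => [|k IH] [|d] //; rewrite binS.
apply: leq_trans (leq_add (IH d.+1) (IH d)) _.
rewrite !expnS -mulSnr leq_mul2l /=.
by case: d => // d; rewrite leq_exp2r.
Qed.

(** The index q = j d + l stands for point l of shell j. The d points are equally spaced, reach the
    right end of the shell and avoid its left end; so 0 is never a node and the inverses make
    sense. *)
Definition base_node (d q : nat) : R :=
  1 - (4 / 5) ^+ (q %/ d) * (1 - (q %% d + 1)%:R / (5 * d%:R)).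

Definition node (d a : nat) : R :=
  let x := base_node d (a %/ 4) in
  match (a %% 4)%N with 0 => x | 1 => 0 - x | 2 => 1 / x | _ => 0 - 1 / x end.

(** Even, so that powers of negative atoms are nonnegative; about i / 8, to absorb the gap between
    [x] and the decay rate 1 - de/2; constant on blocks of 16, so that few positions are
    identified. *)
Definition coarse (i : nat) : nat := (2 * (i %/ 16))%N.

Definition shell (j : nat) : R := (4 / 5) ^+ j.

Lemma shell_gt0 j : 0 < shell j. Proof. by apply: exprn_gt0; lra. Qed.

Lemma shellS j : shell j.+1 = 4 / 5 * shell j. Proof. exact: exprS. Qed.

Lemma base_node_bounds d j l : (l < d)%N ->
  [/\ 1 - shell j < base_node d (j * d + l), base_node d (j * d + l) <= 1 - shell j.+1 &
      base_node d (j * d + l) = 1 - shell j * (1 - (l + 1)%:R / (5 * d%:R))].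
Proof.
move=> ld; have d0 : (0 < d)%N by exact: leq_ltn_trans ld.
have E : base_node d (j * d + l) = 1 - shell j * (1 - (l + 1)%:R / (5 * d%:R)).
  by rewrite /base_node divnMDl // divn_small // addn0 modnMDl modn_small.
have dp : 0 < d%:R :> R by rewrite ltr0n.
set t := (l + 1)%:R / (5 * d%:R) in E.
have t0 : 0 < t by rewrite divr_gt0 ?mulr_gt0 // ltr0n addn1.
have t1 : t <= 1 / 5.
  rewrite /t ler_pdivrMr ?mulr_gt0 // mulrA divfK ?pnatr_eq0 // mul1r ler_nat; lia.
split=> //; rewrite E ?shellS; have := shell_gt0 j; nra.
Qed.

(** The rate 1 - de/2 exceeds the points of the shell, but its 8th power stays below the left end 1
    - 5/4 de as long as de <= 16/25 = (4/5)^2, that is, outside the shell that contains 0. *)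
Lemma shell_compare (de x y : R) : 0 < de <= 16 / 25 -> 1 - 5 / 4 * de <= x -> y = 1 - de / 2 ->
  y ^+ 16 <= x ^+ 2.
Proof.
move=> /andP[d0 d1] hx ->.
have y0 : 0 <= 1 - de / 2 by lra.
have e1 : 0 <= 1 - 5 / 4 * de by lra.
have -> : (1 - de / 2) ^+ 16 = ((1 - de / 2) ^+ 8) ^+ 2 by rewrite -exprM.
rewrite lerXn2r ?nnegrE ?exprn_ge0 //; first exact: le_trans hx.
apply: le_trans hx.
set q := 1 - de / 2 in y0 *.
have q2 : q ^+ 2 = 1 - de + de ^+ 2 / 4 by rewrite /q; field.
have q4 : q ^+ 4 = (q ^+ 2) ^+ 2 by rewrite -exprM.
have de2 : 0 <= de ^+ 2 by exact: sqr_ge0.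
have t2 : 0 <= de ^+ 2 * (16 / 25 - de) by apply: mulr_ge0 => //; lra.
have q4l : q ^+ 4 <= 1 - 5 / 4 * de + 1 / 2 * de ^+ 2.
  have t1 : 0 <= de * (16 / 25 - de) by apply: mulr_ge0; lra.
  have t3 : 0 <= de * (de ^+ 2 * (16 / 25 - de)) by apply: mulr_ge0 => //; lra.
  have t4 : 0 <= de * de ^+ 2 by apply: mulr_ge0 => //; lra.
  have -> : q ^+ 4 = 1 - 2 * de + 3 / 2 * de ^+ 2 - 1 / 2 * (de * de ^+ 2) + 1 / 16 * (de * (de * de ^+ 2)).
    by rewrite /q; field.
  lra.
have q8 : q ^+ 8 = (q ^+ 4) ^+ 2 by rewrite -exprM.
have q40 : 0 <= q ^+ 4 by exact: exprn_ge0.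
apply: le_trans (_ : _ <= (1 - 5 / 4 * de + 1 / 2 * de ^+ 2) ^+ 2) _.
  by rewrite q8 lerXn2r ?nnegrE //; exact: le_trans q4l.
(* Times [de], this cubic is the gap between 1 - 5/4 de and (1 - 5/4 de + 1/2 de^2)^2. *)
have f0 : 0 <= 5 / 4 - 41 / 16 * de + 5 / 4 * de ^+ 2 - 1 / 4 * (de * de ^+ 2).
  have := sqr_ge0 (de - 16 / 25); rewrite sqrrB => h; lra.
have df : 0 <= de * (5 / 4 - 41 / 16 * de + 5 / 4 * de ^+ 2 - 1 / 4 * (de * de ^+ 2)).
  by apply: mulr_ge0 => //; lra.
by rewrite -subr_ge0; move: df; apply: etrans; congr (_ <= _); field.
Qed.

Lemma coarse_pow (x y : R) i : 0 <= y <= 1 -> y ^+ 16 <= x ^+ 2 -> y ^+ i <= x ^+ coarse i.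
Proof.
move=> /andP[y0 y1] h; apply: le_trans (_ : y ^+ (16 * (i %/ 16)) <= _).
  by apply: ler_wiXn2l => //; rewrite mulnC leq_divM.
by rewrite /coarse !exprM; apply: lerXn2r => //; rewrite nnegrE ?sqr_ge0 // exprn_ge0.
Qed.

(** Three regimes. Next to 1, the powers of [x] in the bound are at least 1/2. On a middle shell,
    the decay (1 - de/2)^k turns into coarsened powers of [x]. On shell 0, where [x] may vanish, 1 -
    de/2 = 3/5 gives the corner term. *)
Lemma unit_interval_approx (n d J : nat) (x : R) :
  (0 < d)%N -> (0 < n)%N -> 8 * n%:R * shell J <= 1 -> 0 <= x <= 1 ->
  exists j (c : nat -> R), (j <= J)%N /\ forall i i', (i < n)%N -> (i' < n)%N ->
    `|x ^+ (i + i') - expsum d (fun l => base_node d (j * d + l)) c (i + i')| <=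
    2 * (5 / 6) ^+ d * ((3 / 5) ^+ (i + i') + x ^+ (coarse i + coarse i')).
Proof.
move=> d0 n0 hJ /andP[x0 x1].
have dist j l l' : (l < l')%N -> (l' < d)%N -> base_node d (j * d + l) != base_node d (j * d + l').
  move=> ll ld; have ld' := ltn_trans ll ld.
  have [_ _ ->] := base_node_bounds j ld; have [_ _ ->] := base_node_bounds j ld'.
  have dp : 0 < d%:R :> R by rewrite ltr0n.
  rewrite -subr_eq0.
  have -> : 1 - shell j * (1 - (l + 1)%:R / (5 * d%:R)) - (1 - shell j * (1 - (l' + 1)%:R / (5 * d%:R)))
     = shell j * ((l%:R - l'%:R) / (5 * d%:R)).
    by rewrite !natrD; ring.
  apply: mulf_neq0; first by rewrite gt_eqF ?shell_gt0.
  apply: mulf_neq0; first by rewrite subr_eq0 eqr_nat neq_ltn ll.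
  by rewrite invr_eq0 gt_eqF ?mulr_gt0.
have e0 : 0 <= (5 / 6 : R) ^+ d by apply: exprn_ge0; lra.
have [near|far] := leP (1 - shell J) x.
  (* The innermost shell, where x^k is comparable to 1. *)
  have [|||||c hc] := @interpolation_remainder d (fun l => base_node d (J * d + l)) x 1 (shell J).
  - by rewrite ger0_norm.
  - by rewrite ltW // shell_gt0.
  - move=> l ld; have [h1 h2 _] := base_node_bounds J ld.
    have s1 : shell J <= 1 by apply: exprn_ile1; lra.
    have := shell_gt0 J.+1; rewrite ler_norml; lra.
  - move=> l ld; have [h1 h2 _] := base_node_bounds J ld.
    have := shell_gt0 J.+1; rewrite ler_norml; lra.
  - exact: dist.
  exists J, c; split=> // i i' li li'; apply: le_trans (hc _) _.
  rewrite expr1n mulr1.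
  have nR : 0 < n%:R :> R by rewrite ltr0n.
  apply: le_trans (_ : _ <= (5 / 6) ^+ d) _.
    apply: le_trans (_ : _ <= ((i + i')%:R * shell J) ^+ d) _.
      rewrite exprMn -natrX ler_wpM2r ?ler_nat ?bin_le_exp // exprn_ge0 // ltW // shell_gt0 //.
    rewrite lerXn2r ?nnegrE //; [by rewrite mulr_ge0 // ltW // shell_gt0|lra|].
    have : (i + i')%:R <= 2 * n%:R :> R by rewrite -natrM ler_nat; lia.
    have := shell_gt0 J; nra.
  (* The coarsened exponents add up to at most n, and n * shell J <= 1/8, so Bernoulli's inequality
     applies. *)
  have xp : 1 / 2 <= x ^+ (coarse i + coarse i').
    apply: le_trans (_ : _ <= x ^+ n) _.
      have bern : forall m, 1 - m%:R * shell J <= (1 - shell J) ^+ m.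
        have s1 : shell J <= 1 by apply: exprn_ile1; lra.
        elim=> [|m IH]; first by rewrite mul0r subr0 expr0.
        have sp := shell_gt0 J.
        rewrite exprS -natr1; apply: le_trans (_ : (1 - shell J) * (1 - m%:R * shell J) <= _).
          have : 0 <= m%:R :> R by []. nra.
        by rewrite ler_wpM2l // subr_ge0.
      apply: le_trans (_ : 1 - n%:R * shell J <= _); first nra.
      apply: le_trans (bern n) _.
      rewrite lerXn2r ?nnegrE // subr_ge0; apply: exprn_ile1; lra.
    apply: ler_wiXn2l => //; rewrite /coarse; lia.
  have : 0 <= (3 / 5 : R) ^+ (i + i') by apply: exprn_ge0; lra.
  nra.
have [j jJ /andP[jx xj]] : exists2 j, (j < J)%N & 1 - shell j <= x < 1 - shell j.+1.
  elim: J far {hJ} => [|J IH] far; first by move: far; rewrite /shell expr0 subrr ltNge x0.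
  have [|/IH[j jJ hj]] := leP (1 - shell J) x; last by exists j => //; exact: ltnW.
  by move=> h; exists J => //; rewrite h.
set de := shell j.+1 in xj *.
have dp : 0 < de by exact: shell_gt0.
have sj1 : shell j <= 1 by apply: exprn_ile1; lra.
have d1 : de <= 4 / 5 by rewrite /de shellS; lra.
have sj : shell j = 5 / 4 * de by rewrite /de shellS; lra.
(* The shell has right end 1 - de and width de / 4. *)
have [|||||c hc] := @interpolation_remainder d (fun l => base_node d (j * d + l)) x (1 - de) (de / 4).
- by rewrite ger0_norm // ltW.
- lra.
- move=> l ld; have [h1 h2 _] := base_node_bounds j ld.
  have s1 : shell j <= 1 by apply: exprn_ile1; lra.
  rewrite ger0_norm //; lra.
- move=> l ld; have [h1 h2 _] := base_node_bounds j ld.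
  rewrite ler_norml -/de in h2 *; lra.
- exact: dist.
exists j, c; split; first exact: ltnW.
move=> i i' li li'; apply: le_trans (hc _) _.
apply: le_trans (binomial_tail _ _ _) _; first by rewrite ltW.
have y01 : 0 <= 1 - de / 2 <= 1 by lra.
have pos1 : 0 <= (3 / 5 : R) ^+ (i + i') by apply: exprn_ge0; lra.
have pos2 : 0 <= x ^+ (coarse i + coarse i') by exact: exprn_ge0.
suff : (1 - de / 2) ^+ (i + i') <= (3 / 5) ^+ (i + i') + x ^+ (coarse i + coarse i') by nra.
have [j0|j0] := posnP j.
  have -> : 1 - de / 2 = 3 / 5 by rewrite /de j0 shellS /shell expr0; lra.
  by rewrite lerDl.
apply: ler_wpDl => //; rewrite exprD (exprD x).
have h16 : (1 - de / 2) ^+ 16 <= x ^+ 2.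
  apply: (@shell_compare de) => //; last lra.
  rewrite dp /= /de -(prednK j0) !shellS.
  have : shell j.-1 <= 1 by apply: exprn_ile1; lra.
  lra.
have /andP[y0 _] := y01.
by apply: ler_pM; rewrite ?exprn_ge0 //; apply: coarse_pow.
Qed.

End Interpolation.

(** * Orthogonal projection onto the span *)

Section Projection.
Variables (R : realType) (I : finType) (r : nat) (u : nat -> I -> R).

Definition projk (g : I -> R) (p : I) : R := dot (rkernel r u p) g.

Lemma projkE g : exists c, projk g =1 lincomb r u c.
Proof.
exists (fun a => \sum_(b < r) gram_kernel r (fun a b => dot (u a) (u b)) r a b * dot (u b) g) => p.
exact: kernel_apply.
Qed.

Lemma projk_lincomb c : projk (lincomb r u c) =1 lincomb r u c.
Proof. by move=> p; exact: rkernel_lincomb. Qed.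

Lemma projk_id g : projk (projk g) =1 projk g.
Proof.
move=> p; have [c cE] := projkE g.
by rewrite cE -projk_lincomb; apply: eq_dot.
Qed.

Lemma dot_projk g : dot (projk g) (projk g) = dot g (projk g).
Proof.
rewrite {1}/dot; under eq_bigr => p _ do rewrite {1}/projk /dot mulr_suml.
rewrite exchange_big /=; apply: eq_bigr => q _.
rewrite -[in RHS]projk_id /projk -/(projk g) mulr_sumr; apply: eq_bigr => p _.
by rewrite rkernelC -/(projk g p); ring.
Qed.

Lemma dot_residual g :
  dot (fun p => g p - projk g p) (fun p => g p - projk g p) = dot g g - dot (projk g) (projk g).
Proof.
have -> : dot (fun p => g p - projk g p) (fun p => g p - projk g p) =
    dot (fun p => g p + (-1) * projk g p) (fun p => g p + (-1) * projk g p).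
  by apply: eq_dot => p; rewrite mulN1r.
by rewrite dot_addZ (dotC (projk g) g) -dot_projk; ring.
Qed.

Lemma projk_le g : dot (projk g) (projk g) <= dot g g.
Proof. by rewrite -subr_ge0 -dot_residual dot_ge0. Qed.

Lemma residual_le g : dot (fun p => g p - projk g p) (fun p => g p - projk g p) <= dot g g.
Proof. by rewrite dot_residual lerBlDr lerDl dot_ge0. Qed.

Lemma projkD g h p : projk (fun q => g q + h q) p = projk g p + projk h p.
Proof. exact: dotDr. Qed.

Lemma projkB g h p : projk (fun q => g q - h q) p = projk g p - projk h p.
Proof. exact: dotBr. Qed.

Lemma projkZ s g p : projk (fun q => s * g q) p = s * projk g p.
Proof. exact: dotZr. Qed.

(** Subtracting the projection annihilates the span and does not increase the norm. *)
Lemma residual_le_dist g c :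
  dot (fun p => g p - projk g p) (fun p => g p - projk g p) <=
  dot (fun p => g p - lincomb r u c p) (fun p => g p - lincomb r u c p).
Proof.
apply: le_trans (residual_le _); rewrite le_eqVlt; apply/orP; left; apply/eqP.
by apply: eq_dot => p; rewrite projkB projk_lincomb; ring.
Qed.

End Projection.

(** * Interpolation of a single atom on the whole real line *)

Section Approximation.
Variable R : realType.

Definition inspan (r : nat) (x : nat -> R) (f : nat -> R) := exists c, f =1 expsum r x c.

Lemma inspan_node r x a : (a < r)%N -> inspan r x (fun k => x a ^+ k).
Proof.
move=> ar; exists (fun b => (b == a)%:R) => k; rewrite /expsum (bigD1 (Ordinal ar)) //= eqxx mul1r.
by rewrite big1 ?addr0 // => b; rewrite -val_eqE /= => /negPf ->; rewrite mul0r.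
Qed.

Lemma inspanZ r x s f : inspan r x f -> inspan r x (fun k => s * f k).
Proof.
move=> [c cE]; exists (fun a => s * c a) => k; rewrite cE /expsum mulr_sumr.
by apply: eq_bigr => a _; rewrite mulrA.
Qed.

Lemma inspan_sum (T : finType) r x (f : T -> nat -> R) :
  (forall l, inspan r x (f l)) -> inspan r x (fun k => \sum_l f l k).
Proof.
move=> h; have [c cE] := boolp.choice h.
exists (fun a => \sum_l c l a) => k; rewrite /expsum.
under eq_bigr => l _ do rewrite cE /expsum.
by rewrite exchange_big; apply: eq_bigr => a _; rewrite mulr_suml.
Qed.

Lemma eq_inspan r x f g : f =1 g -> inspan r x f -> inspan r x g.
Proof. by move=> e [c cE]; exists c => k; rewrite -e. Qed.

Definition node_count (d J : nat) : nat := (4 * (d * J.+1))%N.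

Lemma nodeE d q e : (e < 4)%N -> node R d (4 * q + e) =
  let x := base_node R d q in
  match e with 0 => x | 1 => 0 - x | 2 => 1 / x | _ => 0 - 1 / x end.
Proof.
by move=> e4; rewrite /node mulnC divnMDl // divn_small // addn0 modnMDl modn_small.
Qed.

Lemma node_lt d J j l e : (j <= J)%N -> (l < d)%N -> (e < 4)%N ->
  (4 * (j * d + l) + e < node_count d J)%N.
Proof.
move=> jJ ld e4; rewrite /node_count.
have : (j * d + l < d * J.+1)%N.
  apply: leq_trans (_ : j.+1 * d <= _)%N; first by rewrite mulSn addnC ltn_add2r.
  by rewrite mulnC leq_mul2l ltnS jJ orbT.
lia.
Qed.

Lemma inspan_base d J j l (s : bool) : (j <= J)%N -> (l < d)%N ->
  inspan (node_count d J) (node R d) (fun k => ((-1) ^+ s * base_node R d (j * d + l)) ^+ k).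
Proof.
move=> jJ ld; have e4 : (s < 4)%N by case: s.
apply: eq_inspan (inspan_node _ (node_lt jJ ld e4)) => k; congr (_ ^+ _).
by rewrite nodeE //; case: s {e4}; rewrite /= ?expr1 ?expr0 ?mulN1r ?mul1r ?sub0r.
Qed.

Lemma inspan_base_inv d J j l (s : bool) : (j <= J)%N -> (l < d)%N ->
  inspan (node_count d J) (node R d) (fun k => ((-1) ^+ s * (base_node R d (j * d + l))^-1) ^+ k).
Proof.
move=> jJ ld; have e4 : (2 + s < 4)%N by case: s.
apply: eq_inspan (inspan_node _ (node_lt jJ ld e4)) => k; congr (_ ^+ _).
by rewrite nodeE //; case: s {e4}; rewrite /= ?expr1 ?expr0 ?mulN1r ?mul1r ?sub0r ?div1r.
Qed.

(** The first two terms serve |lam| <= 1; the other two are their mirror images for |lam| > 1. All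
    exponents of lam are even, so the sum is a bound in both cases, and each term is a multiple of a
    power of lam, so that integrating over the atoms produces entries of H. *)
Definition atom_bound (N : nat) (lam : R) (i j : nat) : R :=
  (3 / 5) ^+ (i + j) * lam ^+ 0 + lam ^+ (coarse i + coarse j) +
  (3 / 5) ^+ ((N - i) + (N - j)) * lam ^+ (N + N) +
  lam ^+ ((N - coarse (N - i)) + (N - coarse (N - j))).

Lemma even_pow_ge0 (x : R) k : ~~ odd k -> 0 <= x ^+ k.
Proof. by move=> h; rewrite exprn_even_ge0. Qed.

Lemma coarse_le i : (coarse i <= i)%N.
Proof. rewrite /coarse; lia. Qed.

Lemma sgnX_norm (x : R) k : x ^+ k = ((-1) ^+ (x < 0)%R) ^+ k * `|x| ^+ k.
Proof. by rewrite -exprMn -realEsign ?num_real. Qed.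

Lemma norm_sgnX (b : bool) k (x : R) : `|((-1) ^+ b) ^+ k * x| = `|x|.
Proof. by rewrite normrM -exprM normrX normrN1 expr1n mul1r. Qed.

Lemma norm_even_pow (x : R) k : ~~ odd k -> `|x| ^+ k = x ^+ k.
Proof. by move=> h; rewrite -normrX ger0_norm // even_pow_ge0. Qed.

(** For |lam| > 1, lam^k = lam^(2N) (1/lam)^(2N-k): the bound on the unit interval is used for
    1/|lam| at the position (N-i, N-j), with inverted nodes. The sign of lam is passed on to the
    nodes. *)
Lemma atom_approx (N d J : nat) (lam : R) :
  (0 < d)%N -> 8 * N.+1%:R * shell R J <= 1 ->
  exists c, forall i j, (i <= N)%N -> (j <= N)%N ->
    `|lam ^+ (i + j) - expsum (node_count d J) (node R d) c (i + j)| <=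
    2 * (5 / 6) ^+ d * atom_bound N lam i j.
Proof.
move=> d0 hJ.
have e0 : 0 <= 2 * (5 / 6 : R) ^+ d by apply: mulr_ge0 => //; apply: exprn_ge0; lra.
have ge35 k : 0 <= (3 / 5 : R) ^+ k by apply: exprn_ge0; lra.
have ev2 i j : ~~ odd (coarse i + coarse j) by rewrite /coarse; lia.
have ev3 : ~~ odd (N + N) by lia.
have ev4 i j : (i <= N)%N -> (j <= N)%N -> ~~ odd ((N - coarse (N - i)) + (N - coarse (N - j))).
  move=> li lj; have h1 := coarse_le (N - i); have h2 := coarse_le (N - j).
  by move: h1 h2; rewrite /coarse; lia.
have T1 i j : 0 <= (3 / 5 : R) ^+ (i + j) * lam ^+ 0 by rewrite expr0 mulr1.
have T2 i j : 0 <= lam ^+ (coarse i + coarse j) by exact: even_pow_ge0.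
have T3 i j : 0 <= (3 / 5 : R) ^+ ((N - i) + (N - j)) * lam ^+ (N + N).
  by rewrite mulr_ge0 // even_pow_ge0.
have T4 i j : (i <= N)%N -> (j <= N)%N -> 0 <= lam ^+ ((N - coarse (N - i)) + (N - coarse (N - j))).
  by move=> li lj; apply: even_pow_ge0; exact: ev4.
set s := (lam < 0)%R.
have [small|large] := leP `|lam| 1.
  have [|j [c [jJ hc]]] := @unit_interval_approx R N.+1 d J `|lam| d0 isT hJ.
    by rewrite normr_ge0.
  have [c' cE] : inspan (node_count d J) (node R d)
     (fun k => \sum_(l < d) c l * ((-1) ^+ s * base_node R d (j * d + l)) ^+ k).
    by apply: inspan_sum => l; apply: inspanZ; apply: inspan_base.
  exists c' => i i' li li'; rewrite -cE.
  have -> : lam ^+ (i + i') - \sum_(l < d) c l * ((-1) ^+ s * base_node R d (j * d + l)) ^+ (i + i') =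
     ((-1) ^+ s) ^+ (i + i') * (`|lam| ^+ (i + i') - expsum d (fun l => base_node R d (j * d + l)) c (i + i')).
    rewrite mulrBr -sgnX_norm; congr (_ - _); rewrite /expsum mulr_sumr; apply: eq_bigr => l _.
    by rewrite exprMn; ring.
  rewrite norm_sgnX; apply: le_trans (hc i i' _ _) _; rewrite ?ltnS //.
  rewrite ler_wpM2l // /atom_bound norm_even_pow // expr0 mulr1 -[leRHS]addrA lerDl.
  by rewrite addr_ge0 // T4.
have lam0 : `|lam| != 0 by rewrite gt_eqF // (lt_trans ltr01).
have [|j [c [jJ hc]]] := @unit_interval_approx R N.+1 d J `|lam|^-1 d0 isT hJ.
  by rewrite invr_ge0 normr_ge0 invf_le1 ?ltW // (lt_trans ltr01).
have bn l : (l < d)%N -> base_node R d (j * d + l) != 0.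
  move=> ld; have [h _ _] := base_node_bounds R j ld.
  have : shell R j <= 1 by apply: exprn_ile1; lra.
  move=> h1; rewrite gt_eqF //; lra.
(* The factor y^(2N) converts y^(2N-k) into the power k of the inverted node. *)
pose e l := c l * `|lam| ^+ (N + N) * base_node R d (j * d + l) ^+ (N + N).
have [c' cE] : inspan (node_count d J) (node R d)
   (fun k => \sum_(l < d) e l * ((-1) ^+ s * (base_node R d (j * d + l))^-1) ^+ k).
  by apply: inspan_sum => l; apply: inspanZ; apply: inspan_base_inv.
exists c' => i i' li li'; rewrite -cE.
have kk : (N + N = (N - i) + (N - i') + (i + i'))%N by lia.
have flip (y : R) : y != 0 -> y ^+ (N + N) * y^-1 ^+ (i + i') = y ^+ ((N - i) + (N - i')).
  move=> y0; rewrite kk exprD -mulrA -exprMn mulfV // expr1n mulr1 //.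
have flip' (y : R) a : (a <= N + N)%N -> y != 0 -> y ^+ (N + N) * y^-1 ^+ a = y ^+ (N + N - a).
  by move=> h y0; rewrite -{1}(subnK h) exprD -mulrA -exprMn mulfV // expr1n mulr1.
have -> : lam ^+ (i + i') - \sum_(l < d) e l * ((-1) ^+ s * (base_node R d (j * d + l))^-1) ^+ (i + i') =
   ((-1) ^+ s) ^+ (i + i') * (`|lam| ^+ (N + N) *
     (`|lam|^-1 ^+ ((N - i) + (N - i')) - expsum d (fun l => base_node R d (j * d + l)) c ((N - i) + (N - i')))).
  rewrite !mulrBr; congr (_ - _).
    rewrite sgnX_norm flip' //; last lia.
    by congr (_ * _ ^+ _); lia.
  rewrite /expsum !mulr_sumr; apply: eq_bigr => l _.
  by rewrite exprMn /e -flip ?bn //; ring.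
rewrite norm_sgnX normrM normrX normr_id.
have hN : (N - i < N.+1)%N /\ (N - i' < N.+1)%N by split; lia.
apply: le_trans (ler_wpM2l (exprn_ge0 _ (normr_ge0 _)) (hc _ _ hN.1 hN.2)) _.
rewrite mulrCA ler_wpM2l // mulrDr flip' //; last first.
  by have := coarse_le (N - i); have := coarse_le (N - i'); lia.
have -> : (N + N - (coarse (N - i) + coarse (N - i')) = (N - coarse (N - i)) + (N - coarse (N - i')))%N.
  by have := coarse_le (N - i); have := coarse_le (N - i'); lia.
rewrite !norm_even_pow ?ev4 // /atom_bound lerD2r [leLHS]mulrC lerDr.
by rewrite addr_ge0.
Qed.

End Approximation.

(** * From atoms to positive semidefinite Hankel matrices *)

Section HankelApprox.
Variable R : realType.

Definition matfun n (H : 'M[R]_n) (p : 'I_n * 'I_n) : R := H p.1 p.2.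

Lemma sum_matfun n (F : 'I_n -> 'I_n -> R) : \sum_(p : 'I_n * 'I_n) F p.1 p.2 = \sum_i \sum_j F i j.
Proof. by rewrite pair_bigA. Qed.

Lemma entry_le n (H : 'M[R]_n) i j : H i j ^+ 2 <= dot (matfun H) (matfun H).
Proof.
rewrite /dot (bigD1 (i, j)) //= -expr2 lerDl; apply: sumr_ge0 => p _.
by rewrite -expr2 sqr_ge0.
Qed.

(** A coarsening forgets only a residue modulo 16, so it is at most 16 to 1 on indices and 256 to 1
    on pairs. *)
Lemma sum_fiber16 n (g : 'I_n -> 'I_n) (key : 'I_n -> nat) (F : 'I_n * 'I_n -> R) :
  (forall q, 0 <= F q) ->
  (forall i i', g i = g i' -> key i = key i' %[mod 16] -> i = i') ->
  \sum_p F (g p.1, g p.2) <= 256 * \sum_p F p.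
Proof.
move=> F0 inj.
apply: (sum_fiber_le (m := 256) (h := fun p => (g p.1, g p.2)) F0) => - [q1 q2].
have fib q : (#|[set i | g i == q]| <= 16)%N.
  have inj_k : {in [set i | g i == q] &, injective (fun i => inord (key i %% 16) : 'I_16)}.
    move=> i i'; rewrite !inE => /eqP e /eqP e' /(congr1 val) /=.
    by rewrite !inordK ?ltn_mod // => h; apply: inj => //; rewrite e e'.
  by rewrite -(card_in_imset inj_k) -[X in (_ <= X)%N](card_ord 16) max_card.
have -> : [set p : 'I_n * 'I_n | (g p.1, g p.2) == (q1, q2)] = setX [set i | g i == q1] [set i | g i == q2].
  by apply/setP => - [i j]; rewrite !inE.
by rewrite cardsX; apply: (leq_mul (fib q1) (fib q2)).
Qed.

Lemma geometric_sum_le n : \sum_(i < n) (9 / 25 : R) ^+ i <= 2 - 2 * (9 / 25) ^+ n.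
Proof.
elim: n => [|n IH]; first by rewrite big_ord0 expr0; lra.
rewrite big_ord_recr /= exprS; have : 0 <= (9 / 25 : R) ^+ n by apply: exprn_ge0; lra.
lra.
Qed.

Lemma sum_corner n : \sum_(p : 'I_n * 'I_n) ((3 / 5 : R) ^+ (p.1 + p.2)) ^+ 2 <= 4.
Proof.
rewrite (eq_bigr (fun p : 'I_n * 'I_n => (9 / 25) ^+ p.1 * (9 / 25) ^+ p.2)) => [|p _]; last first.
  by rewrite -exprD -exprM mulnC exprM; congr (_ ^+ _); field.
rewrite (sum_matfun (fun i j : 'I_n => (9 / 25) ^+ i * (9 / 25) ^+ j)).
under eq_bigr => i _ do rewrite -mulr_sumr.
rewrite -mulr_suml; have h := geometric_sum_le n.
have e0 : 0 <= (9 / 25 : R) ^+ n by apply: exprn_ge0; lra.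
have g0 : 0 <= \sum_(i < n) (9 / 25 : R) ^+ i by apply: sumr_ge0 => i _; apply: exprn_ge0; lra.
nra.
Qed.

(** 2080 = 4 (4 + 256 + 4 + 256): squaring a sum of four terms costs the factor 4, each corner term
    contributes at most 4 |H|_F^2 and each coarsened term at most 256 |H|_F^2. *)
Definition approx_rate (d : nat) : R := 2080 * (2 * (5 / 6) ^+ d) ^+ 2.

Lemma moments_approx N d J (H : 'M[R]_N.+1) (T : finType) (m lam : T -> R) :
  (0 < d)%N -> 8 * N.+1%:R * shell R J <= 1 -> (forall a, 0 <= m a) ->
  (forall i j, H i j = \sum_a m a * lam a ^+ (i + j)) ->
  exists c, dot (fun p => matfun H p - lincomb (node_count d J) (@expmx R N.+1 (node R d)) c p)
                (fun p => matfun H p - lincomb (node_count d J) (@expmx R N.+1 (node R d)) c p) <=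
    approx_rate d * dot (matfun H) (matfun H).
Proof.
move=> d0 hJ m0 HE.
have [ca hca] := boolp.choice (fun a => @atom_approx R N d J (lam a) d0 hJ).
have [c cE] : inspan (node_count d J) (node R d) (fun k => \sum_a m a * expsum (node_count d J) (node R d) (ca a) k).
  by apply: inspan_sum => a; apply: inspanZ; exists (ca a).
exists c.
set eta := 2 * (5 / 6) ^+ d in hca.
have eta0 : 0 <= eta by apply: mulr_ge0 => //; apply: exprn_ge0; lra.
pose g1 (i : 'I_N.+1) : 'I_N.+1 := inord (coarse i).
pose g2 (i : 'I_N.+1) : 'I_N.+1 := inord (N - coarse (N - i)).
have ord_le (i : 'I_N.+1) : (i <= N)%N by rewrite -ltnS.
have g1E i : g1 i = coarse i :> nat by rewrite inordK // ltnS (leq_trans (coarse_le i)).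
have g2E i : g2 i = (N - coarse (N - i))%N :> nat by rewrite inordK //; lia.
pose t1 (p : 'I_N.+1 * 'I_N.+1) := (3 / 5) ^+ (p.1 + p.2) * H ord0 ord0.
pose t2 (p : 'I_N.+1 * 'I_N.+1) := matfun H (g1 p.1, g1 p.2).
pose t3 (p : 'I_N.+1 * 'I_N.+1) := (3 / 5) ^+ ((N - p.1) + (N - p.2)) * H ord_max ord_max.
pose t4 (p : 'I_N.+1 * 'I_N.+1) := matfun H (g2 p.1, g2 p.2).
(* Since the weights are nonnegative, the sum of the atom bounds reassembles entries of [H] at the
   two corners and at the coarsened positions. *)
have pt p : `|matfun H p - lincomb (node_count d J) (@expmx R N.+1 (node R d)) c p| <=
    eta * (t1 p + t2 p + t3 p + t4 p).
  rewrite -[lincomb _ _ _ _]/(expsum (node_count d J) (node R d) c (p.1 + p.2)) -cE /matfun HE -sumrB.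
  apply: le_trans (ler_norm_sum _ _ _) _.
  apply: le_trans (_ : _ <= \sum_a m a * (eta * atom_bound N (lam a) p.1 p.2)) _.
    apply: ler_sum => a _; rewrite -mulrBr normrM ger0_norm // ler_wpM2l //.
    exact: hca.
  rewrite le_eqVlt; apply/orP; left; apply/eqP.
  rewrite /t1 /t2 /t3 /t4 /matfun !HE /= !g1E !g2E addn0 !mulr_sumr -!big_split /= mulr_sumr.
  by apply: eq_bigr => a _; rewrite /atom_bound; ring.
have sq4 (a b c' e : R) : (a + b + c' + e) ^+ 2 <= 4 * (a ^+ 2 + b ^+ 2 + c' ^+ 2 + e ^+ 2).
  have := sqr_ge0 (a - b); have := sqr_ge0 (a - c'); have := sqr_ge0 (a - e).
  have := sqr_ge0 (b - c'); have := sqr_ge0 (b - e); have := sqr_ge0 (c' - e).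
  rewrite -subr_ge0; nra.
set D := dot (matfun H) (matfun H).
have D0 : 0 <= D by exact: dot_ge0.
apply: le_trans (_ : _ <= \sum_p eta ^+ 2 * (4 * (t1 p ^+ 2 + t2 p ^+ 2 + t3 p ^+ 2 + t4 p ^+ 2))) _.
  rewrite /dot; apply: ler_sum => p _; rewrite -expr2 -real_normK ?num_real //.
  apply: le_trans (_ : (eta * (t1 p + t2 p + t3 p + t4 p)) ^+ 2 <= _).
    by rewrite lerXn2r ?nnegrE //; exact: le_trans (pt p).
  by rewrite exprMn ler_wpM2l ?sqr_ge0.
rewrite -!mulr_sumr !big_split /= /approx_rate -/eta.
have b1 : \sum_p t1 p ^+ 2 <= 4 * D.
  rewrite (eq_bigr (fun p : 'I_N.+1 * 'I_N.+1 => ((3 / 5 : R) ^+ (p.1 + p.2)) ^+ 2 * H ord0 ord0 ^+ 2)) => [|p _]; last by rewrite exprMn.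
  rewrite -mulr_suml; apply: ler_pM; rewrite ?sqr_ge0 ?sum_corner ?entry_le //.
  by apply: sumr_ge0 => p _; exact: sqr_ge0.
have b3 : \sum_p t3 p ^+ 2 <= 4 * D.
  rewrite (eq_bigr (fun p : 'I_N.+1 * 'I_N.+1 => ((3 / 5 : R) ^+ ((N - p.1) + (N - p.2))) ^+ 2 * H ord_max ord_max ^+ 2)) => [|p _]; last by rewrite exprMn.
  rewrite -mulr_suml; apply: ler_pM; rewrite ?sqr_ge0 ?entry_le //.
    by apply: sumr_ge0 => p _; exact: sqr_ge0.
  pose F (q : 'I_N.+1 * 'I_N.+1) := ((3 / 5 : R) ^+ (q.1 + q.2)) ^+ 2.
  apply: le_trans (sum_corner N.+1).
  apply: (sum_inj_le (h := fun p : 'I_N.+1 * 'I_N.+1 => (rev_ord p.1, rev_ord p.2)) (F := F)).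
    by move=> q; exact: sqr_ge0.
  by move=> [i j] [i' j'] [] /= h1 h2; congr (_, _); apply: rev_ord_inj; apply: val_inj.
have F0 q : 0 <= matfun H q ^+ 2 by exact: sqr_ge0.
have DE : \sum_p matfun H p ^+ 2 = D by apply: eq_bigr => p _; rewrite expr2.
have b2 : \sum_p t2 p ^+ 2 <= 256 * D.
  rewrite -DE; apply: (sum_fiber16 (g := g1) (key := fun i => i) F0) => i i' /(congr1 val) /=.
  by rewrite !g1E => h1 h2; apply: val_inj => /=; move: h1 h2; rewrite /coarse; lia.
have b4 : \sum_p t4 p ^+ 2 <= 256 * D.
  rewrite -DE; apply: (sum_fiber16 (g := g2) (key := fun i => (N - i)%N) F0) => i i' /(congr1 val) /=.
  rewrite !g2E => h1 h2; apply: val_inj => /=; have := ord_le i; have := ord_le i'.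
  by have := coarse_le (N - i); have := coarse_le (N - i'); move: h1 h2; rewrite /coarse; lia.
have e2 : 0 <= eta ^+ 2 by exact: sqr_ge0.
have -> : 2080 * eta ^+ 2 * D = eta ^+ 2 * (2080 * D) by ring.
apply: ler_wpM2l => //; lra.
Qed.

(** The limit t -> 0 made explicit: if a > 0, then at t = a / (2 s) the constant term outweighs the
    other two. *)
Lemma quadratic_limit (a b c : R) : (forall t, 0 < t -> a + t * b + t ^+ 2 * c <= 0) -> a <= 0.
Proof.
move=> h; rewrite leNgt; apply/negP => a0.
have b0 := normr_ge0 b; have c0 := normr_ge0 c.
pose s := `|b| + `|c| + a + 1.
have s0 : 0 < s by rewrite /s; lra.
pose t := a / (2 * s).
have t0 : 0 < t by rewrite divr_gt0 // mulr_gt0.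
have ts : t * s = a / 2 by rewrite /t; field; rewrite gt_eqF.
have t1 : t <= 1 by rewrite /t ler_pdivrMr ?mulr_gt0 // /s; lra.
have := h _ t0.
have hb : - `|b| <= b by rewrite lerNl ler_normr lexx orbT.
have hc : - `|c| <= c by rewrite lerNl ler_normr lexx orbT.
have p1 : - (t * `|b|) <= t * b by rewrite -mulrN ler_wpM2l // ltW.
have p2 : - (t ^+ 2 * `|c|) <= t ^+ 2 * c by rewrite -mulrN ler_wpM2l // sqr_ge0.
have p3 : t ^+ 2 * `|c| <= t * `|c| by rewrite ler_wpM2r // expr2 ler_piMr // ltW.
have p4 : 0 < t * (a + 1) by rewrite mulr_gt0 //; lra.
have p5 : t * `|b| + t * `|c| + t * (a + 1) = a / 2 by rewrite -ts /s; ring.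
lra.
Qed.

(** The moment matrix of unit masses at 0, ..., N is positive definite because the Vandermonde
    matrix is invertible. *)
Lemma pd_hankel_exists N : exists H0 : 'M[R]_N.+1, [/\ hankel H0, H0^T = H0 &
  forall x : 'cV_N.+1, x != 0 -> 0 < (x^T *m H0 *m x) 0 0].
Proof.
pose a : 'rV[R]_N.+1 := \row_i i%:R.
pose V := Vandermonde N.+1 a.
have unV : V \in unitmx.
  rewrite unitmxE det_Vandermonde unitfE; apply/prodf_neq0 => i _; apply/prodf_neq0 => j ij.
  by rewrite !mxE subr_eq0 eqr_nat gtn_eqF.
exists (V *m V^T); split.
- move=> i j k l e; rewrite !mxE; apply: eq_bigr => s _; by rewrite !mxE -!exprD e.
- by rewrite trmx_mul trmxK.
move=> x x0; pose z := V^T *m x.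
have -> : x^T *m (V *m V^T) *m x = z^T *m z by rewrite /z trmx_mul trmxK !mulmxA.
have z0 : z != 0.
  apply: contra x0 => /eqP e; rewrite -[x](mulKmx (_ : V^T \in unitmx)) ?unitmx_tr //.
  by rewrite -/z e mulmx0.
have zE : (z^T *m z) 0 0 = \sum_i z i 0 ^+ 2 by rewrite mxE; apply: eq_bigr => i _; rewrite mxE expr2.
rewrite zE lt_neqAle; apply/andP; split; last by apply: sumr_ge0 => i _; exact: sqr_ge0.
rewrite eq_sym; apply: contra z0; rewrite psumr_eq0 => [/allP h|i _]; last exact: sqr_ge0.
apply/eqP/matrixP => i j; rewrite ord1 [RHS]mxE.
by have := h i (mem_index_enum i); rewrite /= sqrf_eq0 => /eqP.
Qed.

(** The projection is linear and the same for every t, so the inequality for H + t H0 is quadratic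
    in t, and the claim is about its constant coefficient. *)
Lemma psd_hankel_residual N d J (H : 'M[R]_N.+1) :
  (0 < d)%N -> 8 * N.+1%:R * shell R J <= 1 -> hankel H -> psd H ->
  let P := projk (node_count d J) (@expmx R N.+1 (node R d)) in
  dot (fun p => matfun H p - P (matfun H) p) (fun p => matfun H p - P (matfun H) p) <=
    approx_rate d * dot (matfun H) (matfun H).
Proof.
move=> d0 hJ hk [symH psdH]; cbv zeta; set P := projk _ _.
have [H0 [hk0 sym0 pd0]] := pd_hankel_exists N.
pose g := matfun H; pose g0 := matfun H0.
pose e p := g p - P g p; pose e0 p := g0 p - P g0 p.
rewrite -subr_le0 -/e -/g.
apply: (@quadratic_limit _ (2 * dot e0 e - approx_rate d * (2 * dot g0 g))
  (dot e0 e0 - approx_rate d * dot g0 g0)) => t t0.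
pose Ht := H + t *: H0.
have hkt : hankel Ht by move=> i j k l E; rewrite !mxE (hk _ _ _ _ E) (hk0 _ _ _ _ E).
have symt : Ht^T = Ht by rewrite /Ht linearD /= linearZ /= symH sym0.
have pdt (x : 'cV_N.+1) : x != 0 -> 0 < (x^T *m Ht *m x) 0 0.
  move=> x0; have -> : x^T *m Ht *m x = x^T *m H *m x + t *: (x^T *m H0 *m x).
    by rewrite /Ht mulmxDr mulmxDl -scalemxAr -scalemxAl.
  rewrite [ltRHS]mxE [X in _ + X]mxE; apply: ltr_wpDl; first exact: psdH.
  by apply: mulr_gt0 => //; exact: pd0.
have [m [lam [m0 HE]]] := hankel_pd_moments hkt symt pdt.
have [c hc] := moments_approx d0 hJ m0 HE.
have := le_trans (residual_le_dist _ _ _ c) hc.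
have gE p : matfun Ht p = g p + t * g0 p by rewrite /matfun !mxE.
have EE p : matfun Ht p - P (matfun Ht) p = e p + t * e0 p.
  have -> : P (matfun Ht) p = P g p + t * P g0 p by rewrite -projkZ -projkD; exact: eq_dot.
  by rewrite gE /e /e0; ring.
rewrite -/P (eq_dot EE EE).
rewrite (eq_dot gE gE) !dot_addZ -subr_le0 => h.
by move: h; apply: etrans; congr (_ <= _); ring.
Qed.

End HankelApprox.

(** * A structured language for the machine *)

Inductive nexpr : Type :=
| NV of nat | NC of nat | NPlus of nexpr & nexpr | NMinus of nexpr & nexpr | NHf of nexpr.

Inductive rexpr : Type :=
| XV of nat | XN of nexpr | XA of nat & nexpr
| XPlus of rexpr & rexpr | XMinus of rexpr & rexpr | XTimes of rexpr & rexpr | XOver of rexpr & rexpr.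

(** Every loop runs a counter up to the content of a register, so termination and running time
    follow from the syntax. *)
Inductive stmt : Type :=
| SN of nat & nexpr
| SX of nat & rexpr
| SA of nat & nexpr & rexpr
| SQ of nat & nexpr & nexpr
| SF of nat
| SS of stmt & stmt
| SI of nexpr & nexpr & stmt & stmt
| SFor of nat & nat & stmt.

(* Registers are the cells 0..31 of either memory, expression temporaries the
   cells from 32 on, and entry i of the q-th of eight real arrays is X[64+q+8i]. *)
Definition arr_addr (q i : nat) : nat := (64 + q + 8 * i)%N.

(** The result lands in cell 32 + k, and no cell below it is written. Copying is adding zero. *)
Fixpoint compN (e : nexpr) (k : nat) : cmd :=
  match e with
  | NV r => Seq (Do (NConst (33 + k) 0)) (Do (NAdd (32 + k) r (33 + k)))
  | NC c => Do (NConst (32 + k) c)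
  | NPlus e1 e2 => Seq (compN e1 k) (Seq (compN e2 k.+1) (Do (NAdd (32 + k) (32 + k) (33 + k))))
  | NMinus e1 e2 => Seq (compN e1 k) (Seq (compN e2 k.+1) (Do (NSub (32 + k) (32 + k) (33 + k))))
  | NHf e1 => Seq (compN e1 k) (Do (NHalf (32 + k) (32 + k)))
  end.

(** Three doublings stand for the multiplication by 8 in [arr_addr]. *)
Definition comp_addr (q : nat) : cmd :=
  Seq (Do (NAdd 32 32 32)) (Seq (Do (NAdd 32 32 32)) (Seq (Do (NAdd 32 32 32))
    (Seq (Do (NConst 33 (64 + q))) (Do (NAdd 32 33 32))))).

Fixpoint compX (e : rexpr) (k : nat) : cmd :=
  match e with
  | XV x => Seq (Do (NConst 32 0)) (Seq (Do (RNat (32 + k) 32)) (Do (RAdd (32 + k) x (32 + k))))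
  | XN e1 => Seq (compN e1 0) (Do (RNat (32 + k) 32))
  | XA q e1 => Seq (compN e1 0) (Seq (comp_addr q) (Do (RLoad (32 + k) 32)))
  | XPlus e1 e2 => Seq (compX e1 k) (Seq (compX e2 k.+1) (Do (RAdd (32 + k) (32 + k) (33 + k))))
  | XMinus e1 e2 => Seq (compX e1 k) (Seq (compX e2 k.+1) (Do (RSub (32 + k) (32 + k) (33 + k))))
  | XTimes e1 e2 => Seq (compX e1 k) (Seq (compX e2 k.+1) (Do (RMul (32 + k) (32 + k) (33 + k))))
  | XOver e1 e2 => Seq (compX e1 k) (Seq (compX e2 k.+1) (Do (RDiv (32 + k) (32 + k) (33 + k))))
  end.

Fixpoint comp (p : stmt) : cmd :=
  match p with
  | SN r e => Seq (compN e 0) (Seq (Do (NConst 33 0)) (Do (NAdd r 32 33)))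
  | SX x e => Seq (compX e 0) (Seq (Do (NConst 32 0)) (Seq (Do (RNat 33 32)) (Do (RAdd x 32 33))))
  | SA q i e => Seq (compX e 0) (Seq (compN i 0) (Seq (comp_addr q) (Do (RStore 32 32))))
  | SQ x i j => Seq (compN i 0) (Seq (compN j 1) (Do (Query x 32 33)))
  | SF r => Do (Flip r)
  | SS p1 p2 => Seq (comp p1) (comp p2)
  | SI e1 e2 p1 p2 => Seq (compN e1 0) (Seq (compN e2 1) (If (NLt 32 33) (comp p1) (comp p2)))
  | SFor i r p1 => Seq (Do (NConst i 0))
      (While (NLt i r) (Seq (comp p1) (Seq (Do (NConst 32 1)) (Do (NAdd i i 32)))))
  end.

Fixpoint costN (e : nexpr) : nat :=
  match e with
  | NV _ => 2 | NC _ => 1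
  | NPlus e1 e2 | NMinus e1 e2 => (costN e1 + (costN e2 + 1))%N
  | NHf e1 => (costN e1 + 1)%N
  end.

Fixpoint costX (e : rexpr) : nat :=
  match e with
  | XV _ => 3 | XN e1 => (costN e1 + 1)%N | XA _ e1 => (costN e1 + (5 + 1))%N
  | XPlus e1 e2 | XMinus e1 e2 | XTimes e1 e2 | XOver e1 e2 => (costX e1 + (costX e2 + 1))%N
  end.

(** An upper bound on the steps when no loop runs more than [b] rounds; both branches of a
    conditional are charged. *)
Fixpoint cost (b : nat) (p : stmt) : nat :=
  match p with
  | SN _ e => (costN e + 2)%N
  | SX _ e => (costX e + 3)%N
  | SA _ i e => (costX e + (costN i + (5 + 1)))%N
  | SQ _ i j => (costN i + (costN j + 1))%N
  | SF _ => 1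
  | SS p1 p2 => (cost b p1 + cost b p2)%N
  | SI e1 e2 p1 p2 => (costN e1 + (costN e2 + (cost b p1 + cost b p2).+1))%N
  | SFor _ _ p1 => (1 + (b * (cost b p1 + 3) + 1))%N
  end.

Fixpoint size_stmt (p : stmt) : nat :=
  match p with
  | SS p1 p2 => (size_stmt p1 + size_stmt p2)%N
  | SI e1 e2 p1 p2 => (costN e1 + costN e2 + 1 + size_stmt p1 + size_stmt p2)%N
  | SFor _ _ p1 => (size_stmt p1 + 5)%N
  | _ => cost 0 p
  end.

Fixpoint nesting (p : stmt) : nat :=
  match p with
  | SS p1 p2 | SI _ _ p1 p2 => maxn (nesting p1) (nesting p2)
  | SFor _ _ p1 => (nesting p1).+1
  | _ => 0%N
  end.

Lemma cost_le (b : nat) (p : stmt) : (cost b p <= size_stmt p * b.+1 ^ nesting p)%N.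
Proof.
have mono k l : (k <= l)%N -> (b.+1 ^ k <= b.+1 ^ l)%N by move=> h; rewrite leq_pexp2l.
have pos k : (0 < b.+1 ^ k)%N by rewrite expn_gt0.
have one x k : (x <= x * b.+1 ^ k)%N by rewrite leq_pmulr.
elim: p => [r e|x e|q i e|x i j|r|p1 IH1 p2 IH2|e1 e2 p1 IH1 p2 IH2|i r p1 IH] /=;
  rewrite ?muln1 //.
- rewrite mulnDl; apply: leq_add.
    by apply: leq_trans IH1 _; rewrite leq_mul2l mono ?orbT // leq_maxl.
  by apply: leq_trans IH2 _; rewrite leq_mul2l mono ?orbT // leq_maxr.
- rewrite !mulnDl; set k := maxn _ _.
  have h1 : (cost b p1 <= size_stmt p1 * b.+1 ^ k)%N.
    by apply: leq_trans IH1 _; rewrite leq_mul2l mono ?orbT // leq_maxl.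
  have h2 : (cost b p2 <= size_stmt p2 * b.+1 ^ k)%N.
    by apply: leq_trans IH2 _; rewrite leq_mul2l mono ?orbT // leq_maxr.
  have := one (costN e1) k; have := one (costN e2) k; have := one 1%N k; lia.
- have h := pos (nesting p1); rewrite expnS; set X := (b.+1 ^ _)%N in IH h *.
  have : (b * (cost b p1 + 3) <= b * (size_stmt p1 * X + 3))%N by rewrite leq_mul2l leq_add2r IH orbT.
  nia.
Qed.

(** The depth of temporaries is not limited here, since the natural-number memory holds no arrays;
    [okX] has to keep real temporaries below cell 64. *)
Fixpoint okN (e : nexpr) : bool :=
  match e with
  | NV r => (r < 32)%N | NC _ => true
  | NPlus e1 e2 | NMinus e1 e2 => okN e1 && okN e2
  | NHf e1 => okN e1
  end.

Fixpoint okX (e : rexpr) (k : nat) : bool :=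
  (k < 31)%N &&
  match e with
  | XV x => (x < 32)%N | XN e1 => okN e1 | XA q e1 => (q < 8)%N && okN e1
  | XPlus e1 e2 | XMinus e1 e2 | XTimes e1 e2 | XOver e1 e2 => okX e1 k && okX e2 k.+1
  end.

Fixpoint writesN (p : stmt) : seq nat :=
  match p with
  | SN r _ | SF r => [:: r]
  | SS p1 p2 | SI _ _ p1 p2 => writesN p1 ++ writesN p2
  | SFor i _ p1 => i :: writesN p1
  | _ => [::]
  end.

Fixpoint writesX (p : stmt) : seq nat :=
  match p with
  | SX x _ | SQ x _ _ => [:: x]
  | SS p1 p2 | SI _ _ p1 p2 => writesX p1 ++ writesX p2
  | SFor _ _ p1 => writesX p1
  | _ => [::]
  end.

Fixpoint writesA (p : stmt) : seq nat :=
  match p with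
  | SA q _ _ => [:: q]
  | SS p1 p2 | SI _ _ p1 p2 => writesA p1 ++ writesA p2
  | SFor _ _ p1 => writesA p1
  | _ => [::]
  end.

(** [Pr] lists protected registers: every loop bound is one of them and nothing writes to them. So
    loop bounds keep their initial values, and a bound on those controls the running time. *)
Fixpoint ok (Pr : seq nat) (p : stmt) : bool :=
  match p with
  | SN r e => [&& (r < 32)%N, r \notin Pr & okN e]
  | SX x e => (x < 32)%N && okX e 0
  | SA q i e => [&& (q < 8)%N, okN i & okX e 0]
  | SQ x i j => [&& (x < 32)%N, okN i & okN j]
  | SF r => (r < 32)%N && (r \notin Pr)
  | SS p1 p2 => ok Pr p1 && ok Pr p2
  | SI e1 e2 p1 p2 => [&& okN e1, okN e2, ok Pr p1 & ok Pr p2]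
  | SFor i r p1 => [&& (i < 32)%N, (r < 32)%N, i \notin Pr, r \in Pr, i \notin writesN p1 & ok Pr p1]
  end.

(** * Semantics of the language and correctness of its compilation *)

Section Semantics.
Variables (R : realType) (B : nat -> nat -> R) (w : nat -> bool).

Record ast : Type := Ast { nr : nat -> nat; xr : nat -> R; ar : nat -> nat -> R; co : nat }.

Definition setn (a : ast) r v := Ast (upd (nr a) r v) (xr a) (ar a) (co a).
Definition setx (a : ast) x v := Ast (nr a) (upd (xr a) x v) (ar a) (co a).
Definition seta (a : ast) q i v := Ast (nr a) (xr a) (upd (ar a) q (upd (ar a q) i v)) (co a).

Fixpoint evN (e : nexpr) (N : nat -> nat) : nat :=
  match e with
  | NV r => N r | NC c => c
  | NPlus e1 e2 => (evN e1 N + evN e2 N)%N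
  | NMinus e1 e2 => (evN e1 N - evN e2 N)%N
  | NHf e1 => (evN e1 N)./2
  end.

Fixpoint evX (e : rexpr) (a : ast) : R :=
  match e with
  | XV x => xr a x | XN e1 => (evN e1 (nr a))%:R | XA q e1 => ar a q (evN e1 (nr a))
  | XPlus e1 e2 => evX e1 a + evX e2 a
  | XMinus e1 e2 => evX e1 a - evX e2 a
  | XTimes e1 e2 => evX e1 a * evX e2 a
  | XOver e1 e2 => evX e1 a / evX e2 a
  end.

Fixpoint den (p : stmt) (a : ast) : ast :=
  match p with
  | SN r e => setn a r (evN e (nr a))
  | SX x e => setx a x (evX e a)
  | SA q i e => seta a q (evN i (nr a)) (evX e a)
  | SQ x i j => setx a x (B (evN i (nr a)) (evN j (nr a)))
  | SF r => Ast (upd (nr a) r (w (co a) : nat)) (xr a) (ar a) (co a).+1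
  | SS p1 p2 => den p2 (den p1 a)
  | SI e1 e2 p1 p2 => if (evN e1 (nr a) < evN e2 (nr a))%N then den p1 a else den p2 a
  | SFor i r p1 => iter (nr a r) (fun a => setn (den p1 a) i (nr (den p1 a) i).+1) (setn a i 0)
  end.

Lemma updE (V : Type) (f : nat -> V) k v : upd f k v k = v.
Proof. by rewrite /upd eqxx. Qed.

Lemma updNE (V : Type) (f : nat -> V) k v j : j != k -> upd f k v j = f j.
Proof. by rewrite /upd => /negPf ->. Qed.

Lemma den_frameN p a k : k \notin writesN p -> nr (den p a) k = nr a k.
Proof.
elim: p a => [r e|x e|q i e|x i j|r|p1 IH1 p2 IH2|e1 e2 p1 IH1 p2 IH2|i r p1 IH] a //=.
- by rewrite inE => h; rewrite updNE.
- by rewrite inE => h; rewrite updNE.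
- by rewrite mem_cat negb_or => /andP[h1 h2]; rewrite IH2 ?IH1.
- by rewrite mem_cat negb_or => /andP[h1 h2]; case: ifP => _; rewrite ?IH1 ?IH2.
- rewrite inE negb_or => /andP[h1 h2].
  elim: (nr a r) => [|m IHm] /=; first by rewrite updNE.
  by rewrite updNE // IH.
Qed.

Lemma den_frameX p a k : k \notin writesX p -> xr (den p a) k = xr a k.
Proof.
elim: p a => [r e|x e|q i e|x i j|r|p1 IH1 p2 IH2|e1 e2 p1 IH1 p2 IH2|i r p1 IH] a //=.
- by rewrite inE => h; rewrite updNE.
- by rewrite inE => h; rewrite updNE.
- by rewrite mem_cat negb_or => /andP[h1 h2]; rewrite IH2 ?IH1.
- by rewrite mem_cat negb_or => /andP[h1 h2]; case: ifP => _; rewrite ?IH1 ?IH2.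
- move=> h2; elim: (nr a r) => [|m IHm] //=.
  by rewrite IH.
Qed.

Lemma den_frameA p a k : k \notin writesA p -> ar (den p a) k = ar a k.
Proof.
elim: p a => [r e|x e|q i e|x i j|r|p1 IH1 p2 IH2|e1 e2 p1 IH1 p2 IH2|i r p1 IH] a //=.
- by rewrite inE => h; rewrite updNE.
- by rewrite mem_cat negb_or => /andP[h1 h2]; rewrite IH2 ?IH1.
- by rewrite mem_cat negb_or => /andP[h1 h2]; case: ifP => _; rewrite ?IH1 ?IH2.
- move=> h2; elim: (nr a r) => [|m IHm] //=.
  by rewrite IH.
Qed.

Lemma ok_writes Pr p k : ok Pr p -> k \in Pr -> k \notin writesN p.
Proof.
have ne r : k \in Pr -> r \notin Pr -> k != r by move=> kP; apply: contraNneq => <-.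
elim: p => [r e|x e|q i e|x i j|r|p1 IH1 p2 IH2|e1 e2 p1 IH1 p2 IH2|i r p1 IH] //=.
- by move=> /and3P[_ h _] kP; rewrite inE ne.
- by move=> /andP[_ h] kP; rewrite inE ne.
- by move=> /andP[h1 h2] kP; rewrite mem_cat negb_or IH1 ?IH2.
- by move=> /and4P[_ _ h1 h2] kP; rewrite mem_cat negb_or IH1 ?IH2.
- by move=> /and5P[_ _ h1 _ /andP[_ h2]] kP; rewrite inE negb_or ne // IH.
Qed.

Lemma den_for (Inv : nat -> ast -> Prop) i r p a :
  i \notin writesN p ->
  Inv 0%N (setn a i 0) ->
  (forall t a', (t < nr a r)%N -> nr a' i = t -> Inv t a' -> Inv t.+1 (setn (den p a') i t.+1)) ->
  Inv (nr a r) (den (SFor i r p) a).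
Proof.
move=> ip h0 hS /=.
suff : forall m, (m <= nr a r)%N ->
    let a' := iter m (fun a => setn (den p a) i (nr (den p a) i).+1) (setn a i 0) in
    nr a' i = m /\ Inv m a' by move=> /(_ _ (leqnn _)) [].
elim=> [|m IH] mr /=; first by rewrite updE.
have [e Im] := IH (ltnW mr); rewrite updE den_frameN // e; split=> //.
by apply: hS.
Qed.

(** Temporaries are unconstrained, so compiled code may overwrite them. *)
Definition sim (s : state R) (a : ast) : Prop :=
  [/\ forall j, (j < 32)%N -> nmem s j = nr a j,
      forall j, (j < 32)%N -> rmem s j = xr a j,
      forall q i, (q < 8)%N -> rmem s (arr_addr q i) = ar a q i &
      coins s = co a].

Local Notation hw := (@halts_within R B w).

Lemma hw_seq T1 T2 c1 c2 s s1 s2 : hw T1 c1 s s1 -> hw T2 c2 s1 s2 -> hw (T1 + T2) (Seq c1 c2) s s2.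
Proof.
move=> [t1 h1 e1] [t2 h2 e2]; exists (t1 + t2)%N; first exact: leq_add.
exact: ExecSeq e1 e2.
Qed.

Lemma hw_do i s : hw 1 (Do i) s (step B w i s).
Proof. by exists 1%N => //; constructor. Qed.

Lemma hw_le T T' c s s' : (T <= T')%N -> hw T c s s' -> hw T' c s s'.
Proof. by move=> le_T [t h e]; exists t => //; exact: leq_trans le_T. Qed.

Lemma eq_evN e N N' : okN e -> (forall j, (j < 32)%N -> N j = N' j) -> evN e N = evN e N'.
Proof.
move=> + h; elim: e => //= [e1 IH1 e2 IH2|e1 IH1 e2 IH2|e1 IH1].
- by move=> /andP[/IH1 -> /IH2 ->].
- by move=> /andP[/IH1 -> /IH2 ->].
- by move=> /IH1 ->.
Qed.

Lemma compN_ok e k s : okN e -> exists s', [/\ hw (costN e) (compN e k) s s',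
  rmem s' = rmem s, coins s' = coins s, (forall j, (j < 32 + k)%N -> nmem s' j = nmem s j) &
  nmem s' (32 + k)%N = evN e (nmem s)].
Proof.
elim: e k s => [r|c|e1 IH1 e2 IH2|e1 IH1 e2 IH2|e1 IH1] k s /=.
- move=> hr; eexists; split; first by apply: hw_seq (hw_do _ _) (hw_do _ _).
  + by [].
  + by [].
  + by move=> j jk /=; rewrite !updNE //; lia.
  + by rewrite /= !updE addn0 updNE //; lia.
- move=> _; eexists; split; first exact: hw_do.
  + by [].
  + by [].
  + by move=> j jk /=; rewrite !updNE //; lia.
  + by rewrite /= !updE.
- move=> /andP[o1 o2].
  have [s1 [h1 r1 c1 n1 v1]] := IH1 k s o1.
  have [s2 [h2 r2 c2 n2 v2]] := IH2 k.+1 s1 o2.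
  eexists; split; first by apply: hw_seq h1 (hw_seq h2 (hw_do _ _)).
  + by rewrite /= r2.
  + by rewrite /= c2.
  + by move=> j jk /=; rewrite updNE ?n2 ?n1 //; lia.
  + rewrite /= updE n2; last lia.
    rewrite v1; congr (_ + _)%N; rewrite (_ : 33 + k = 32 + k.+1)%N; last lia.
    by rewrite v2; apply: eq_evN => // j jl; apply: n1; lia.
- move=> /andP[o1 o2].
  have [s1 [h1 r1 c1 n1 v1]] := IH1 k s o1.
  have [s2 [h2 r2 c2 n2 v2]] := IH2 k.+1 s1 o2.
  eexists; split; first by apply: hw_seq h1 (hw_seq h2 (hw_do _ _)).
  + by rewrite /= r2.
  + by rewrite /= c2.
  + by move=> j jk /=; rewrite updNE ?n2 ?n1 //; lia.
  + rewrite /= updE n2; last lia.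
    rewrite v1; congr (_ - _)%N; rewrite (_ : 33 + k = 32 + k.+1)%N; last lia.
    by rewrite v2; apply: eq_evN => // j jl; apply: n1; lia.
- move=> o1; have [s1 [h1 r1 c1 n1 v1]] := IH1 k s o1.
  eexists; split; first by apply: hw_seq h1 (hw_do _ _).
  + by rewrite /= r1.
  + by rewrite /= c1.
  + by move=> j jk /=; rewrite updNE ?n1 //; lia.
  + by rewrite /= updE v1.
Qed.

Lemma comp_addr_ok q s : exists s', [/\ hw 5 (comp_addr q) s s',
  rmem s' = rmem s, coins s' = coins s, (forall j, (j < 32)%N -> nmem s' j = nmem s j) &
  nmem s' 32 = arr_addr q (nmem s 32)].
Proof.
eexists; split.
- exact: (hw_seq (hw_do _ _) (hw_seq (hw_do _ _) (hw_seq (hw_do _ _) (hw_seq (hw_do _ _) (hw_do _ _))))).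
- by [].
- by [].
- by move=> j jk /=; rewrite !updNE //; lia.
- by rewrite /= /upd /= /arr_addr; lia.
Qed.

Lemma arr_addr_ge q i : (64 <= arr_addr q i)%N.
Proof. by rewrite /arr_addr -addnA leq_addr. Qed.

Lemma compX_ok e k s a : sim s a -> okX e k -> exists s', [/\ hw (costX e) (compX e k) s s',
  coins s' = coins s, (forall j, (j < 32)%N -> nmem s' j = nmem s j),
  (forall j, (j < 32 + k)%N || (64 <= j)%N -> rmem s' j = rmem s j) &
  rmem s' (32 + k)%N = evX e a].
Proof.
have simX s1 s2 k' : sim s1 a -> coins s2 = coins s1 -> (forall j, (j < 32)%N -> nmem s2 j = nmem s1 j) ->
    (forall j, (j < 32 + k')%N || (64 <= j)%N -> rmem s2 j = rmem s1 j) -> sim s2 a.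
  move=> [a1 a2 a3 a4] b1 b2 b3; split.
  - by move=> j jl; rewrite b2 ?a1.
  - by move=> j jl; rewrite b3 ?a2 //; lia.
  - by move=> q i ql; rewrite b3 ?a3 // arr_addr_ge orbT.
  - by rewrite b1.
have bin (op : nat -> nat -> nat -> instr) (f : R -> R -> R) e1 e2 :
    (forall x y z s, step B w (op x y z) s = Defs.setX s x (f (rmem s y) (rmem s z))) ->
    (forall k s, sim s a -> okX e1 k -> exists s', [/\ hw (costX e1) (compX e1 k) s s',
      coins s' = coins s, (forall j, (j < 32)%N -> nmem s' j = nmem s j),
      (forall j, (j < 32 + k)%N || (64 <= j)%N -> rmem s' j = rmem s j) & rmem s' (32 + k)%N = evX e1 a]) ->
    (forall k s, sim s a -> okX e2 k -> exists s', [/\ hw (costX e2) (compX e2 k) s s',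
      coins s' = coins s, (forall j, (j < 32)%N -> nmem s' j = nmem s j),
      (forall j, (j < 32 + k)%N || (64 <= j)%N -> rmem s' j = rmem s j) & rmem s' (32 + k)%N = evX e2 a]) ->
    forall k s, sim s a -> (k < 31)%N && (okX e1 k && okX e2 k.+1) -> exists s',
    [/\ hw (costX e1 + (costX e2 + 1)) (Seq (compX e1 k) (Seq (compX e2 k.+1) (Do (op (32 + k)%N (32 + k)%N (33 + k)%N)))) s s',
      coins s' = coins s, (forall j, (j < 32)%N -> nmem s' j = nmem s j),
      (forall j, (j < 32 + k)%N || (64 <= j)%N -> rmem s' j = rmem s j) &
      rmem s' (32 + k)%N = f (evX e1 a) (evX e2 a)].
  move=> hop IH1 IH2 {}k {}s hs /and3P[kl o1 o2].
  have [s1 [h1 c1 n1 r1 v1]] := IH1 k s hs o1.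
  have [s2 [h2 c2 n2 r2 v2]] := IH2 k.+1 s1 (simX _ _ _ hs c1 n1 r1) o2.
  eexists; split; first by apply: hw_seq h1 (hw_seq h2 (hw_do _ _)).
  + by rewrite hop /= c2.
  + by move=> j jl; rewrite hop /= n2 ?n1.
  + move=> j jl; rewrite hop /= updNE; last lia.
    by rewrite r2 ?r1 //; lia.
  + rewrite hop /= updE (_ : 33 + k = 32 + k.+1)%N; last lia.
    by rewrite v2 r2 ?v1 //; lia.
elim: e k s => [x|e1|q e1|e1 IH1 e2 IH2|e1 IH1 e2 IH2|e1 IH1 e2 IH2|e1 IH1 e2 IH2] k s hs /=.
- move=> /andP[kl xl]; have [a1 a2 a3 a4] := hs.
  eexists; split; first by apply: hw_seq (hw_do _ _) (hw_seq (hw_do _ _) (hw_do _ _)).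
  + by [].
  + by move=> j jl /=; rewrite updNE //; lia.
  + by move=> j jl /=; rewrite !updNE //; lia.
  + by rewrite /= !updE updNE ?a2 ?addr0 //; lia.
- move=> /andP[kl o1]; have [a1 a2 a3 a4] := hs.
  have [s1 [h1 r1 c1 n1 v1]] := @compN_ok e1 0 s o1.
  eexists; split; first by apply: hw_seq h1 (hw_do _ _).
  + by rewrite /= c1.
  + by move=> j jl /=; rewrite n1 // addn0.
  + by move=> j jl /=; rewrite updNE ?r1 //; lia.
  + rewrite /= updE; move: v1; rewrite addn0 => ->.
    by rewrite (eq_evN o1 a1).
- move=> /and3P[kl ql o1]; have [a1 a2 a3 a4] := hs.
  have [s1 [h1 r1 c1 n1 v1]] := @compN_ok e1 0 s o1.
  have [s2 [h2 r2 c2 n2 v2]] := comp_addr_ok q s1.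
  eexists; split; first by apply: hw_seq h1 (hw_seq h2 (hw_do _ _)).
  + by rewrite /= c2.
  + by move=> j jl /=; rewrite n2 ?n1 // addn0.
  + by move=> j jl /=; rewrite updNE ?r2 ?r1 //; lia.
  + rewrite /= updE v2 r2 r1; move: v1; rewrite addn0 => ->.
    by rewrite a3 // (eq_evN o1 a1).
- by move=> o; exact: (bin RAdd +%R).
- by move=> o; exact: (bin RSub (fun x y => x - y)).
- by move=> o; exact: (bin RMul *%R).
- by move=> o; exact: (bin RDiv (fun x y => x / y)).
Qed.

Lemma arr_addr_inj q q' i i' : (q < 8)%N -> (q' < 8)%N -> arr_addr q i = arr_addr q' i' -> q = q' /\ i = i'.
Proof. by rewrite /arr_addr => h h' e; split; lia. Qed.

Lemma comp_ok Pr b p s a : sim s a -> ok Pr p -> (forall r, r \in Pr -> (nr a r <= b)%N) ->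
  exists2 s', hw (cost b p) (comp p) s s' & sim s' (den p a).
Proof.
elim: p s a => [r e|x e|q i e|x i j|r|p1 IH1 p2 IH2|e1 e2 p1 IH1 p2 IH2|i r p1 IH] s a hs /=.
- move=> /and3P[rl _ o] _; have [a1 a2 a3 a4] := hs.
  have [s1 [h1 r1 c1 n1 v1]] := @compN_ok e 0 s o.
  eexists; first by apply: hw_seq h1 (@hw_seq 1 1 _ _ _ _ _ (hw_do _ _) (hw_do _ _)).
  split=> /=.
  + move=> j jl; rewrite /upd /=; case: eqP => // _.
      by rewrite addn0; move: v1; rewrite addn0 => ->; exact: eq_evN.
    by rewrite ifF ?n1 ?a1 //; lia.
  + by move=> j jl; rewrite r1 a2.
  + by move=> q' i' ql; rewrite r1 a3.
  + by rewrite c1.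
- move=> /andP[xl o] _.
  have [s1 [h1 c1 n1 r1 v1]] := compX_ok hs o; have [a1 a2 a3 a4] := hs.
  eexists; first by apply: hw_seq h1 (@hw_seq 1 2 _ _ _ _ _ (hw_do _ _) (@hw_seq 1 1 _ _ _ _ _ (hw_do _ _) (hw_do _ _))).
  split=> /=.
  + by move=> j jl; rewrite updNE ?n1 ?a1 //; lia.
  + move=> j jl; rewrite /upd /=; case: eqP => // _.
      by move: v1; rewrite addn0 => ->; rewrite addr0.
    by rewrite ifF ?r1 ?a2 //; lia.
  + move=> q' i' ql; have := arr_addr_ge q' i' => h; rewrite !updNE ?r1 ?a3 ?h ?orbT //; lia.
  + by rewrite c1.
- move=> /and3P[ql oi o] _.
  have [s1 [h1 c1 n1 r1 v1]] := compX_ok hs o; have [a1 a2 a3 a4] := hs.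
  have [s2 [h2 r2 c2 n2 v2]] := @compN_ok i 0 s1 oi.
  have [s3 [h3 r3 c3 n3 v3]] := comp_addr_ok q s2.
  eexists; first by apply: hw_seq h1 (hw_seq h2 (hw_seq h3 (hw_do _ _))).
  have iE : nmem s2 32 = evN i (nr a).
    by move: v2; rewrite addn0 => ->; apply: eq_evN => // j jl; rewrite n1 ?a1.
  split=> /=.
  + by move=> j jl; rewrite n3 ?n2 ?n1 ?a1 // addn0.
  + move=> j jl; rewrite v3 updNE; last by have := arr_addr_ge q (nmem s2 32); lia.
    by rewrite r3 r2 r1 ?a2 //; lia.
  + move=> q' i' ql'; rewrite v3 iE /upd r3 r2; case: eqP => [e'|ne].
      have [-> ->] := arr_addr_inj ql' ql e'; rewrite !eqxx.
      by move: v1; rewrite addn0.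
    rewrite r1 ?arr_addr_ge ?orbT // a3 //; case: eqP => //= qq; subst q'; case: eqP => // ii.
    by case: ne; rewrite ii.
  + by rewrite c3 c2 c1.
- move=> /and3P[xl oi oj] _; have [a1 a2 a3 a4] := hs.
  have [s1 [h1 r1 c1 n1 v1]] := @compN_ok i 0 s oi.
  have [s2 [h2 r2 c2 n2 v2]] := @compN_ok j 1 s1 oj.
  eexists; first by apply: hw_seq h1 (hw_seq h2 (hw_do _ _)).
  split=> /=.
  + by move=> k kl; rewrite n2 ?n1 ?a1 //; lia.
  + move=> k kl; rewrite n2 //; move: v1 v2; rewrite addn0 => -> ->.
    rewrite /upd r2 r1 a2 //; case: eqP => // _; congr B; first exact: eq_evN.
    by apply: eq_evN => // k' kl'; rewrite n1 ?a1 //; lia.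
  + by move=> q' i' ql; have h := arr_addr_ge q' i'; rewrite updNE ?r2 ?r1 ?a3 //; lia.
  + by rewrite c2 c1.
- move=> /andP[rl _] _; have [a1 a2 a3 a4] := hs.
  eexists; first exact: hw_do.
  split=> //=; last by rewrite a4.
  by move=> j jl; rewrite /upd a4 a1.
- move=> /andP[o1 o2] hb.
  have [s1 h1 hs1] := IH1 s a hs o1 hb.
  have [|s2 h2 hs2] := IH2 s1 (den p1 a) hs1 o2.
    by move=> k kP; rewrite den_frameN ?hb //; exact: ok_writes o1 kP.
  by exists s2 => //; exact: hw_seq h1 h2.
- move=> /and4P[oe1 oe2 o1 o2] hb; have [a1 a2 a3 a4] := hs.
  have [s1 [h1 r1 c1 n1 v1]] := @compN_ok e1 0 s oe1.
  have [s2 [h2 r2 c2 n2 v2]] := @compN_ok e2 1 s1 oe2.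
  have hs2 : sim s2 a.
    split.
    + by move=> k kl; rewrite n2 ?n1 ?a1 //; lia.
    + by move=> k kl; rewrite r2 r1 a2.
    + by move=> q' i' ql; rewrite r2 r1 a3.
    + by rewrite c2 c1.
  have tE : holds (NLt 32 33) s2 = (evN e1 (nr a) < evN e2 (nr a))%N.
    rewrite /= n2 //; move: v1 v2; rewrite addn0 => -> ->; congr (_ < _)%N; first exact: eq_evN.
    by apply: eq_evN => // k' kl'; rewrite n1 ?a1 //; lia.
  have [s3 [t3 t3l e3] hs3] : exists2 s', hw (cost b p1 + cost b p2) (if holds (NLt 32 33) s2 then comp p1 else comp p2) s2 s' &
     sim s' (if (evN e1 (nr a) < evN e2 (nr a))%N then den p1 a else den p2 a).
    rewrite tE; case: ifP => _.
      by have [s3 h3 hs3] := IH1 s2 a hs2 o1 hb; exists s3 => //; apply: hw_le h3; rewrite leq_addr.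
    by have [s3 h3 hs3] := IH2 s2 a hs2 o2 hb; exists s3 => //; apply: hw_le h3; rewrite leq_addl.
  exists s3 => //; apply: hw_seq h1 (hw_seq h2 _).
  by exists t3.+1 => //; exact: ExecIf.
- move=> /and5P[il rl iP rP /andP[iw o]] hb.
  have ne_ir : r != i by apply: contraNneq iP => <-.
  have hs0 : sim (step B w (NConst i 0) s) (setn a i 0).
    have [a1 a2 a3 a4] := hs; split=> //= j jl; by rewrite /upd a1.
  pose F a := setn (den p1 a) i (nr (den p1 a) i).+1.
  have loop m : forall s1 a1, sim s1 a1 -> nr a1 i = (nr a r - m)%N -> (m <= nr a r)%N ->
      (forall k, k \in Pr -> nr a1 k = nr a k) ->
      exists2 s2, hw (m * (cost b p1 + 3) + 1) (While (NLt i r) (Seq (comp p1) (Seq (Do (NConst 32 1)) (Do (NAdd i i 32))))) s1 s2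
        & sim s2 (iter m F a1).
    elim: m => [|m IHm] s1 a1 hs1 ei mr hP.
      exists s1 => //; exists 1%N => //; apply: ExecWhileF => /=.
      by have [b1 _ _ _] := hs1; rewrite !b1 // ei hP // subn0 ltnn.
    have [|s2 h2 hs2] := IH s1 a1 hs1 o.
      by move=> k kP; rewrite hP ?hb.
    pose s3 := step B w (NAdd i i 32) (step B w (NConst 32 1) s2).
    have hs3 : sim s3 (F a1).
      have [b1 b2 b3 b4] := hs2; split=> //= j jl; rewrite /upd b1 //.
      case: eqP => [|_] /=; last by rewrite ifF ?b1 //; lia.
      by move=> _; rewrite ifF ?addn1 //; lia.
    have [|||s4 [t4 t4l e4] hs4] := IHm s3 (F a1) hs3.
    - by rewrite /F /= updE den_frameN // ei; lia.
    - exact: ltnW.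
    - move=> k kP; rewrite /F /= updNE; last by apply: contraNneq iP => <-.
      by rewrite den_frameN ?hP //; exact: ok_writes o kP.
    exists s4; last by rewrite iterSr.
    have [t2 t2l e2] := hw_seq h2 (hw_seq (hw_do (NConst 32 1) s2) (hw_do (NAdd i i 32) _)).
    exists (t2 + t4).+1; first by rewrite mulSn; lia.
    apply: ExecWhileT e2 e4 => /=.
    by have [b1 _ _ _] := hs1; rewrite !b1 // ei hP //; lia.
  have [|||s2 h2 hs2] := loop (nr a r) _ _ hs0.
  - by rewrite /= updE subnn.
  - by [].
  - by move=> k kP; rewrite /= updNE //; apply: contraNneq iP => <-.
  exists s2 => //; apply: hw_seq (hw_do _ _) _.
  by apply: hw_le h2; rewrite leq_add2r leq_mul2r hb ?orbT.
Qed.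

End Semantics.

(** * The program *)

(* N0 = n, N3 = L (so that 2n <= 2^L), N4 = d, N5 = number of shells, N6 = number
   of nodes, N7 = number of iterations, N8 = number of bits of a scale; a sample
   is N16 = scale m, N17 = row, N18 = column, N19 = 2^m, N21 = side.
   A0 = nodes, A3 = kernel matrix, A4 = coefficients, A1 and A2 = work vectors. *)
Notation "p ;; q" := (SS p q) (at level 60, right associativity).

Definition Skp : stmt := SN 31 (NV 31).

(* X1 := 1 + y + ... + y^(m-1) by binary splitting of m, where N3 bounds the bit length of m. *)
Definition GeoBody : stmt :=
  SI (NC 0) (NMinus (NV 10) (NPlus (NHf (NV 10)) (NHf (NV 10))))
     (SX 1 (XPlus (XV 2) (XTimes (XV 3) (XV 1)))) Skp ;;
  SX 2 (XPlus (XV 2) (XTimes (XV 2) (XV 3))) ;;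
  SX 3 (XTimes (XV 3) (XV 3)) ;;
  SN 10 (NHf (NV 10)).

Definition Geo (y : rexpr) (m : nexpr) : stmt :=
  (SX 3 y ;; SN 10 m ;; SX 1 (XN (NC 0)) ;; SX 2 (XN (NC 1))) ;; SFor 9 3 GeoBody.

(* A2 := K A1 for the N6 x N6 matrix K stored row by row in A3. *)
Definition MatVecInner : stmt :=
  SX 4 (XPlus (XV 4) (XTimes (XA 3 (NV 13)) (XA 1 (NV 12)))) ;; SN 13 (NPlus (NV 13) (NC 1)).
Definition MatVecRow : stmt :=
  SX 4 (XN (NC 0)) ;; SFor 12 6 MatVecInner ;; SA 2 (NV 11) (XV 4).
Definition MatVec : stmt := SN 13 (NC 0) ;; SFor 11 6 MatVecRow.

(** * Geometric sums and matrix-vector products *)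

Section Pieces.
Variables (R : realType) (B : nat -> nat -> R) (w : nat -> bool).
Local Notation ast := (@ast R).
Local Notation den := (den B w).

Definition same (p : stmt) (a a' : ast) : Prop :=
  [/\ forall k, k \notin writesN p -> nr a' k = nr a k,
      forall k, k \notin writesX p -> xr a' k = xr a k &
      forall k, k \notin writesA p -> ar a' k = ar a k].

Lemma den_same p a : same p a (den p a).
Proof.
by split=> k h; [exact: den_frameN | exact: den_frameX | exact: den_frameA].
Qed.

(** A loop rule with the frame built in: [same] covers all cells that the loop does not write, so
    invariants mention only what changes. *)
Lemma den_loop (Inv : nat -> ast -> Prop) i r p a :
  i \notin writesN p -> Inv 0%N (setn a i 0) ->
  (forall t a', (t < nr a r)%N -> nr a' i = t -> same (SFor i r p) a a' -> Inv t a' ->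
     Inv t.+1 (setn (den p a') i t.+1)) ->
  Inv (nr a r) (den (SFor i r p) a).
Proof.
move=> ip h0 hS.
suff : (fun t a' => same (SFor i r p) a a' /\ Inv t a') (nr a r) (den (SFor i r p) a) by case.
apply: (den_for (Inv := fun t a' => same (SFor i r p) a a' /\ Inv t a')) => //.
  split=> //; split=> k //=; by rewrite inE negb_or => /andP[h _]; rewrite updNE.
move=> t a' tr e [sm Iv]; split; last exact: hS.
case: sm => s1 s2 s3; split=> k /= h.
- by have := h; rewrite inE negb_or => /andP[ki kp]; rewrite updNE // den_frameN // s1.
- by rewrite den_frameX // s2.
- by rewrite den_frameA // s3.
Qed.

Lemma half_mod_step m t : (m %% 2 ^ t.+1 = m %% 2 ^ t + odd (m %/ 2 ^ t) * 2 ^ t)%N.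
Proof.
rewrite {1}(divn_eq m (2 ^ t)) {1}(divn_eq (m %/ 2 ^ t) 2) modn2 mulnDl -mulnA -expnS -addnA.
rewrite modnMDl modn_small; first by rewrite addnC.
have := ltn_pmod m (_ : 0 < 2 ^ t)%N; rewrite expn_gt0 => /(_ isT).
by rewrite expnS; case: odd; lia.
Qed.

Lemma geo_body a : let a' := den GeoBody a in
  [/\ xr a' 1 = if odd (nr a 10) then xr a 2 + xr a 3 * xr a 1 else xr a 1,
      xr a' 2 = xr a 2 + xr a 2 * xr a 3, xr a' 3 = xr a 3 * xr a 3 &
      nr a' 10 = (nr a 10)./2].
Proof.
have e : (0 < nr a 10 - ((nr a 10)./2 + (nr a 10)./2))%N = odd (nr a 10).
  by have := odd_double_half (nr a 10); rewrite -addnn; case: odd; lia.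
by rewrite /= e; case: ifP => _; split; rewrite /= /upd.
Qed.

Lemma geo_ok y m a : (evN m (nr a) < 2 ^ nr a 3)%N ->
  xr (den (Geo y m) a) 1 = \sum_(i < evN m (nr a)) evX y a ^+ i.
Proof.
set M := evN m (nr a); set v := evX y a => ML.
rewrite -[den _ a]/(den (SFor 9 3 GeoBody) (den (SX 3 y ;; SN 10 m ;; SX 1 (XN (NC 0)) ;; SX 2 (XN (NC 1))) a)).
set a0 := den _ a.
have h1 : xr a0 1 = 0 by [].
have h2 : xr a0 2 = 1 by [].
have h3 : xr a0 3 = v by [].
have h10 : nr a0 10 = M by [].
have hL : nr a0 3 = nr a 3 by [].
clearbody a0.
(* After [t] rounds X1 is the sum for the low [t] bits of [M], X2 a full block of length 2^t, X3 the
   power that shifts past this block, and N10 holds the remaining bits. *)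
pose Inv t (a' : ast) := [/\ xr a' 1 = \sum_(i < M %% 2 ^ t) v ^+ i,
  xr a' 2 = \sum_(i < 2 ^ t) v ^+ i, xr a' 3 = v ^+ (2 ^ t) & nr a' 10 = (M %/ 2 ^ t)%N].
have : Inv (nr a0 3) (den (SFor 9 3 GeoBody) a0).
  apply: den_loop => //.
    split; rewrite /= ?expn0.
    - by rewrite h1 modn1 big_ord0.
    - by rewrite h2 big_ord1 expr0.
    - by rewrite h3 expr1.
    - by rewrite /upd /= h10 divn1.
  move=> t a' _ _ _ [i1 i2 i3 i4].
  have [g1 g2 g3 g4] := geo_body a'.
  have pp : (2 ^ t.+1 = 2 ^ t + 2 ^ t)%N by rewrite expnS mul2n addnn.
  have split_sum k l : \sum_(i < k + l) v ^+ i = \sum_(i < k) v ^+ i + v ^+ k * \sum_(i < l) v ^+ i.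
    by rewrite big_split_ord /= mulr_sumr; congr (_ + _); apply: eq_bigr => i _; rewrite exprD.
  split.
  - rewrite -[LHS]/(xr (den GeoBody a') 1) g1 i1 i2 i3 i4 half_mod_step.
    by case: odd; rewrite ?mul1n ?mul0n ?addn0 // addnC split_sum.
  - by rewrite -[LHS]/(xr (den GeoBody a') 2) g2 i2 i3 pp split_sum mulrC.
  - by rewrite -[LHS]/(xr (den GeoBody a') 3) g3 i3 pp exprD.
  - by rewrite -[LHS]/(nr (den GeoBody a') 10) g4 i4 expnSr divnMA divn2.
by rewrite hL => - [-> _ _ _]; rewrite modn_small.
Qed.

Lemma matvec_ok a i : (i < nr a 6)%N ->
  ar (den MatVec a) 2 i = \sum_(b < nr a 6) ar a 3 (i * nr a 6 + b) * ar a 1 b.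
Proof.
set r := nr a 6; move: i.
rewrite -[den _ a]/(den (SFor 11 6 MatVecRow) (den (SN 13 (NC 0)) a)).
set a0 := den _ a.
have h13 : nr a0 13 = 0%N by [].
have h6 : nr a0 6 = r by [].
have h3 : ar a0 3 = ar a 3 by [].
have h1 : ar a0 1 = ar a 1 by [].
clearbody a0.
pose Inv t (a' : ast) := nr a' 13 = (t * r)%N /\
  forall i, (i < t)%N -> ar a' 2 i = \sum_(b < r) ar a 3 (i * r + b) * ar a 1 b.
have : Inv (nr a0 6) (den (SFor 11 6 MatVecRow) a0).
  apply: den_loop => // t a' _ e11 [sN sX sA] [i13 i2].
  have e6 : nr a' 6 = r by rewrite sN.
  have e3 : ar a' 3 = ar a 3 by rewrite sA.
  have e1 : ar a' 1 = ar a 1 by rewrite sA.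
  rewrite -[den _ a']/(den (SA 2 (NV 11) (XV 4)) (den (SFor 12 6 MatVecInner) (den (SX 4 (XN (NC 0))) a'))).
  set a1 := den (SX 4 _) a'.
  have f4 : xr a1 4 = 0 by [].
  have f6 : nr a1 6 = r by [].
  have f13 : nr a1 13 = (t * r)%N by [].
  have f11 : nr a1 11 = t by [].
  have f2 : ar a1 2 = ar a' 2 by [].
  have f3 : ar a1 3 = ar a 3 by [].
  have f1 : ar a1 1 = ar a 1 by [].
  clearbody a1.
  pose Inv2 k (a' : ast) := nr a' 13 = (t * r + k)%N /\ xr a' 4 = \sum_(b < k) ar a 3 (t * r + b) * ar a 1 b.
  have : Inv2 (nr a1 6) (den (SFor 12 6 MatVecInner) a1).
    apply: den_loop => //.
      by split; rewrite /= /upd /= ?f13 ?addn0 ?big_ord0.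
    move=> k a2 _ k12 [s1 s2 s3] [j13 j4].
    split; rewrite /= /upd /=; first by rewrite j13 addn1 addnS.
    by rewrite big_ord_recr /= j4 s3 // f3 s3 // f1 j13 k12.
  have := den_same (SFor 12 6 MatVecInner) a1.
  set a2 := den (SFor 12 6 MatVecInner) a1; clearbody a2 => - [s1 s2 s3] [j13 j4].
  rewrite f6 in j13 j4.
  split; first by rewrite /= /upd /= j13 mulSnr.
  move=> i; rewrite ltnS leq_eqVlt /= s1 // f11 /upd /= => /orP[/eqP ->|it].
    by rewrite eqxx j4.
  by rewrite ltn_eqF // s3 // f2 i2.
by rewrite h6 => - [_ h] i ir; exact: h.
Qed.

End Pieces.

(** * Programs for the kernel matrix, the sampling and the update *)

Definition KGram : stmt :=
  SFor 11 6 (Geo (XTimes (XA 0 (NV 11)) (XA 0 (NV 14))) (NV 0) ;; SA 1 (NV 11) (XTimes (XV 1) (XV 1))).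
Definition KNeg : stmt := SFor 11 6 (SA 2 (NV 11) (XMinus (XN (NC 0)) (XA 2 (NV 11)))).
Definition KDiag : stmt := SA 2 (NV 14) (XPlus (XA 2 (NV 14)) (XN (NC 1))).
Definition KDen : stmt :=
  SX 5 (XN (NC 0)) ;; SFor 11 6 (SX 5 (XPlus (XV 5) (XTimes (XA 2 (NV 11)) (XA 1 (NV 11))))).
Definition KUpdInner : stmt :=
  SA 3 (NV 13) (XPlus (XA 3 (NV 13)) (XOver (XTimes (XA 2 (NV 11)) (XA 2 (NV 12))) (XV 5))) ;;
  SN 13 (NPlus (NV 13) (NC 1)).
Definition KUpd : stmt := SN 13 (NC 0) ;; SFor 11 6 (SFor 12 6 KUpdInner).
(** One step of [gram_kernel] for l in N14: A1 receives column l of the Gram matrix, A2 the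
    coefficients e_l - K A1 of the direction, X5 its squared norm, and the rank-one term is added in
    place. *)
Definition KStep : stmt := KGram ;; MatVec ;; KNeg ;; KDiag ;; KDen ;; KUpd.
Definition KBuild : stmt := SFor 14 6 KStep.

Definition RBits (dst cnt : nat) : stmt :=
  SN dst (NC 0) ;;
  SFor 22 3 (SF 20 ;; SI (NV 22) (NV cnt) (SN dst (NPlus (NPlus (NV dst) (NV dst)) (NV 20))) Skp).
Definition Pow2 : stmt :=
  SN 19 (NC 1) ;; SFor 22 3 (SI (NV 22) (NV 16) (SN 19 (NPlus (NV 19) (NV 19))) Skp).
Definition Draw : stmt := RBits 16 8 ;; RBits 17 16 ;; RBits 18 16 ;; SF 21 ;; Pow2.
(** Powers come from the geometric-sum routine through y^k = 1 + (y - 1)(1 + ... + y^(k-1)), which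
    also holds at y = 1. *)
Definition UPow : stmt :=
  SFor 11 6 (Geo (XA 0 (NV 11)) (NPlus (NV 17) (NV 18)) ;;
    SA 1 (NV 11) (XPlus (XN (NC 1)) (XTimes (XMinus (XA 0 (NV 11)) (XN (NC 1))) (XV 1)))).
Definition UQuery : stmt := SQ 6 (NV 17) (NV 18).
Definition URes : stmt := SFor 11 6 (SX 6 (XMinus (XV 6) (XTimes (XA 4 (NV 11)) (XA 1 (NV 11))))).
Definition UScale : stmt :=
  SX 6 (XOver (XTimes (XV 6) (XTimes (XN (NV 19)) (XN (NV 19)))) (XTimes (XN (NC 16)) (XN (NV 6)))).
Definition UCoef : stmt := SFor 11 6 (SA 4 (NV 11) (XPlus (XA 4 (NV 11)) (XTimes (XV 6) (XA 2 (NV 11))))).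
Definition Upd : stmt := UPow ;; UQuery ;; URes ;; UScale ;; MatVec ;; UCoef.
Definition Mirror : stmt :=
  SI (NC 0) (NV 21) (SN 17 (NMinus (NMinus (NV 0) (NC 1)) (NV 17)) ;;
                     SN 18 (NMinus (NMinus (NV 0) (NC 1)) (NV 18))) Skp.
(** The machine only tests strict inequalities, so the weak ones of [accept] appear with 1 added on
    the right. *)
Definition Acc (p : stmt) : stmt :=
  let s := NPlus (NV 17) (NV 18) in
  let s1 := NPlus s (NC 1) in
  SI (NV 16) (NPlus (NV 3) (NC 1))
    (SI s (NV 19)
      (SI (NV 19) (NPlus s1 s1)
        (SI (NPlus s1 (NV 21)) (NPlus (NV 0) (NC 1)) p Skp) Skp) Skp) Skp.
Definition Step : stmt := Draw ;; Acc (Mirror ;; Upd).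

Fixpoint no_flip (p : stmt) : bool :=
  match p with
  | SF _ => false
  | SS p1 p2 | SI _ _ p1 p2 => no_flip p1 && no_flip p2
  | SFor _ _ p1 => no_flip p1
  | _ => true
  end.

(** * Correctness of the kernel, sampling and update programs *)

Section Correctness.
Variables (R : realType) (B : nat -> nat -> R) (w : nat -> bool).
Local Notation ast := (@ast R).
Local Notation den := (den B w).

Lemma den_co p a : no_flip p -> co (den p a) = co a.
Proof.
elim: p a => [r e|x e|q i e|x i j|r|p1 IH1 p2 IH2|e1 e2 p1 IH1 p2 IH2|i r p1 IH] a //=.
- by move=> /andP[h1 h2]; rewrite IH2 ?IH1.
- by move=> /andP[h1 h2]; case: ifP => _; rewrite ?IH1 ?IH2.
- by move=> h; elim: (nr a r) => //= m IHm; rewrite IH.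
Qed.

Lemma kgram_ok a i : (nr a 0 < 2 ^ nr a 3)%N -> (i < nr a 6)%N ->
  ar (den KGram a) 1 i = gramx (nr a 0) (ar a 0) i (nr a 14).
Proof.
move=> nL; move: i.
pose Inv t (a' : ast) := forall i, (i < t)%N -> ar a' 1 i = gramx (nr a 0) (ar a 0) i (nr a 14).
suff : Inv (nr a 6) (den KGram a) by [].
apply: den_loop => // t a' _ e11 [sN sX sA] IH i.
set G := Geo _ _; set S1 := SA 1 _ _.
rewrite -[ar _ 1]/(ar (den S1 (den G a')) 1).
have g1 : xr (den G a') 1 = \sum_(i < nr a 0) (ar a 0 t * ar a 0 (nr a 14)) ^+ i.
  rewrite geo_ok; first by rewrite /= e11 !sN // sA.
  by rewrite /= !sN.
have g11 : nr (den G a') 11 = t by rewrite den_frameN.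
have ga : ar (den G a') 1 = ar a' 1 by rewrite den_frameA.
rewrite /S1; move: g1 g11 ga; set a1 := den G a'; clearbody a1 => g1 g11 ga.
rewrite ltnS leq_eqVlt /= g11 /upd /= => /orP[/eqP ->|it].
  by rewrite eqxx g1.
by rewrite ltn_eqF // ga IH.
Qed.

Lemma kneg_ok a i : (i < nr a 6)%N -> ar (den KNeg a) 2 i = 0 - ar a 2 i.
Proof.
pose Inv t (a' : ast) := forall i, ar a' 2 i = if (i < t)%N then 0 - ar a 2 i else ar a 2 i.
have : Inv (nr a 6) (den KNeg a).
  apply: den_loop => // t a' _ e11 _ IH {}i.
  rewrite /= e11 /upd /= ltnS leq_eqVlt; case: eqP => [->|_] /=; last exact: IH.
  by rewrite IH ltnn.
by move=> h ir; rewrite h ir.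
Qed.

Lemma kden_ok a : xr (den KDen a) 5 = \sum_(i < nr a 6) ar a 2 i * ar a 1 i.
Proof.
rewrite -[den _ a]/(den (SFor 11 6 (SX 5 (XPlus (XV 5) (XTimes (XA 2 (NV 11)) (XA 1 (NV 11)))))) (den (SX 5 (XN (NC 0))) a)).
set a0 := den (SX 5 _) a.
pose Inv t (a' : ast) := xr a' 5 = \sum_(i < t) ar a 2 i * ar a 1 i.
have : Inv (nr a0 6) (den (SFor 11 6 (SX 5 (XPlus (XV 5) (XTimes (XA 2 (NV 11)) (XA 1 (NV 11)))))) a0).
  apply: den_loop => //; first by rewrite /Inv /= big_ord0.
  move=> t a' _ e11 [sN sX sA] IH.
  by rewrite /Inv /= /upd /= big_ord_recr /= IH !sA // e11.
by [].
Qed.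

Lemma kupd_ok a i j : (i < nr a 6)%N -> (j < nr a 6)%N ->
  ar (den KUpd a) 3 (i * nr a 6 + j)%N =
  ar a 3 (i * nr a 6 + j)%N + ar a 2 i * ar a 2 j / xr a 5.
Proof.
set r := nr a 6 => ir jr.
have r0 : (0 < r)%N by exact: leq_ltn_trans ir.
rewrite -[den _ a]/(den (SFor 11 6 (SFor 12 6 KUpdInner)) (den (SN 13 (NC 0)) a)).
set a0 := den (SN 13 _) a.
pose newv k := ar a 3 k + ar a 2 (k %/ r) * ar a 2 (k %% r) / xr a 5.
(* N13 runs through the matrix row by row, so the invariant is linear: exactly the cells below [m]
   have been updated. *)
pose arr_inv m (a' : ast) := nr a' 13 = m /\ forall k, ar a' 3 k = if (k < m)%N then newv k else ar a 3 k.
have : arr_inv (nr a0 6 * r)%N (den (SFor 11 6 (SFor 12 6 KUpdInner)) a0).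
  apply: (den_loop (Inv := fun t => arr_inv (t * r)%N)) => //.
  move=> t a' _ e11 [sN sX sA] IH.
  have e6 : nr a' 6 = r by rewrite sN.
  have : arr_inv (t * r + nr a' 6)%N (den (SFor 12 6 KUpdInner) a').
    apply: (den_loop (Inv := fun k => arr_inv (t * r + k)%N)) => //; first by rewrite addn0.
    move=> k a2 kr e12 [s1 s2 s3] [j13 j3].
    split; rewrite /= /upd /=; first by rewrite j13 addn1 addnS.
    move=> q; rewrite j13 addnS ltnS leq_eqVlt; case: eqP => [->|_] /=; last exact: j3.
    rewrite j3 ltnn s3 // sA // s1 // e11 e12 s2 // sX //.
    by rewrite /newv divnMDl // modnMDl modn_small -?e6 // divn_small ?addn0 // -e6.
  rewrite e6 -mulSnr => - [j13 j3]; split; rewrite /= /upd /=; first exact: j13.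
  exact: j3.
move=> [_ ->]; rewrite -[nr a0 6]/r.
have -> : (i * r + j < r * r)%N.
  by apply: leq_trans (_ : i.+1 * r <= _)%N; rewrite ?mulSnr ?ltn_add2l // -mulSnr leq_mul2r ir orbT.
by rewrite /newv divnMDl // modnMDl modn_small // divn_small // addn0.
Qed.

Lemma kstep_ok a (K : nat -> nat -> R) (r l n : nat) (x : nat -> R) :
  nr a 6 = r -> nr a 14 = l -> nr a 0 = n -> ar a 0 = x ->
  (n < 2 ^ nr a 3)%N -> (l < r)%N ->
  (forall i j, (i < r)%N -> (j < r)%N -> ar a 3 (i * r + j)%N = K i j) ->
  forall i j, (i < r)%N -> (j < r)%N -> ar (den KStep a) 3 (i * r + j)%N =
    K i j + gram_dir r (gramx n x) K l i * gram_dir r (gramx n x) K l j / gram_den r (gramx n x) K l.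
Proof.
move=> E6 E14 E0 EA; set G := gramx n x => nL lr hK.
change (den KStep a) with (den KUpd (den KDen (den KDiag (den KNeg (den MatVec (den KGram a)))))).
have [s1 _ s3] := den_same B w KGram a.
have h1 i : (i < r)%N -> ar (den KGram a) 1 i = G i l.
  by move=> ir; rewrite kgram_ok ?E0 ?E6 // EA E14.
have n6 : nr (den KGram a) 6 = r by rewrite s1.
have n14 : nr (den KGram a) 14 = l by rewrite s1.
have a3 : ar (den KGram a) 3 = ar a 3 by rewrite s3.
set a1 := den KGram a in h1 n6 n14 a3 *; clearbody a1 => {s1 s3}.
have [s1 _ s3] := den_same B w MatVec a1.
have h2 i := @matvec_ok R B w a1 i.
rewrite n6 in h2.
have m6 : nr (den MatVec a1) 6 = r by rewrite s1.
have m14 : nr (den MatVec a1) 14 = l by rewrite s1.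
have m3 : ar (den MatVec a1) 3 = ar a 3 by rewrite s3.
have m1 : ar (den MatVec a1) 1 = ar a1 1 by rewrite s3.
set a2 := den MatVec a1 in h2 m6 m14 m3 m1 *; clearbody a2 => {s1 s3}.
have [s1 _ s3] := den_same B w KNeg a2.
have h3 i := @kneg_ok a2 i.
rewrite m6 in h3.
have p6 : nr (den KNeg a2) 6 = r by rewrite s1.
have p14 : nr (den KNeg a2) 14 = l by rewrite s1.
have p3 : ar (den KNeg a2) 3 = ar a 3 by rewrite s3.
have p1 : ar (den KNeg a2) 1 = ar a1 1 by rewrite s3.
set a4 := den KNeg a2 in h3 p6 p14 p3 p1 *; clearbody a4 => {s1 s3}.
pose dir i := gram_dir r G K l i.
have h4 i : (i < r)%N -> ar (den KDiag a4) 2 i = dir i.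
  move=> ir; rewrite /= /upd /= p14 /dir /gram_dir.
  have -> : \sum_(b < r) K i b * G b l = \sum_(b < r) ar a1 3 (i * r + b) * ar a1 1 b.
    by apply: eq_bigr => b _; rewrite a3 hK // h1.
  case: eqP => [e|_] /=; last by rewrite h3 // h2.
  by rewrite -e h3 // h2 // sub0r addrC.
have q6 : nr (den KDiag a4) 6 = r by rewrite den_frameN.
have q3 : ar (den KDiag a4) 3 = ar a 3 by rewrite den_frameA.
have q1 : ar (den KDiag a4) 1 = ar a1 1 by rewrite den_frameA.
set a5 := den KDiag a4 in h4 q6 q3 q1 *; clearbody a5.
have [s1 _ s3] := den_same B w KDen a5.
have h5 : xr (den KDen a5) 5 = gram_den r G K l.
  rewrite kden_ok q6; apply: eq_bigr => i _; rewrite h4 // q1 h1 //.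
have t6 : nr (den KDen a5) 6 = r by rewrite s1.
have t3 : ar (den KDen a5) 3 = ar a 3 by rewrite s3.
have t2 : ar (den KDen a5) 2 = ar a5 2 by rewrite s3.
set a6 := den KDen a5 in h5 t6 t3 t2 *; clearbody a6.
move=> i j ir jr; have := @kupd_ok a6 i j; rewrite t6 => /(_ ir jr) ->.
by rewrite t3 hK // t2 !h4 // h5.
Qed.

Lemma kbuild_ok a : (nr a 0 < 2 ^ nr a 3)%N -> (forall k, ar a 3 k = 0) ->
  forall i j, (i < nr a 6)%N -> (j < nr a 6)%N -> ar (den KBuild a) 3 (i * nr a 6 + j)%N =
    gram_kernel (nr a 6) (gramx (nr a 0) (ar a 0)) (nr a 6) i j.
Proof.
move=> nL z.
pose Inv t (a' : ast) := forall i j, (i < nr a 6)%N -> (j < nr a 6)%N -> ar a' 3 (i * nr a 6 + j)%N =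
    gram_kernel (nr a 6) (gramx (nr a 0) (ar a 0)) t i j.
suff : Inv (nr a 6) (den KBuild a) by [].
apply: den_loop => //; first by move=> i j _ _; rewrite /= z.
move=> t a' tr e14 [sN sX sA] IH i j ir jr.
have e6 : nr a' 6 = nr a 6 by rewrite sN.
have e0 : nr a' 0 = nr a 0 by rewrite sN.
have e3 : nr a' 3 = nr a 3 by rewrite sN.
have ea : ar a' 0 = ar a 0 by rewrite sA.
change (ar (setn (den KStep a') 14 t.+1) 3) with (ar (den KStep a') 3).
by apply: (@kstep_ok a' _ (nr a 6) t (nr a 0) (ar a 0)) => //; rewrite e3.
Qed.

Lemma rbits_ok dst cnt a : dst \notin [:: 3; 20; 22; 31]%N -> cnt \notin [:: dst; 20; 22; 31]%N ->
  let a' := den (RBits dst cnt) a in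
  nr a' dst = rbits (nr a cnt) (fun k => w (co a + k)%N) (nr a 3) /\ co a' = (co a + nr a 3)%N.
Proof.
rewrite !inE !negb_or => /and4P[d3 d20 d22 d31] /and4P[cd c20 c22 c31].
set body := SF 20 ;; SI (NV 22) (NV cnt) (SN dst (NPlus (NPlus (NV dst) (NV dst)) (NV 20))) Skp.
rewrite /= -/(den (SFor 22 3 body) (den (SN dst (NC 0)) a)).
set a0 := den (SN dst _) a.
have l3 : nr a0 3 = nr a 3 by rewrite /= updNE // eq_sym.
have lc : nr a0 cnt = nr a cnt by rewrite /= updNE.
pose Inv t (a' : ast) := [/\ nr a' dst = rbits (nr a cnt) (fun k => w (co a + k)%N) t,
  nr a' cnt = nr a cnt & co a' = (co a + t)%N].
suff : Inv (nr a0 3) (den (SFor 22 3 body) a0) by rewrite l3 => - [].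
apply: den_loop.
- by rewrite !inE !negb_or /= eq_sym d22.
- split; [by rewrite /= updNE // updE|by rewrite /= !updNE|by rewrite /= addn0].
move=> t a' _ e22 _ [i1 i2 i3].
have [b1 b2 b3] : [/\ nr (den body a') dst = if (t < nr a' cnt)%N then (nr a' dst + nr a' dst + w (co a'))%N else nr a' dst,
    nr (den body a') cnt = nr a' cnt & co (den body a') = (co a').+1].
  rewrite /=.
  have -> : upd (nr a') 20 (w (co a') : nat) 22 = t by rewrite updNE.
  have -> : upd (nr a') 20 (w (co a') : nat) cnt = nr a' cnt by rewrite updNE.
  by case: ifP => _ /=; split=> //; rewrite ?updE ?updNE // ?updE ?updNE.
split.
- by rewrite /setn [LHS]updNE // b1 i2 i1 i3.
- by rewrite /setn [LHS]updNE // b2.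
- by rewrite /setn [LHS]b3 i3 addnS.
Qed.

(** The loop has only as many rounds as N3 says, whence the minimum; scales above that are rejected
    anyway. *)
Lemma pow2_ok a : nr (den Pow2 a) 19 = (2 ^ minn (nr a 16) (nr a 3))%N.
Proof.
pose Inv t (a' : ast) := nr a' 19 = (2 ^ minn (nr a 16) t)%N.
set body := SI (NV 22) (NV 16) (SN 19 (NPlus (NV 19) (NV 19))) Skp.
rewrite -[den _ a]/(den (SFor 22 3 body) (den (SN 19 (NC 1)) a)).
set a0 := den (SN 19 _) a.
suff : Inv (nr a0 3) (den (SFor 22 3 body) a0) by [].
apply: den_loop => //.
move=> t a' _ e22 [sN sX sA] IH; rewrite /Inv /body /= e22 sN //.
rewrite -[nr a0 16]/(nr a 16); case: ifP => tm; rewrite /= /upd /= IH.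
  by rewrite (minn_idPr (ltnW tm)) (minn_idPr tm) expnS mul2n addnn.
by have -> : minn (nr a 16) t.+1 = minn (nr a 16) t by lia.
Qed.

Lemma draw_ok a : let a' := den Draw a in
  let g k := w (co a + k)%N in let L := nr a 3 in let m := draw_scale (nr a 8) L g in
  [/\ [/\ nr a' 16 = m, nr a' 17 = draw_row m L g & nr a' 18 = draw_col m L g],
      nr a' 21 = draw_side L g, nr a' 19 = (2 ^ minn m L)%N & co a' = (co a + sgd_bits L)%N].
Proof.
rewrite -[den Draw a]/(den Pow2 (den (SF 21) (den (RBits 18 16) (den (RBits 17 16) (den (RBits 16 8) a))))).
move=> a' g L m; rewrite {}/a'.
have [] := @rbits_ok 16%N 8%N a isT isT; have [s1 _ _] := den_same B w (RBits 16 8) a.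
have l3 : nr (den (RBits 16 8) a) 3 = L by rewrite s1.
set a1 := den (RBits 16 8) a in l3 *; clearbody a1 => e16 c1 {s1}.
have [] := @rbits_ok 17%N 16%N a1 isT isT; have [s1 _ _] := den_same B w (RBits 17 16) a1.
have f3 : nr (den (RBits 17 16) a1) 3 = L by rewrite s1.
have f16 : nr (den (RBits 17 16) a1) 16 = m by rewrite s1.
set a2 := den (RBits 17 16) a1 in f3 f16 *; clearbody a2 => e17 c2 {s1}.
have [] := @rbits_ok 18%N 16%N a2 isT isT; have [s1 _ _] := den_same B w (RBits 18 16) a2.
have h3 : nr (den (RBits 18 16) a2) 3 = L by rewrite s1.
have h16 : nr (den (RBits 18 16) a2) 16 = m by rewrite s1.
have h17 : nr (den (RBits 18 16) a2) 17 = nr a2 17 by rewrite s1.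
set a3 := den (RBits 18 16) a2 in h3 h16 h17 *; clearbody a3 => e18 c3 {s1}.
rewrite -/L in c1; rewrite l3 in c2 e17; rewrite f3 in c3 e18.
rewrite e16 in e17; rewrite f16 in e18.
have row : nr a2 17 = draw_row m L g.
  by rewrite e17; apply: eq_rbits => k _; rewrite c1 -addnA.
have col : nr a3 18 = draw_col m L g.
  by rewrite e18; apply: eq_rbits => k _; rewrite c2 c1 -!addnA.
set a4 := den (SF 21) a3.
have k21 : nr a4 21 = draw_side L g.
  by rewrite /a4 /= /upd /= c3 c2 c1 /draw_side /g; congr (nat_of_bool (w _)); lia.
have k16 : nr a4 16 = m by [].
have k17 : nr a4 17 = draw_row m L g by rewrite -row -h17.
have k18 : nr a4 18 = draw_col m L g by rewrite -col.
have k3 : nr a4 3 = L by [].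
have kc : co a4 = (co a + sgd_bits L)%N by rewrite /a4 /= c3 c2 c1 /sgd_bits; lia.
clearbody a4; have [s1 _ _] := den_same B w Pow2 a4.
by split; first split; rewrite ?pow2_ok ?den_co ?s1 ?k16 ?k3.
Qed.

Lemma upow_ok a i : (nr a 17 + nr a 18 < 2 ^ nr a 3)%N -> (i < nr a 6)%N ->
  ar (den UPow a) 1 i = ar a 0 i ^+ (nr a 17 + nr a 18).
Proof.
move=> nL; move: i.
pose Inv t (a' : ast) := forall i, (i < t)%N -> ar a' 1 i = ar a 0 i ^+ (nr a 17 + nr a 18).
suff : Inv (nr a 6) (den UPow a) by [].
apply: den_loop => // t a' _ e11 [sN sX sA] IH i.
set G := Geo _ _; set S1 := SA 1 _ _.
rewrite -[ar _ 1]/(ar (den S1 (den G a')) 1).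
have g1 : xr (den G a') 1 = \sum_(i < nr a 17 + nr a 18) ar a 0 t ^+ i.
  rewrite geo_ok; first by rewrite /= e11 !sN // sA.
  by rewrite /= !sN.
have g11 : nr (den G a') 11 = t by rewrite den_frameN.
have ga : ar (den G a') 1 = ar a' 1 by rewrite den_frameA.
have g0 : ar (den G a') 0 = ar a 0 by rewrite den_frameA // sA.
rewrite /S1; move: g1 g11 ga g0; set a1 := den G a'; clearbody a1 => g1 g11 ga g0.
rewrite ltnS leq_eqVlt /= g11 /upd /= => /orP[/eqP ->|it].
  by rewrite eqxx g1 g0 -subrX1 addrC subrK.
by rewrite ltn_eqF // ga IH.
Qed.

Lemma ures_ok a : xr (den URes a) 6 = xr a 6 - \sum_(i < nr a 6) ar a 4 i * ar a 1 i.
Proof.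
pose Inv t (a' : ast) := xr a' 6 = xr a 6 - \sum_(i < t) ar a 4 i * ar a 1 i.
suff : Inv (nr a 6) (den URes a) by [].
apply: den_loop => //; first by rewrite /Inv /= big_ord0 subr0.
move=> t a' _ e11 [sN sX sA] IH.
by rewrite /Inv /= /upd /= big_ord_recr /= IH !sA // e11 opprD addrA.
Qed.

Lemma ucoef_ok a i : (i < nr a 6)%N -> ar (den UCoef a) 4 i = ar a 4 i + xr a 6 * ar a 2 i.
Proof.
pose Inv t (a' : ast) := forall i, ar a' 4 i = if (i < t)%N then ar a 4 i + xr a 6 * ar a 2 i else ar a 4 i.
have : Inv (nr a 6) (den UCoef a).
  apply: den_loop => // t a' _ e11 [sN sX sA] IH {}i.
  rewrite /= e11 /upd /= ltnS leq_eqVlt; case: eqP => [->|_] /=; last exact: IH.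
  by rewrite IH ltnn sA // sX.
by move=> h ir; rewrite h ir.
Qed.

Lemma upd_ok a (x : nat -> R) m :
  let r := nr a 6 in let n := nr a 0 in
  (nr a 17 + nr a 18 < 2 ^ nr a 3)%N -> nr a 19 = (2 ^ m)%N ->
  (forall i, (i < r)%N -> ar a 0 i = x i) ->
  (forall i j, (i < r)%N -> (j < r)%N -> ar a 3 (i * r + j)%N = gram_kernel r (gramx n x) r i j) ->
  forall i, (i < r)%N -> ar (den Upd a) 4 i = sgd_update n r x B (ar a 4) m (nr a 17) (nr a 18) i.
Proof.
move=> r n kL pw hx hK.
set k := (nr a 17 + nr a 18)%N in kL *.
rewrite -[den Upd a]/(den UCoef (den MatVec (den UScale (den URes (den UQuery (den UPow a)))))).
have h1 i : (i < r)%N -> ar (den UPow a) 1 i = x i ^+ k.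
  by move=> ir; rewrite upow_ok // hx.
have [s1 _ s3] := den_same B w UPow a.
have n6 : nr (den UPow a) 6 = r by rewrite s1.
have n17 : nr (den UPow a) 17 = nr a 17 by rewrite s1.
have n18 : nr (den UPow a) 18 = nr a 18 by rewrite s1.
have n19 : nr (den UPow a) 19 = (2 ^ m)%N by rewrite s1.
have a3 : ar (den UPow a) 3 = ar a 3 by rewrite s3.
have a4 : ar (den UPow a) 4 = ar a 4 by rewrite s3.
set b1 := den UPow a in h1 n6 n17 n18 n19 a3 a4 *; clearbody b1 => {s1 s3}.
have q : xr (den UQuery b1) 6 = B (nr a 17) (nr a 18) by rewrite /= updE n17 n18.
have q1 : ar (den UQuery b1) 1 = ar b1 1 by [].
have q3 : ar (den UQuery b1) 3 = ar a 3 by [].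
have q4 : ar (den UQuery b1) 4 = ar a 4 by [].
have q6 : nr (den UQuery b1) 6 = r by [].
have q19 : nr (den UQuery b1) 19 = (2 ^ m)%N by [].
set b2 := den UQuery b1 in q q1 q3 q4 q6 q19 *; clearbody b2.
have u6 : xr (den URes b2) 6 = B (nr a 17) (nr a 18) - expsum r x (ar a 4) k.
  rewrite ures_ok q q6; congr (_ - _); apply: eq_bigr => i _.
  by rewrite q4 q1 h1.
have [s1 _ s3] := den_same B w URes b2.
have v6 : nr (den URes b2) 6 = r by rewrite s1.
have v19 : nr (den URes b2) 19 = (2 ^ m)%N by rewrite s1.
have v1 : ar (den URes b2) 1 = ar b1 1 by rewrite s3.
have v3 : ar (den URes b2) 3 = ar a 3 by rewrite s3.
have v4 : ar (den URes b2) 4 = ar a 4 by rewrite s3.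
set b3 := den URes b2 in u6 v6 v19 v1 v3 v4 *; clearbody b3 => {s1 s3}.
pose rho := (B (nr a 17) (nr a 18) - expsum r x (ar a 4) k) * ((2 ^ m)%:R * (2 ^ m)%:R) / (16 * r%:R).
have w6 : xr (den UScale b3) 6 = rho by rewrite /= updE u6 v19 v6.
have x6 : nr (den UScale b3) 6 = r by [].
have x1 : ar (den UScale b3) 1 = ar b1 1 by [].
have x3 : ar (den UScale b3) 3 = ar a 3 by [].
have x4 : ar (den UScale b3) 4 = ar a 4 by [].
set b4 := den UScale b3 in w6 x6 x1 x3 x4 *; clearbody b4.
have h2 i := @matvec_ok R B w b4 i.
rewrite x6 in h2.
have [s1 s2 s3] := den_same B w MatVec b4.
have y6 : nr (den MatVec b4) 6 = r by rewrite s1.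
have z6 : xr (den MatVec b4) 6 = rho by rewrite s2.
have y4 : ar (den MatVec b4) 4 = ar a 4 by rewrite s3.
set b5 := den MatVec b4 in h2 y6 z6 y4 *; clearbody b5 => {s1 s2 s3} i ir.
rewrite ucoef_ok ?y6 // y4 z6 h2 // /sgd_update -/k -/rho; congr (_ + _ * _).
by apply: eq_bigr => b _; rewrite x3 x1 hK // h1.
Qed.

End Correctness.

(** * Descent loop, node table and iteration count *)

Definition Sgd : stmt := SFor 15 7 Step.

Definition NodeBody : stmt :=
  SX 8 (XMinus (XN (NC 1)) (XTimes (XV 7) (XMinus (XN (NC 1))
    (XOver (XN (NPlus (NV 12) (NC 1))) (XTimes (XN (NC 5)) (XN (NV 4))))))) ;;
  SA 0 (NV 13) (XV 8) ;;
  SA 0 (NPlus (NV 13) (NC 1)) (XMinus (XN (NC 0)) (XV 8)) ;;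
  SA 0 (NPlus (NV 13) (NC 2)) (XOver (XN (NC 1)) (XV 8)) ;;
  SA 0 (NPlus (NV 13) (NC 3)) (XMinus (XN (NC 0)) (XOver (XN (NC 1)) (XV 8))) ;;
  SN 13 (NPlus (NV 13) (NC 4)).
Definition NodeRow : stmt :=
  SFor 12 4 NodeBody ;; SX 7 (XTimes (XV 7) (XOver (XN (NC 4)) (XN (NC 5)))).
Definition Nodes : stmt := (SN 13 (NC 0) ;; SX 7 (XN (NC 1))) ;; SFor 11 5 NodeRow.

(** The product d * r * L * 64 by repeated addition. Since 2^Lam <= 2 L, the number 64 r L is at
    least the inverse of [sgd_rate], so that many iterations halve the contribution of the squared
    initial error. *)
Definition Tot : stmt :=
  SN 7 (NC 0) ;; SFor 11 4 (SFor 12 6 (SFor 14 3 (SN 7 (NPlus (NV 7) (NC 64))))).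

Section Correctness2.
Variables (R : realType) (B : nat -> nat -> R) (w : nat -> bool).
Local Notation ast := (@ast R).
Local Notation den := (den B w).

Lemma acc_ok p a : den (Acc p) a =
  if [&& (nr a 16 < nr a 3 + 1)%N, (nr a 17 + nr a 18 < nr a 19)%N,
         (nr a 19 < nr a 17 + nr a 18 + 1 + (nr a 17 + nr a 18 + 1))%N &
         (nr a 17 + nr a 18 + 1 + nr a 21 < nr a 0 + 1)%N]
  then den p a else den Skp a.
Proof. by rewrite /=; do 4?case: ifP => _. Qed.

Lemma mirror_ok a (b : bool) : nr a 21 = b ->
  nr (den Mirror a) 17 = mirror (nr a 0) b (nr a 17) /\ nr (den Mirror a) 18 = mirror (nr a 0) b (nr a 18).
Proof. by rewrite /= => ->; case: b. Qed.

Lemma step_ok a (r n L Lam : nat) (x : nat -> R) :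
  nr a 6 = r -> nr a 0 = n -> nr a 3 = L -> nr a 8 = Lam -> (0 < n)%N -> (n + n <= 2 ^ L)%N ->
  (forall i, (i < r)%N -> ar a 0 i = x i) ->
  (forall i j, (i < r)%N -> (j < r)%N -> ar a 3 (i * r + j)%N = gram_kernel r (gramx n x) r i j) ->
  co (den Step a) = (co a + sgd_bits L)%N /\
  forall i, (i < r)%N -> ar (den Step a) 4 i = sgd_step n r L Lam x B (ar a 4) (fun k => w (co a + k)%N) i.
Proof.
move=> E6 E0 E3 E8 n0 nL hx hK.
change (den Step a) with (den (Acc (Mirror ;; Upd)) (den Draw a)).
have := draw_ok B w a; rewrite E3 E8 => - [[]]; set g := fun k => w (co a + k)%N.
have [s1 _ s3] := den_same B w Draw a.
have f6 : nr (den Draw a) 6 = r by rewrite s1.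
have f0 : nr (den Draw a) 0 = n by rewrite s1.
have f3 : nr (den Draw a) 3 = L by rewrite s1.
have a0 : ar (den Draw a) 0 = ar a 0 by rewrite s3.
have a3 : ar (den Draw a) 3 = ar a 3 by rewrite s3.
have a4 : ar (den Draw a) 4 = ar a 4 by rewrite s3.
set a1 := den Draw a in f6 f0 f3 a0 a3 a4 *; clearbody a1 => {s1 s3} d16 d17 d18 d21 d19 dc.
have flip_free : no_flip (Acc (Mirror ;; Upd)) by [].
split; first by rewrite den_co.
move=> i ir; rewrite acc_ok /sgd_step /sampled d16 d17 d18 d19 d21 f3 f0.
set m := draw_scale Lam L g; set ii := draw_row m L g; set jj := draw_col m L g; set sd := draw_side L g.
have -> : [&& (m < L + 1)%N, (ii + jj < 2 ^ minn m L)%N,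
         (2 ^ minn m L < ii + jj + 1 + (ii + jj + 1))%N & (ii + jj + 1 + sd < n + 1)%N] = accept n L m ii jj sd.
  rewrite /accept addn1 ltnS; have [mL|Lm] := boolP (m <= L)%N => //=.
  rewrite (minn_idPl mL); congr [&& _, _ & _]; lia.
case: ifP => [acc|_]; last by rewrite /= a4.
have /and4P[mL c1 c2 c3] := acc.
change (den (Mirror ;; Upd) a1) with (den Upd (den Mirror a1)).
have [m17 m18] := mirror_ok d21; rewrite f0 d17 d18 -/m -/ii -/jj -/sd in m17 m18.
have [s1 _ s3] := den_same B w Mirror a1.
have g6 : nr (den Mirror a1) 6 = r by rewrite s1.
have g0 : nr (den Mirror a1) 0 = n by rewrite s1.
have g3 : nr (den Mirror a1) 3 = L by rewrite s1.
have g19 : nr (den Mirror a1) 19 = (2 ^ m)%N by rewrite s1 // d19 (minn_idPl mL).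
have b0 : ar (den Mirror a1) 0 = ar a 0 by rewrite s3.
have b3 : ar (den Mirror a1) 3 = ar a 3 by rewrite s3.
have b4 : ar (den Mirror a1) 4 = ar a 4 by rewrite s3.
set a2 := den Mirror a1 in m17 m18 g6 g0 g3 g19 b0 b3 b4 *; clearbody a2.
have := @upd_ok R B w a2 x m; rewrite g6 g0 g3 m17 m18 b0 b3 b4; apply=> //.
rewrite /mirror; case: (sd) c3 => c3; lia.
Qed.

Lemma eq_sgd_step n r L Lam (x c c' : nat -> R) g i : (i < r)%N ->
  (forall j, (j < r)%N -> c j = c' j) ->
  sgd_step n r L Lam x B c g i = sgd_step n r L Lam x B c' g i.
Proof.
move=> ir e; rewrite /sgd_step /sampled; case: ifP => _; last exact: e.
rewrite /sgd_update e //; congr (_ + _ * _ / _ * _); congr (_ - _).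
by apply: eq_bigr => j _; rewrite e.
Qed.

Lemma sgd_ok a (r n L Lam : nat) (x : nat -> R) :
  nr a 6 = r -> nr a 0 = n -> nr a 3 = L -> nr a 8 = Lam -> (0 < n)%N -> (n + n <= 2 ^ L)%N ->
  (forall i, (i < r)%N -> ar a 0 i = x i) ->
  (forall i j, (i < r)%N -> (j < r)%N -> ar a 3 (i * r + j)%N = gram_kernel r (gramx n x) r i j) ->
  co a = 0%N -> (forall i, ar a 4 i = 0) ->
  forall i, (i < r)%N -> ar (den Sgd a) 4 i = sgd_run n r L Lam x B (nr a 7) w i.
Proof.
move=> E6 E0 E3 E8 n0 nL hx hK c0 z.
pose Inv t (a' : ast) := co a' = (t * sgd_bits L)%N /\
  forall i, (i < r)%N -> ar a' 4 i = sgd_run n r L Lam x B t w i.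
suff : Inv (nr a 7) (den Sgd a) by case.
apply: den_loop => //.
  by split=> [|i _]; [exact: c0|exact: z].
move=> t a' _ _ [sN sX sA] [ic i4].
have e6 : nr a' 6 = r by rewrite sN.
have e0 : nr a' 0 = n by rewrite sN.
have e3 : nr a' 3 = L by rewrite sN.
have e8 : nr a' 8 = Lam by rewrite sN.
have x0 i : (i < r)%N -> ar a' 0 i = x i by rewrite sA //; exact: hx.
have k0 i j : (i < r)%N -> (j < r)%N -> ar a' 3 (i * r + j)%N = gram_kernel r (gramx n x) r i j.
  by rewrite sA //; exact: hK.
have [hc h4] := step_ok e6 e0 e3 e8 n0 nL x0 k0.
split.
  change (co (den Step a') = (t.+1 * sgd_bits L)%N).
  by rewrite hc ic mulSnr.
move=> i ir; change (ar (den Step a') 4 i = sgd_run n r L Lam x B t.+1 w i).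
by rewrite h4 // ic /=; apply: eq_sgd_step.
Qed.

Lemma node_body a d m j t : nr a 4 = d -> (t < d)%N -> m = (j * d + t)%N -> nr a 12 = t ->
  xr a 7 = (4 / 5) ^+ j -> nr a 13 = (4 * m)%N ->
  (forall k, (k < 4 * m)%N -> ar a 0 k = node R d k) ->
  nr (den NodeBody a) 13 = (4 * m.+1)%N /\
  forall k, (k < 4 * m.+1)%N -> ar (den NodeBody a) 0 k = node R d k.
Proof.
move=> e4 td em e12 e7 e13 h.
have bE : 1%:R - xr a 7 * (1%:R - (nr a 12 + 1)%:R / (5%:R * (nr a 4)%:R)) = base_node R d m.
  have d0 : (0 < d)%N by exact: leq_ltn_trans td.
  by rewrite /base_node em divnMDl // divn_small // addn0 modnMDl modn_small // e12 e7 e4.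
split; first by rewrite /= /upd /= e13; lia.
move=> k kl.
rewrite /= /upd /= bE e13.
have [km|mk] := ltnP k (4 * m).
  by rewrite !ifF ?h //; apply/negbTE; lia.
have [e el ->] : exists2 e, (e < 4)%N & k = (4 * m + e)%N by exists (k - 4 * m)%N; lia.
have E0 v : (4 * m + v == 4 * m)%N = (v == 0)%N by lia.
by rewrite nodeE // !eqn_add2l E0; case: e el => [|[|[|[|e]]]].
Qed.

Lemma nodes_ok a : (0 < nr a 4)%N -> let d := nr a 4 in
  nr (den Nodes a) 13 = (4 * (d * nr a 5))%N /\
  forall k, (k < 4 * (d * nr a 5))%N -> ar (den Nodes a) 0 k = node R d k.
Proof.
move=> d0 d.
change (den Nodes a) with (den (SFor 11 5 NodeRow) (den (SN 13 (NC 0) ;; SX 7 (XN (NC 1))) a)).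
set a0 := den (SN 13 _ ;; _) a.
have h13 : nr a0 13 = 0%N by [].
have h7 : xr a0 7 = 1 by [].
have h4 : nr a0 4 = d by [].
have h5 : nr a0 5 = nr a 5 by [].
clearbody a0.
pose good m (a' : ast) := nr a' 13 = (4 * m)%N /\ forall k, (k < 4 * m)%N -> ar a' 0 k = node R d k.
have : (fun j a' => xr a' 7 = (4 / 5) ^+ j /\ good (j * d)%N a') (nr a0 5) (den (SFor 11 5 NodeRow) a0).
  apply: (den_loop (Inv := fun j a' => xr a' 7 = (4 / 5) ^+ j /\ good (j * d)%N a')) => //.
  move=> j a' _ _ [sN sX sA] [i7 gd].
  have e4 : nr a' 4 = d by rewrite sN.
  have [] : xr (den (SFor 12 4 NodeBody) a') 7 = (4 / 5) ^+ j /\ good (j * d + nr a' 4)%N (den (SFor 12 4 NodeBody) a').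
    split; first by rewrite den_frameX.
    apply: (den_loop (Inv := fun t => good (j * d + t)%N)) => //; first by rewrite addn0.
    move=> t a2 td e12 [s1 s2 s3] [g13 g0].
    have f4 : nr a2 4 = d by rewrite s1.
    have f7 : xr a2 7 = (4 / 5) ^+ j by rewrite s2.
    rewrite e4 in td.
    have [q1 q2] := node_body f4 td erefl e12 f7 g13 g0.
    by split; rewrite addnS; [exact: q1|exact: q2].
  rewrite e4 -mulSnr.
  change (den NodeRow a') with (den (SX 7 (XTimes (XV 7) (XOver (XN (NC 4)) (XN (NC 5))))) (den (SFor 12 4 NodeBody) a')).
  set a2 := den (SFor 12 4 NodeBody) a'; clearbody a2 => k7 gd2.
  by split; [rewrite /= updE k7 exprSr|exact: gd2].
by rewrite h5 mulnC => - [_].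
Qed.

Lemma add_loop i r p a c : 7%N != i -> i \notin writesN p ->
  (forall a', same (SFor i r p) a a' -> nr (den p a') 7 = (nr a' 7 + c)%N) ->
  nr (den (SFor i r p) a) 7 = (nr a 7 + nr a r * c)%N.
Proof.
move=> i7 iw h.
apply: (den_loop (Inv := fun t a' => nr a' 7 = (nr a 7 + t * c)%N)) => //.
  by rewrite /= updNE // addn0.
by move=> t a' _ _ sm IH; rewrite /= updNE // h // IH mulSnr addnA.
Qed.

Lemma tot_ok a : nr (den Tot a) 7 = (nr a 4 * (nr a 6 * (nr a 3 * 64)))%N.
Proof.
change (den Tot a) with (den (SFor 11 4 (SFor 12 6 (SFor 14 3 (SN 7 (NPlus (NV 7) (NC 64)))))) (den (SN 7 (NC 0)) a)).
set a0 := den (SN 7 _) a.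
rewrite (add_loop (c := (nr a 6 * (nr a 3 * 64))%N)) // => a1 [s1 _ _].
rewrite (add_loop (c := (nr a 3 * 64)%N)) // => [|a2 [t1 _ _]]; first by rewrite (s1 6%N).
by rewrite (add_loop (c := 64%N)) // (t1 3%N) // (s1 3%N).
Qed.

End Correctness2.

(** * Initialisation and assembly of the algorithm *)

Definition Half (c : nat) : stmt := SN 24 (NHf (NV 24)) ;; SN c (NPlus (NV c) (NC 1)).
(** N24 is halved until it equals N26, which is never written and stays 0; the rounds count the bit
    length. Starting N3 at 1 gives 2n <= 2^N3, which leaves room for exponents i+j. *)
Definition Init1 : stmt := SN 24 (NV 0) ;; SN 3 (NC 1).
Definition Init2 : stmt := SN 24 (NV 3) ;; SN 8 (NC 0).
(** The loop finds the least d >= 1 with (5/6)^d <= eps / 1000 by repeated multiplication instead of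
    a logarithm. The 1000 leaves room for the factor 464 of (5/6)^d |H|_F in the error analysis. *)
Definition Init3 : stmt :=
  SN 4 (NC 1) ;; SX 9 (XOver (XN (NC 5)) (XN (NC 6))) ;; SX 10 (XOver (XV 0) (XN (NC 1000))).
Definition Shrink : stmt := SX 9 (XTimes (XV 9) (XOver (XN (NC 5)) (XN (NC 6)))) ;; SN 4 (NPlus (NV 4) (NC 1)).
(** Because (4/5)^4 <= 1/2, the last of these 4 L + 13 shells has index J = 4 L + 12 and satisfies 8
    n (4/5)^J <= 1. *)
Definition Init4 : stmt :=
  SN 5 (NPlus (NPlus (NPlus (NV 3) (NV 3)) (NPlus (NV 3) (NV 3))) (NC 13)).
Definition Setup : stmt := Nodes ;; SN 6 (NV 13).
Definition Main : stmt := KBuild ;; Sgd ;; SN 0 (NV 6).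

Definition init_cmd : cmd :=
  Seq (comp Init1) (Seq (While (NLt 26 24) (comp (Half 3)))
  (Seq (comp Init2) (Seq (While (NLt 26 24) (comp (Half 8)))
  (Seq (comp Init3) (Seq (While (RLt 10 9) (comp Shrink)) (comp Init4)))))).

Definition alg_cmd : cmd := Seq init_cmd (Seq (comp Setup) (Seq (comp Tot) (comp Main))).

Definition power_entry : rexpr :=
  XPlus (XN (NC 1)) (XTimes (XMinus (XA 0 (NV 2)) (XN (NC 1))) (XV 1)).
Definition EntryU : stmt := Geo (XA 0 (NV 2)) (NV 1) ;; SX 0 (XTimes (XA 4 (NV 2)) power_entry).
Definition EntryV : stmt := Geo (XA 0 (NV 2)) (NV 1) ;; SX 0 power_entry.

Definition bitlen (n : nat) : nat := if n is 0 then 0 else (trunc_log 2 n).+1.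

Lemma bitlen_gt n : (n < 2 ^ bitlen n)%N.
Proof. by case: n => // n; rewrite /bitlen trunc_log_ltn. Qed.

Lemma bitlen_le n m : (m < bitlen n)%N -> (2 ^ m <= n)%N.
Proof.
case: n => // n; rewrite /bitlen ltnS => h.
by apply: leq_trans (trunc_logP (isT : 1 < 2)%N (isT : 0 < n.+1)%N); rewrite leq_pexp2l.
Qed.

Lemma bitlen_self n : (bitlen n <= n)%N.
Proof.
rewrite leqNgt; apply/negP => /bitlen_le; rewrite leqNgt => /negP; apply.
exact: ltn_expl.
Qed.

(** * Execution of the whole algorithm *)

Section Execution.
Variables (R : realType) (B : nat -> nat -> R) (w : nat -> bool).
Local Notation ast := (@ast R).
Local Notation den := (den B w).

Definition tholds (t : test) (a : ast) : bool :=
  match t with NLt i j => (nr a i < nr a j)%N | RLt x y => xr a x < xr a y end.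

Definition tok (t : test) : bool :=
  match t with NLt i j | RLt i j => (i < 32)%N && (j < 32)%N end.

Definition runs (T : nat) (c : cmd) (a a' : ast) : Prop :=
  forall s, sim s a -> exists2 s', halts_within B w T c s s' & sim s' a'.

Lemma runs_seq T1 T2 c1 c2 a a1 a2 :
  runs T1 c1 a a1 -> runs T2 c2 a1 a2 -> runs (T1 + T2) (Seq c1 c2) a a2.
Proof.
move=> h1 h2 s /h1 [s1 e1 /h2 [s2 e2 hs2]]; exists s2 => //.
exact: hw_seq e1 e2.
Qed.

Lemma runs_comp Pr b p a : ok Pr p -> (forall r, r \in Pr -> (nr a r <= b)%N) ->
  runs (cost b p) (comp p) a (den p a).
Proof. by move=> o hb s hs; exact: comp_ok hs o hb. Qed.

(** The initial loops stop on a condition on the data, so they lie outside [stmt] and are executed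
    directly for a known number of rounds. *)
Lemma runs_while t p k a : tok t -> ok [::] p ->
  (forall m, (m < k)%N -> tholds t (iter m (den p) a)) -> ~~ tholds t (iter k (den p) a) ->
  runs (k * (cost 0 p + 1) + 1) (While t (comp p)) a (iter k (den p) a).
Proof.
move=> tk o; have tE s a' : sim s a' -> holds t s = tholds t a'.
  by case: t tk => i j /= /andP[i32 j32] [h1 h2 _ _]; rewrite ?h1 ?h2.
elim: k a => [|k IH] a hT hF s hs.
  by exists s => //; exists 1%N => //; apply: ExecWhileF; rewrite (tE _ _ hs).
have [s1 [t1 l1 e1] hs1] := @runs_comp [::] 0 p a o (fun _ => ltac:(by [])) s hs.
have [||s2 [t2 l2 e2] hs2] := IH (den p a) _ _ s1 hs1.
- by move=> m mk; rewrite -iterSr; apply: hT.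
- by rewrite -iterSr.
exists s2; last by rewrite iterSr.
exists (t1 + t2).+1; first by rewrite mulSn; lia.
by apply: ExecWhileT e1 e2; rewrite (tE _ _ hs); exact: (hT 0%N).
Qed.

Definition ainit (n : nat) (eps : R) : ast :=
  Ast (upd (fun=> 0%N) 0%N n) (upd (fun=> 0) 0%N eps) (fun _ _ => 0) 0.

Lemma sim_init n eps : sim (init n eps) (ainit n eps).
Proof. by split=> // q i _; rewrite /= /upd /arr_addr. Qed.

Lemma iter_half c m a : c \notin [:: 24; 26]%N ->
  let a' := iter m (den (Half c)) a in
  [/\ nr a' 24 = (nr a 24 %/ 2 ^ m)%N, nr a' c = (nr a c + m)%N,
      (forall k, k \notin [:: 24; c]%N -> nr a' k = nr a k) & [/\ xr a' = xr a, ar a' = ar a & co a' = co a]].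
Proof.
rewrite !inE negb_or => /andP[c24 c26].
elim: m => [|m [i1 i2 i3 [i4 i5 i6]]] /=; first by rewrite divn1 addn0; split.
have c24' : 24%N != c by rewrite eq_sym.
split.
- by rewrite updNE // updE i1 expnSr divnMA divn2.
- by rewrite updE updNE // i2 addn1 addnS.
- by move=> k; rewrite !inE negb_or => /andP[k24 kc]; rewrite !updNE // i3 // !inE negb_or k24.
- by [].
Qed.

Lemma runs_half c a : c \notin [:: 24; 26]%N -> (c < 32)%N -> nr a 26 = 0%N ->
  runs (bitlen (nr a 24) * (cost 0 (Half c) + 1) + 1) (While (NLt 26 24) (comp (Half c))) a
    (iter (bitlen (nr a 24)) (den (Half c)) a).
Proof.
move=> hc c32 z.
have h26 m : nr (iter m (den (Half c)) a) 26 = 0%N.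
  have [_ _ h _] := iter_half m a hc; rewrite h //.
  by move: hc; rewrite !inE !negb_or /= => /andP[_]; rewrite eq_sym.
have h24 m : nr (iter m (den (Half c)) a) 24 = (nr a 24 %/ 2 ^ m)%N by have [] := iter_half m a hc.
apply: runs_while => //; first by rewrite /= c32.
  by move=> m mk; rewrite /tholds h26 h24 divn_gt0 ?expn_gt0 // bitlen_le.
by rewrite /tholds h26 h24 -leqNgt divn_small // bitlen_gt.
Qed.

Definition init_cost (k1 k2 k3 : nat) : nat :=
  (cost 0 Init1 + ((k1 * (cost 0 (Half 3) + 1) + 1) + (cost 0 Init2 + ((k2 * (cost 0 (Half 8) + 1) + 1) +
   (cost 0 Init3 + ((k3 * (cost 0 Shrink + 1) + 1) + cost 0 Init4))))))%N.

Lemma init_runs n eps k : let L := (bitlen n).+1 in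
  (forall m, (m < k)%N -> eps / 1000 < (5 / 6) ^+ m.+1) -> (5 / 6) ^+ k.+1 <= eps / 1000 ->
  exists a', [/\ runs (init_cost (bitlen n) (bitlen L) k) init_cmd (ainit n eps) a',
    [/\ nr a' 0 = n, nr a' 3 = L, nr a' 8 = bitlen L, nr a' 4 = k.+1 & nr a' 5 = (4 * L + 13)%N],
    ar a' = (fun _ _ => 0) & co a' = 0%N].
Proof.
move=> L hlt hge.
pose a0 := ainit n eps.
have c1 := @runs_comp [::] 0 Init1 a0 isT (fun _ => ltac:(by [])).
set a1 := den Init1 a0 in c1.
have c2 := @runs_half 3%N a1 isT isT erefl.
have [f24 f3 fo [fx fa fc]] := @iter_half 3%N (bitlen n) a1 isT.
set a2 := iter _ _ a1 in c2 f24 f3 fo fx fa fc.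
have g3 : nr a2 3 = L by rewrite f3.
have g0 : nr a2 0 = n by rewrite fo.
have g26 : nr a2 26 = 0%N by rewrite fo.
have gx : xr a2 0 = eps by rewrite fx.
have ga : ar a2 = (fun _ _ => 0) by rewrite fa.
have gc : co a2 = 0%N by rewrite fc.
have {}c2 : runs (bitlen n * (cost 0 (Half 3) + 1) + 1) (While (NLt 26 24) (comp (Half 3))) a1 a2 by exact: c2.
clearbody a2 => {f24 f3 fo fx fa fc}.
have c3 := @runs_comp [::] 0 Init2 a2 isT (fun _ => ltac:(by [])).
set a3 := den Init2 a2 in c3.
have h24 : nr a3 24 = L by rewrite /a3 /= /upd /= g3.
have h3 : nr a3 3 = L by rewrite /a3 /= /upd /= g3.
have h8 : nr a3 8 = 0%N by [].
have h0 : nr a3 0 = n by [].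
have h26 : nr a3 26 = 0%N by [].
have hx : xr a3 0 = eps by [].
have ha : ar a3 = (fun _ _ => 0) by [].
have hc : co a3 = 0%N by [].
clearbody a3.
have c4 := @runs_half 8%N a3 isT isT h26.
have [f24 f8 fo [fx fa fc]] := @iter_half 8%N (bitlen L) a3 isT.
rewrite h24 in c4; set a4 := iter _ _ a3 in c4 f24 f8 fo fx fa fc.
have i8 : nr a4 8 = bitlen L by rewrite f8 h8.
have i3 : nr a4 3 = L by rewrite fo.
have i0 : nr a4 0 = n by rewrite fo.
have ix : xr a4 0 = eps by rewrite fx.
have ia : ar a4 = (fun _ _ => 0) by rewrite fa.
have ic : co a4 = 0%N by rewrite fc.
clearbody a4 => {f24 f8 fo fx fa fc}.
have c5 := @runs_comp [::] 0 Init3 a4 isT (fun _ => ltac:(by [])).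
set a5 := den Init3 a4 in c5.
have j4 : nr a5 4 = 1%N by [].
have j3 : nr a5 3 = L by [].
have j8 : nr a5 8 = bitlen L by [].
have j0 : nr a5 0 = n by [].
have jx9 : xr a5 9 = 5 / 6 by [].
have jx10 : xr a5 10 = eps / 1000 by rewrite -ix.
have ja : ar a5 = (fun _ _ => 0) by [].
have jc : co a5 = 0%N by [].
clearbody a5.
have it m : let a' := iter m (den Shrink) a5 in
   [/\ xr a' 9 = (5 / 6) ^+ m.+1, nr a' 4 = m.+1, xr a' 10 = eps / 1000,
       [/\ nr a' 3 = L, nr a' 8 = bitlen L & nr a' 0 = n] & ar a' = (fun _ _ => 0) /\ co a' = 0%N].
  elim: m => [|m [k9 k4 k10 [k3 k8 k0] [ka kc]]] /=; first by rewrite expr1.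
  by split=> //; rewrite ?updE ?k9 ?k4 ?addn1 // [in RHS]exprSr.
have c6 : runs (k * (cost 0 Shrink + 1) + 1) (While (RLt 10 9) (comp Shrink)) a5 (iter k (den Shrink) a5).
  apply: runs_while => //.
    by move=> m mk; have [e9 _ e10 _ _] := it m; rewrite /tholds e9 e10 hlt.
  by have [e9 _ e10 _ _] := it k; rewrite /tholds e9 e10 -leNgt.
have [k9 k4 k10 [k3 k8 k0] [ka kc]] := it k.
set a6 := iter k _ a5 in c6 k9 k4 k10 k3 k8 k0 ka kc; clearbody a6.
have c7 := @runs_comp [::] 0 Init4 a6 isT (fun _ => ltac:(by [])).
exists (den Init4 a6); split.
- exact: runs_seq c1 (runs_seq c2 (runs_seq c3 (runs_seq c4 (runs_seq c5 (runs_seq c6 c7))))).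
- by split=> //; rewrite /= updE k3; lia.
- exact: ka.
- exact: kc.
Qed.

(** The array of nodes in memory agrees with the sequence of nodes only below [r], whereas [gramx]
    takes a full sequence. *)
Lemma gram_kernel_ext n r (x x' : nat -> R) l : (l <= r)%N -> (forall i, (i < r)%N -> x i = x' i) ->
  forall i j, (i < r)%N -> (j < r)%N ->
    gram_kernel r (gramx n x) l i j = gram_kernel r (gramx n x') l i j.
Proof.
move=> + e; elim: l => [|l IH] lr i j ir jr //=.
have {}IH := IH (ltnW lr).
have eG k : (k < r)%N -> gramx n x k l = gramx n x' k l by move=> kr; rewrite /gramx !e.
have ed k : (k < r)%N -> gram_dir r (gramx n x) (gram_kernel r (gramx n x) l) l k =
    gram_dir r (gramx n x') (gram_kernel r (gramx n x') l) l k.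
  by move=> kr; congr (_ - _); apply: eq_bigr => b _; rewrite IH ?eG.
rewrite IH // !ed //; congr (_ + _ / _); apply: eq_bigr => b _; by rewrite ed ?eG.
Qed.

Lemma main_ok a (r n L Lam : nat) (x : nat -> R) :
  nr a 6 = r -> nr a 0 = n -> nr a 3 = L -> nr a 8 = Lam -> (0 < n)%N -> (n + n <= 2 ^ L)%N ->
  (forall i, (i < r)%N -> ar a 0 i = x i) -> (forall k, ar a 3 k = 0) -> (forall k, ar a 4 k = 0) -> co a = 0%N ->
  [/\ nr (den Main a) 0 = r, nr (den Main a) 3 = L,
      forall i, (i < r)%N -> ar (den Main a) 0 i = x i &
      forall i, (i < r)%N -> ar (den Main a) 4 i = sgd_run n r L Lam x B (nr a 7) w i].
Proof.
move=> E6 E0 E3 E8 n0 nL hx z3 z4 c0.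
change (den Main a) with (den (SN 0 (NV 6)) (den Sgd (den KBuild a))).
have hK i j : (i < r)%N -> (j < r)%N ->
    ar (den KBuild a) 3 (i * r + j)%N = gram_kernel r (gramx n x) r i j.
  move=> ir jr; have nl : (nr a 0 < 2 ^ nr a 3)%N by rewrite E0 E3; lia.
  have := @kbuild_ok R B w a nl z3 i j; rewrite E6 E0 => /(_ ir jr) ->.
  by apply: gram_kernel_ext.
have [s1 _ s3] := den_same B w KBuild a.
have f6 : nr (den KBuild a) 6 = r by rewrite s1.
have f0 : nr (den KBuild a) 0 = n by rewrite s1.
have f3 : nr (den KBuild a) 3 = L by rewrite s1.
have f8 : nr (den KBuild a) 8 = Lam by rewrite s1.
have f7 : nr (den KBuild a) 7 = nr a 7 by rewrite s1.
have fa : forall i, (i < r)%N -> ar (den KBuild a) 0 i = x i by rewrite s3.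
have f4 : forall i, ar (den KBuild a) 4 i = 0 by rewrite s3.
have fc : co (den KBuild a) = 0%N by rewrite den_co.
set a1 := den KBuild a in hK f6 f0 f3 f8 f7 fa f4 fc *; clearbody a1 => {s1 s3}.
have h4 := @sgd_ok R B w a1 r n L Lam x f6 f0 f3 f8 n0 nL fa hK fc f4; rewrite f7 in h4.
have [s1 _ s3] := den_same B w Sgd a1.
have g6 : nr (den Sgd a1) 6 = r by rewrite s1.
have g3 : nr (den Sgd a1) 3 = L by rewrite s1.
have ga : forall i, (i < r)%N -> ar (den Sgd a1) 0 i = x i by rewrite s3.
set a2 := den Sgd a1 in h4 g6 g3 ga *; clearbody a2.
by split.
Qed.

Definition alg_rank (n k : nat) : nat := (4 * (k.+1 * (4 * (bitlen n).+1 + 13)))%N.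
Definition alg_iter (n k : nat) : nat := (k.+1 * (alg_rank n k * ((bitlen n).+1 * 64)))%N.
Definition alg_cost (n k : nat) : nat :=
  let b := alg_iter n k in
  (init_cost (bitlen n) (bitlen (bitlen n).+1) k + (cost b Setup + (cost b Tot + cost b Main)))%N.

Lemma alg_runs n eps k : let L := (bitlen n).+1 in let r := alg_rank n k in (0 < n)%N ->
  (forall m, (m < k)%N -> eps / 1000 < (5 / 6) ^+ m.+1) -> (5 / 6) ^+ k.+1 <= eps / 1000 ->
  exists a', [/\ runs (alg_cost n k) alg_cmd (ainit n eps) a', nr a' 0 = r, nr a' 3 = L,
    forall i, (i < r)%N -> ar a' 0 i = node R k.+1 i &
    forall i, (i < r)%N -> ar a' 4 i = sgd_run n r L (bitlen L) (node R k.+1) B (alg_iter n k) w i].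
Proof.
move=> L r n0 hlt hge.
have [a1 [c1 [e0 e3 e8 e4 e5] ea ec]] := init_runs n hlt hge.
set b := alg_iter n k.
have r1 : (k < r)%N by rewrite /r /alg_rank; nia.
have r2 : (4 * L + 13 <= r)%N by rewrite /r /alg_rank -/L; nia.
have rb : (r <= b)%N by rewrite /b /alg_iter -/r; nia.
have c2 : runs (cost b Setup) (comp Setup) a1 (den Setup a1).
  apply: (@runs_comp [:: 4; 5] b) => // q; rewrite !inE => /orP[] /eqP ->; rewrite ?e4 ?e5; lia.
have d0 : (0 < nr a1 4)%N by rewrite e4.
have [q13 q0] := nodes_ok B w d0; rewrite e4 e5 -/(alg_rank n k) in q13 q0.
have [s1 _ s3] := den_same B w Setup a1.
have f6 : nr (den Setup a1) 6 = r by exact: q13.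
have f0 : nr (den Setup a1) 0 = n by rewrite s1.
have f3 : nr (den Setup a1) 3 = L by rewrite s1.
have f4 : nr (den Setup a1) 4 = k.+1 by rewrite s1.
have f8 : nr (den Setup a1) 8 = bitlen L by rewrite s1.
have g0 : forall i, (i < r)%N -> ar (den Setup a1) 0 i = node R k.+1 i by exact: q0.
have g3 : forall i, ar (den Setup a1) 3 i = 0 by rewrite s3 // ea.
have g4 : forall i, ar (den Setup a1) 4 i = 0 by rewrite s3 // ea.
have gc : co (den Setup a1) = 0%N by rewrite den_co.
set a2 := den Setup a1 in c2 f6 f0 f3 f4 f8 g0 g3 g4 gc; clearbody a2 => {s1 s3}.
have c3 : runs (cost b Tot) (comp Tot) a2 (den Tot a2).
  apply: (@runs_comp [:: 3; 4; 6] b) => // q; rewrite !inE => /or3P[] /eqP ->; rewrite ?f3 ?f4 ?f6; lia.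
have h7 : nr (den Tot a2) 7 = b by rewrite tot_ok f4 f6 f3.
have [s1 _ s3] := den_same B w Tot a2.
have h6 : nr (den Tot a2) 6 = r by rewrite s1.
have h0 : nr (den Tot a2) 0 = n by rewrite s1.
have h3 : nr (den Tot a2) 3 = L by rewrite s1.
have h8 : nr (den Tot a2) 8 = bitlen L by rewrite s1.
have i0 : forall i, (i < r)%N -> ar (den Tot a2) 0 i = node R k.+1 i by rewrite s3.
have i3 : forall i, ar (den Tot a2) 3 i = 0 by rewrite s3.
have i4 : forall i, ar (den Tot a2) 4 i = 0 by rewrite s3.
have ic : co (den Tot a2) = 0%N by rewrite den_co.
set a3 := den Tot a2 in c3 h7 h6 h0 h3 h8 i0 i3 i4 ic; clearbody a3 => {s1 s3}.
have c4 : runs (cost b Main) (comp Main) a3 (den Main a3).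
  apply: (@runs_comp [:: 3; 6; 7] b) => // q; rewrite !inE => /or3P[] /eqP ->; rewrite ?h3 ?h6 ?h7; lia.
have nL : (n + n <= 2 ^ L)%N by rewrite expnS mul2n addnn leq_double ltnW // bitlen_gt.
have [m0 m3 m5 m4] := main_ok h6 h0 h3 h8 n0 nL i0 i3 i4 ic.
exists (den Main a3); split=> //; last by rewrite -h7.
exact: runs_seq c1 (runs_seq c2 (runs_seq c3 c4)).
Qed.

Lemma entry_ok a i l (x c : nat -> R) :
  nr a 1 = i -> nr a 2 = l -> (i < 2 ^ nr a 3)%N -> ar a 0 l = x l -> ar a 4 l = c l ->
  xr (den EntryU a) 0 = c l * x l ^+ i /\ xr (den EntryV a) 0 = x l ^+ i.
Proof.
move=> e1 e2 iL ex ec.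
change (den EntryU a) with (den (SX 0 (XTimes (XA 4 (NV 2)) power_entry)) (den (Geo (XA 0 (NV 2)) (NV 1)) a)).
change (den EntryV a) with (den (SX 0 power_entry) (den (Geo (XA 0 (NV 2)) (NV 1)) a)).
have g1 : xr (den (Geo (XA 0 (NV 2)) (NV 1)) a) 1 = \sum_(j < i) x l ^+ j.
  by rewrite geo_ok /= e1 // e2 ex.
have [s1 _ s3] := den_same B w (Geo (XA 0 (NV 2)) (NV 1)) a.
have f2 : nr (den (Geo (XA 0 (NV 2)) (NV 1)) a) 2 = l by rewrite s1.
have f0 : ar (den (Geo (XA 0 (NV 2)) (NV 1)) a) 0 = ar a 0 by rewrite s3.
have f4 : ar (den (Geo (XA 0 (NV 2)) (NV 1)) a) 4 = ar a 4 by rewrite s3.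
set a1 := den (Geo _ _) a in g1 f2 f0 f4 *; clearbody a1.
have E : 1%:R + (x l - 1%:R) * \sum_(j < i) x l ^+ j = x l ^+ i by rewrite -subrX1 addrC subrK.
by rewrite /= !updE g1 f2 f0 f4 ex ec E.
Qed.

End Execution.

(** * Complexity *)

Section Complexity.
Variable R : realType.

Definition enough (eps : R) (k : nat) : bool := (5 / 6) ^+ k.+1 <= eps / 1000.

Lemma enough_exists eps : 0 < eps -> exists k, enough eps k.
Proof.
move=> e0; pose y := 5 * 1000 / eps.
have y0 : 0 <= y by apply: divr_ge0; [apply: mulr_ge0|exact: ltW].
have := archi_boundP y0; set k := Num.bound y => hk.
exists k; rewrite /enough.
have bern : forall m, 1 + m%:R / 5 <= (6 / 5 : R) ^+ m.
  elim=> [|m IH]; first by rewrite mul0r addr0 expr0.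
  rewrite exprS; have : m.+1%:R = m%:R + 1 :> R by rewrite natr1.
  have : 0 <= m%:R :> R by [].
  nra.
have E : (5 / 6 : R) ^+ k.+1 * (6 / 5) ^+ k.+1 = 1.
  by rewrite -exprMn (_ : 5 / 6 * (6 / 5) = 1) ?expr1n //; field.
have p : 0 < (6 / 5 : R) ^+ k.+1 by apply: exprn_gt0; lra.
rewrite -(ler_pM2r p) E.
have h := bern k.+1.
apply: le_trans (_ : eps / 1000 * (k%:R / 5) <= _).
  rewrite /y ltr_pdivrMr // in hk; lra.
apply: ler_wpM2l; first by apply: divr_ge0; [exact: ltW|].
apply: le_trans h.
have : k.+1%:R = k%:R + 1 :> R by rewrite natr1.
lra.
Qed.

(** The number of rounds of the loop around [Shrink], one less than the d it finds. The default 0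
    does not occur for eps > 0. *)
Definition eps_steps (eps : R) : nat :=
  if boolp.pselect (exists k, enough eps k) is left h then ex_minn h else 0%N.

Lemma eps_stepsP eps : 0 < eps ->
  enough eps (eps_steps eps) /\ forall m, (m < eps_steps eps)%N -> eps / 1000 < (5 / 6) ^+ m.+1.
Proof.
move=> e0; rewrite /eps_steps; case: boolp.pselect => [h|nh]; last by case: nh; exact: enough_exists.
case: ex_minnP => k hk km; split=> // m mk.
by rewrite ltNge; apply/negP => /km; rewrite leqNgt mk.
Qed.

Definition alg_size : nat :=
  (1000 + size_stmt Setup + size_stmt Tot + size_stmt Main + size_stmt EntryU + size_stmt EntryV)%N.

(** Cubic because loops are nested at most three deep and [alg_iter] bounds each of their
    lengths. *)
Definition alg_time (n k : nat) : nat := (alg_size * (alg_iter n k).+1 ^ 3)%N.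

Lemma cost_le3 b p : (nesting p <= 3)%N -> (cost b p <= size_stmt p * b.+1 ^ 3)%N.
Proof. by move=> h; apply: leq_trans (cost_le b p) _; rewrite leq_mul2l leq_pexp2l ?orbT. Qed.

Lemma alg_iter_ge n k : [/\ (k < alg_iter n k)%N, (bitlen n < alg_iter n k)%N &
  (bitlen (bitlen n).+1 <= alg_iter n k)%N].
Proof.
have h := bitlen_self (bitlen n).+1; rewrite /alg_iter /alg_rank.
set L := (bitlen n).+1 in h *.
have : (k.+1 * L <= k.+1 * (4 * (k.+1 * (4 * L + 13)) * (L * 64)))%N.
  rewrite leq_mul2l /= -{1}[L]mul1n leq_mul //; nia.
have : (k.+1 <= k.+1 * L)%N by rewrite leq_pmulr.
have : (L <= k.+1 * L)%N by rewrite leq_pmull.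
rewrite -/L; split; lia.
Qed.

Lemma alg_time_ge n k : let b := alg_iter n k in let T := alg_time n k in
  [/\ (alg_cost n k <= T)%N, (cost b EntryU <= T)%N, (cost b EntryV <= T)%N &
      (b * sgd_bits (bitlen n).+1 <= T)%N].
Proof.
move=> b T.
have [kb lb llb] := alg_iter_ge n k; rewrite -/b in kb lb llb.
have h1 := @cost_le3 b Setup isT; have h2 := @cost_le3 b Tot isT; have h3 := @cost_le3 b Main isT.
have h4 := @cost_le3 b EntryU isT; have h5 := @cost_le3 b EntryV isT.
have X1 : (b.+1 <= b.+1 ^ 3)%N by rewrite -{1}[b.+1]expn1 leq_pexp2l.
have X2 : (b.+1 * b.+1 <= b.+1 ^ 3)%N by rewrite mulnn leq_pexp2l.
have i1 : (init_cost (bitlen n) (bitlen (bitlen n).+1) k <= 500 * b.+1)%N.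
  by move: kb lb llb; move: (bitlen n) (bitlen (bitlen n).+1) => k1 k2; rewrite /init_cost /=; lia.
have i2 : (b * sgd_bits (bitlen n).+1 <= 4 * (b.+1 * b.+1))%N.
  by rewrite /sgd_bits mulnCA; apply: leq_mul => //; lia.
have TE : T = (1000 * b.+1 ^ 3 + size_stmt Setup * b.+1 ^ 3 + size_stmt Tot * b.+1 ^ 3 + size_stmt Main * b.+1 ^ 3 +
    size_stmt EntryU * b.+1 ^ 3 + size_stmt EntryV * b.+1 ^ 3)%N by rewrite -!mulnDl.
rewrite /alg_cost -/b TE.
move: h1 h2 h3 h4 h5 X1 X2 i1 i2; set X := (b.+1 ^ 3)%N.
set c1 := cost b Setup; set c2 := cost b Tot; set c3 := cost b Main; set c4 := cost b EntryU; set c5 := cost b EntryV.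
set z1 := (size_stmt Setup * X)%N; set z2 := (size_stmt Tot * X)%N; set z3 := (size_stmt Main * X)%N.
set z4 := (size_stmt EntryU * X)%N; set z5 := (size_stmt EntryV * X)%N.
set i0 := init_cost _ _ _; set bb := (b.+1 * b.+1)%N; set sb := (b * sgd_bits _)%N.
clearbody c1 c2 c3 c4 c5 z1 z2 z3 z4 z5 i0 bb sb X => *; split; lia.
Qed.

Lemma ln_half : 1 / 2 <= ln 2 :> R.
Proof.
have := @le_ln1Dx R (- (1 / 2)); rewrite (_ : 1 + - (1 / 2) = 2^-1); last by field.
rewrite lnV ?posrE //; lra.
Qed.

Lemma log_n_ge1 n : (0 < n)%N -> 1 <= log_n R n.
Proof. by move=> n0; rewrite /log_n lerDl ln_ge0 // ler1n. Qed.

Lemma log_eps_ge1 (eps : R) : 1 <= log_eps eps.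
Proof. by rewrite /log_eps lerDl le_max lexx. Qed.

(** With t the integer part of log2 n, t / 2 <= t ln 2 <= ln n, and the left side is t + 2. *)
Lemma bitlen_log n : (0 < n)%N -> (bitlen n).+1%:R <= 2 * log_n R n.
Proof.
case: n => // n _; rewrite /bitlen /log_n; set t := trunc_log 2 n.+1.
have h : (2 ^ t <= n.+1)%N by apply: trunc_logP.
have : ln ((2 : R) ^+ t) <= ln n.+1%:R.
  by rewrite ler_ln ?posrE ?exprn_gt0 // -natrX ler_nat.
rewrite lnXn // -[X in X <= _]mulr_natl => h1; have h2 := ln_half; have t0 : 0 <= t%:R :> R by [].
have -> : t.+2%:R = t%:R + 2 :> R by rewrite -addn2 natrD.
nra.
Qed.

(** By minimality (5/6)^k > eps / 1000, so k ln(6/5) < ln 1000 - ln eps. The crude bounds ln 1000 <=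
    27 and ln(6/5) >= 1/6 then leave ample room below 200. *)
Lemma eps_steps_log eps : 0 < eps -> (eps_steps eps).+1%:R <= 200 * log_eps eps.
Proof.
move=> e0; have [_ h] := eps_stepsP e0; have l1 := log_eps_ge1 eps.
have l10 : ln (10 : R) <= 9 by have := @le_ln1Dx R 9; rewrite (_ : 1 + 9 = 10); [apply; lra|ring].
have lc : ln (1000 : R) <= 27.
  have -> : 1000 = 10 ^+ 3 :> R by rewrite -natrX.
  by rewrite lnXn // -[leLHS]mulr_natl; lra.
have c0 : 0 < 1000 :> R by [].
move: lc c0 h; move: (1000 : R) => c lc c0 h.
case: (posnP (eps_steps eps)) => [->|k0]; first lra.
have := h _ (_ : (eps_steps eps).-1 < eps_steps eps)%N; rewrite prednK // leqnn => /(_ isT).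
set k := eps_steps eps => hk.
have e1 : 0 < eps / c by rewrite divr_gt0.
have p : 0 < (5 / 6 : R) ^+ k by apply: exprn_gt0; lra.
have := hk; rewrite -ltr_ln ?posrE // lnXn; last lra.
have -> : ln (eps / c) = ln eps - ln c by rewrite lnM ?posrE ?invr_gt0 // lnV ?posrE.
rewrite -[X in _ < X]mulr_natl => hl.
have l56 : ln (5 / 6 : R) <= - (1 / 6).
  by have := @le_ln1Dx R (- (1 / 6)); rewrite (_ : 1 + - (1 / 6) = 5 / 6); [apply; lra|field].
have lm : - ln eps <= Num.max 0 (ln eps^-1) by rewrite lnV ?posrE // le_max lexx orbT.
have m0 : 0 <= Num.max 0 (ln eps^-1) by rewrite le_max lexx.
have -> : k.+1%:R = k%:R + 1 :> R by rewrite natr1.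
rewrite /log_eps; set M := Num.max _ _ in lm m0 *.
have k0' : 0 <= k%:R :> R by [].
nra.
Qed.

Lemma alg_rank_log n eps : (0 < n)%N -> 0 < eps ->
  (alg_rank n (eps_steps eps))%:R <= 68 * 400 * (log_n R n * log_eps eps).
Proof.
move=> n0 e0; have h1 := bitlen_log n0; have h2 := eps_steps_log e0.
set L := (bitlen n).+1 in h1; set d := (eps_steps eps).+1 in h2.
have : (alg_rank n (eps_steps eps) <= 68 * (d * L))%N by rewrite /alg_rank -/L -/d; nia.
rewrite -(ler_nat R) natrM (natrM _ d) => /le_trans; apply.
have : d%:R * L%:R <= 200 * log_eps eps * (2 * log_n R n) by apply: ler_pM.
lra.
Qed.

(** [alg_iter] is at most 4352 (d L)^2, where 4352 = 4 * 17 * 64 and 17 comes from 4 L + 13 <= 17 L;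
    d L is at most 400 times the product of the logarithms. The cube gives the exponent 6. *)
Lemma alg_time_polylog : polylog (fun n (eps : R) => alg_time n (eps_steps eps)).
Proof.
exists (alg_size%:R * (4353 * 400 ^+ 2) ^+ 3), 6%N => n eps n0 e0.
have h1 := bitlen_log n0; have h2 := eps_steps_log e0.
rewrite /alg_time; set d := (eps_steps eps).+1 in h2; set L := (bitlen n).+1 in h1.
have hb : ((alg_iter n (eps_steps eps)).+1 <= 4353 * (d * L) ^ 2)%N.
  rewrite /alg_iter /alg_rank -/L -/d.
  have d0 : (0 < d)%N by []. have L0 : (0 < L)%N by [].
  clearbody d L.
  have : (d * (4 * (d * (4 * L + 13)) * (L * 64)) <= 4352 * (d * L) ^ 2)%N.
    apply: leq_trans (_ : d * (4 * (d * (17 * L)) * (L * 64)) <= _)%N.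
      by rewrite !leq_mul //; lia.
    by apply: eq_leq; rewrite -mulnn; ring.
  have : (0 < (d * L) ^ 2)%N by rewrite expn_gt0 muln_gt0 d0 L0.
  lia.
rewrite natrM -mulrA ler_wpM2l // natrX.
set q := log_n R n * log_eps eps.
have dL : (d * L)%:R <= 400 * q.
  have : d%:R * L%:R <= 200 * log_eps eps * (2 * log_n R n) by apply: ler_pM.
  by rewrite natrM /q; lra.
have E (a b : R) : (a * b ^+ 2) ^+ 3 * q ^+ 6 = (a * (b * q) ^+ 2) ^+ 3 by ring.
rewrite E.
have q0 : 0 <= q by rewrite mulr_ge0 // (le_trans ler01) ?log_n_ge1 ?log_eps_ge1.
have q1 : 0 <= 400 * q by apply: mulr_ge0.
clearbody q; apply: lerXn2r; rewrite ?nnegrE //; first by apply: mulr_ge0 => //; exact: sqr_ge0.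
apply: le_trans (_ : _ <= (4353 * (d * L) ^ 2)%N%:R) _; first by rewrite ler_nat.
rewrite natrM ler_wpM2l // natrX; apply: lerXn2r; rewrite ?nnegrE //.
Qed.

End Complexity.

(** * Error analysis *)

Section Norm.
Variables (R : realType) (I : finType).

Definition nf (f : I -> R) : R := Num.sqrt (dot f f).

Lemma nf_ge0 f : 0 <= nf f. Proof. exact: sqrtr_ge0. Qed.

Lemma nf_sqr f : nf f ^+ 2 = dot f f. Proof. by rewrite sqr_sqrtr ?dot_ge0. Qed.

Lemma nf_le f c : 0 <= c -> dot f f <= c ^+ 2 -> nf f <= c.
Proof. by move=> c0; rewrite -nf_sqr => h; rewrite -(@ler_pXn2r _ 2) ?nnegrE ?nf_ge0. Qed.

Lemma eq_nf f g : f =1 g -> nf f = nf g.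
Proof. by move=> e; rewrite /nf (eq_dot e e). Qed.

Lemma nfD f g : nf (fun p => f p + g p) <= nf f + nf g.
Proof.
apply: nf_le; first by rewrite addr_ge0 ?nf_ge0.
have -> : dot (fun p => f p + g p) (fun p => f p + g p) = dot f f + 2 * dot f g + dot g g.
  by rewrite /dot mulr_sumr -!big_split; apply: eq_bigr => p _ /=; ring.
have -> : (nf f + nf g) ^+ 2 = nf f ^+ 2 + 2 * (nf f * nf g) + nf g ^+ 2 by ring.
rewrite !nf_sqr lerD2r lerD2l ler_wpM2l //.
apply: le_trans (ler_norm _) _.
rewrite -(@ler_pXn2r _ 2) ?nnegrE ?mulr_ge0 ?nf_ge0 // real_normK ?num_real //.
by rewrite exprMn !nf_sqr dot_CS.
Qed.

Lemma nfB f g : nf (fun p => f p - g p) <= nf f + nf g.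
Proof.
have -> : nf g = nf (fun p => - g p).
  by rewrite /nf; congr Num.sqrt; apply: eq_bigr => p _; rewrite mulrNN.
exact: nfD.
Qed.

End Norm.

(** * Assembly of the error bound *)

Section Recovery.
Variable R : realType.

Lemma frobE n (A : 'M[R]_n) : frob A = nf (matfun A).
Proof.
rewrite /frob /nf /dot; congr Num.sqrt.
by rewrite -(sum_matfun (fun i j => A i j ^+ 2)); apply: eq_bigr => p _; rewrite expr2.
Qed.

Lemma oracleE n (A : 'M[R]_n) (i j : 'I_n) : oracle A i j = A i j.
Proof. by rewrite /oracle !valK. Qed.

(** From (1 - eta)^M (1 + eta)^M <= 1 and Bernoulli's (1 + eta)^M >= 2 one gets (1 - eta)^M <= 1/2,
    which is below (5/6)^2. *)
Lemma contraction (eta : R) (M d : nat) : 0 <= eta <= 1 -> 1 <= M%:R * eta ->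
  (1 - eta) ^+ (d * M) <= ((5 / 6) ^+ d) ^+ 2.
Proof.
move=> /andP[e0 e1] hM.
have h : (1 - eta) ^+ M <= 1 / 2.
  have bern : forall m, 1 + m%:R * eta <= (1 + eta) ^+ m.
    elim=> [|m IH]; first by rewrite mul0r addr0 expr0.
    rewrite exprS; have : m.+1%:R = m%:R + 1 :> R by rewrite natr1.
    have : 0 <= m%:R :> R by [].
    nra.
  have b2 : 2 <= (1 + eta) ^+ M by apply: le_trans (bern M); lra.
  have p0 : 0 <= (1 - eta) ^+ M by apply: exprn_ge0; lra.
  have : (1 - eta) ^+ M * (1 + eta) ^+ M <= 1.
    by rewrite -exprMn; apply: exprn_ile1; nra.
  nra.
have -> : ((5 / 6 : R) ^+ d) ^+ 2 = ((5 / 6) ^+ 2) ^+ d by rewrite -!exprM mulnC.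
rewrite mulnC exprM; apply: lerXn2r; rewrite ?nnegrE; [apply: exprn_ge0; lra|exact: sqr_ge0|].
by rewrite expr2; lra.
Qed.

(** With P the projection and dev the difference between the iterate and P B, the error is (H - P H)
    - (P E + dev). Writing rho = (5/6)^d, the terms in |H|_F add up to (92 + 4 + 368) rho <= eps and
    those in |E|_F to 1 + 4 + 4 rho <= 9. *)
Lemma recovery_error N (H E : 'M[R]_N.+1) eps k (c : nat -> R) (L := (bitlen N.+1).+1) (r := alg_rank N.+1 k) :
  hankel H -> psd H -> 0 < eps -> (5 / 6) ^+ k.+1 <= eps / 1000 ->
  let B := oracle (H + E) in let x := node R k.+1 in
  dot (deviation r x B c) (deviation r x B c : 'I_N.+1 * 'I_N.+1 -> R) <=
    10 * ((1 - sgd_rate R r (bitlen L)) ^+ alg_iter N.+1 k * start_err N.+1 r x B +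
      dot (residual r x B : 'I_N.+1 * 'I_N.+1 -> R) (residual r x B)) ->
  frob (H - \matrix_(i, j) expsum r x c (i + j)) <= 9 * frob E + eps * frob H.
Proof.
move=> hk ps e0 hge B x.
set d := k.+1 in x hge *.
have L1 : (0 < L)%N by [].
have Lam2 : (2 ^ bitlen L <= 2 * L)%N.
  case e: (bitlen L) => [|l]; first by rewrite expn0; lia.
  by rewrite expnS leq_mul2l /= bitlen_le // e.
have r0 : (0 < r)%N by rewrite /r /alg_rank muln_gt0.
pose J := (4 * L + 12)%N.
have rE : r = node_count d J by rewrite /r /alg_rank /node_count -/L -/d /J -addnS.
have hJ : 8 * N.+1%:R * shell R J <= 1.
  have nL : (N.+1 <= 2 ^ L)%N by rewrite expnS; have := bitlen_gt N.+1; lia.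
  have : shell R J <= (1 / 2) ^+ (L + 3).
    have -> : shell R J = ((4 / 5) ^+ 4) ^+ (L + 3) by rewrite /shell -exprM; congr (_ ^+ _); rewrite /J; lia.
    apply: lerXn2r; rewrite ?nnegrE; [by apply: exprn_ge0; lra|lra|].
    by rewrite !exprS expr0; lra.
  have -> : (1 / 2 : R) ^+ (L + 3) = (1 / 2) ^+ L / 8 by rewrite exprD; congr (_ * _); rewrite !exprS expr0; field.
  move=> hs; have p2 : N.+1%:R * (1 / 2) ^+ L <= 1 :> R.
    apply: le_trans (_ : (2 ^ L)%N%:R * (1 / 2) ^+ L <= _).
      by rewrite ler_wpM2r ?ler_nat // exprn_ge0 //; lra.
    by rewrite natrX -exprMn (_ : 2 * (1 / 2) = 1) ?expr1n //; field.
  have n0 : 0 <= N.+1%:R :> R by [].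
  have := ler_wpM2l n0 hs; lra.
have PR := psd_hankel_residual (isT : (0 < d)%N) hJ hk ps.
rewrite -rE -/x in PR.
pose P := projk r (@expmx R N.+1 x).
pose h := matfun H; pose e := matfun E; pose bf : 'I_N.+1 * 'I_N.+1 -> R := input_fun B.
set rho := (5 / 6 : R) ^+ d in hge.
have rho0 : 0 <= rho by apply: exprn_ge0; lra.
have rho1 : rho <= 1 by apply: exprn_ile1; lra.
have bE p : bf p = h p + e p by rewrite /bf /input_fun /B oracleE mxE.
have PbE p : P bf p = P h p + P e p by rewrite -projkD; exact: eq_dot.
have nh := nf_ge0 h; have ne := nf_ge0 e.
(* 92^2 exceeds 2080 * 2^2 = 8320. *)
have A1 : nf (fun p => h p - P h p) <= 92 * rho * nf h.
  apply: nf_le; first by rewrite !mulr_ge0.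
  apply: le_trans PR _; rewrite -/h exprMn nf_sqr; apply: ler_wpM2r; first exact: dot_ge0.
  rewrite /approx_rate -/rho; have : 0 <= rho ^+ 2 by exact: sqr_ge0.
  by rewrite !exprMn; lra.
have A2 : nf (P e) <= nf e by apply: nf_le => //; rewrite nf_sqr; exact: projk_le.
have A3 : nf (fun p => e p - P e p) <= nf e by apply: nf_le => //; rewrite nf_sqr; exact: residual_le.
have A4 : nf (residual r x B : 'I_N.+1 * 'I_N.+1 -> R) <= 92 * rho * nf h + nf e.
  apply: le_trans (lerD A1 A3); apply: le_trans (nfD _ _).
  rewrite (eq_nf (g := fun p => (h p - P h p) + (e p - P e p))) // => p.
  by rewrite /residual -/bf -[proj_fun _ _ _ _]/(P bf p) bE PbE; ring.
have A5 : nf (P bf) <= nf h + nf e.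
  apply: le_trans (_ : nf bf <= _).
    by apply: nf_le; rewrite ?nf_ge0 // nf_sqr; exact: projk_le.
  by rewrite (eq_nf bE); exact: nfD.
have SE : start_err N.+1 r x B = nf (P bf) ^+ 2.
  rewrite nf_sqr /start_err; apply: eq_bigr => p _; rewrite /deviation.
  have -> : expsum r x (fun=> 0) (p.1 + p.2) = 0 by rewrite /expsum big1 // => a _; rewrite mul0r.
  by rewrite sub0r mulrNN.
have rate : (1 - sgd_rate R r (bitlen L)) ^+ alg_iter N.+1 k <= rho ^+ 2.
  have /andP[s0 s1] := sgd_rate_bounds R (bitlen L) r0.
  apply: contraction; first by rewrite ltW.
  rewrite /sgd_rate; have p2 : 0 < 2 ^+ bitlen L :> R by exact: exprn_gt0.
  have rp : 0 < r%:R :> R by rewrite ltr0n.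
  have pp : 0 < 32 * r%:R * 2 ^+ bitlen L  :> R by apply: mulr_gt0 => //; apply: mulr_gt0.
  rewrite ler_pdivlMr // mul1r -natrX -!natrM ler_nat -/L.
  have -> : (r * (L * 64) = 32 * r * (2 * L))%N by ring.
  by rewrite leq_mul2l Lam2 orbT.
set dev := deviation r x B c; rewrite SE -nf_sqr -nf_sqr => hdev.
(* The factor 4 is chosen because 4^2 absorbs the 10 of Markov's inequality. *)
have A6 : nf (dev : 'I_N.+1 * 'I_N.+1 -> R) <= 4 * (rho * (nf h + nf e) + (92 * rho * nf h + nf e)).
  have q1 : 0 <= rho * (nf h + nf e) by rewrite mulr_ge0 // addr_ge0.
  have q2 : 0 <= 92 * rho * nf h + nf e by rewrite addr_ge0 // !mulr_ge0.
  apply: nf_le; first by rewrite mulr_ge0 // addr_ge0.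
  rewrite -nf_sqr; apply: le_trans hdev _.
  have h1 : (1 - sgd_rate R r (bitlen L)) ^+ alg_iter N.+1 k * nf (P bf) ^+ 2 <= (rho * (nf h + nf e)) ^+ 2.
    rewrite exprMn; apply: ler_pM => //; last by apply: lerXn2r; rewrite ?nnegrE ?nf_ge0 ?addr_ge0.
    - by apply: exprn_ge0; rewrite subr_ge0; have /andP[] := sgd_rate_bounds R (bitlen L) r0.
    - exact: sqr_ge0.
  have h2 : nf (residual r x B : 'I_N.+1 * 'I_N.+1 -> R) ^+ 2 <= (92 * rho * nf h + nf e) ^+ 2.
    by apply: lerXn2r; rewrite ?nnegrE ?nf_ge0.
  move: h1 h2 q1 q2; set u := rho * _; set v := 92 * rho * _ + _; clearbody u v => h1 h2 q1 q2.
  have : 0 <= u * v by exact: mulr_ge0.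
  have : 0 <= u ^+ 2 by exact: sqr_ge0.
  have : 0 <= v ^+ 2 by exact: sqr_ge0.
  have -> : (4 * (u + v)) ^+ 2 = 16 * (u ^+ 2) + 32 * (u * v) + 16 * (v ^+ 2) by ring.
  lra.
rewrite !frobE -/h -/e.
have -> : nf (matfun (H - \matrix_(i, j) expsum r x c (i + j))) = nf (fun p => (h p - P h p) - (P e p + dev p)).
  apply: eq_nf => p; rewrite /matfun !mxE /dev /deviation -[proj_fun _ _ _ _]/(P bf p) PbE.
  by rewrite /h /matfun; ring.
apply: le_trans (nfB _ _) _; apply: le_trans (lerD A1 (nfD _ _)) _.
have hr : 1000 * rho <= eps by rewrite mulrC -ler_pdivlMr.
have : 1000 * rho * nf h <= eps * nf h by rewrite ler_wpM2r.
have : rho * nf e <= nf e by rewrite ler_piMl.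
have : 0 <= rho * nf h by rewrite mulr_ge0.
move: A2 A6; set d1 := nf (P e); set d2 := nf (fun p => dev p); set hh := nf h; set ee := nf e.
rewrite -/d2 => A2 A6 B1 B2 B3.
have -> : 92 * rho * hh = 92 * (rho * hh) by ring.
have B3' : 1000 * (rho * hh) <= eps * hh by move: B3; rewrite mulrA.
move: A6; have -> : 4 * (rho * (hh + ee) + (92 * rho * hh + ee)) = 4 * (rho * hh) + 4 * (rho * ee) + 368 * (rho * hh) + 4 * ee by ring.
lra.
Qed.

End Recovery.

Theorem theorem1p1 (R : realType) :
  exists C : R, 0 < C /\
  exists (alg cU cV : cmd) (T : nat -> R -> nat) (K : R), polylog T /\
  forall (n : nat) (H E : 'M[R]_n) (eps : R),
    (0 < n)%N -> hankel H -> psd H -> 0 < eps ->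
    exists (out : (T n eps).-tuple bool -> state R)
           (Hhat : (T n eps).-tuple bool -> 'M[R]_n),
      (forall w : (T n eps).-tuple bool,
        [/\ halts_within (oracle (H + E)) (nth false w) (T n eps) alg
              (init n eps) (out w),
            factored_rep cU cV (T n eps) (out w) (Hhat w),
            hankel (Hhat w),
            (width (out w))%:R <= K * (log_n R n * log_eps eps) &
            (\rank (Hhat w))%:R <= K * (log_n R n * log_eps eps)]) /\
      9 / 10 <= coin_prob R
        (fun w => frob (H - Hhat w) <= C * frob E + eps * frob H).
Proof.
exists 9; split=> //.
exists alg_cmd, (comp EntryU), (comp EntryV), (fun n eps => alg_time n (eps_steps eps)), (68 * 400).
split; first exact: alg_time_polylog.
move=> [//|N] H E eps _ hk ps e0.
set n := N.+1; set k := eps_steps eps; set T := alg_time n k.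
have [hge hlt] := eps_stepsP e0; rewrite -/k in hge hlt.
set r := alg_rank n k; set L := (bitlen n).+1; set x := node R k.+1.
have [tc tU tV tb] := alg_time_ge n k; rewrite -/T -/L in tc tU tV tb.
have [_ Lb _] := alg_iter_ge n k; rewrite -/L in Lb.
pose coef (w : T.-tuple bool) := sgd_run n r L (bitlen L) x (oracle (H + E)) (alg_iter n k) (nth false w).
pose Hhat (w : T.-tuple bool) : 'M[R]_n := \matrix_(i, j) expsum r x (coef w) (i + j).
have ex (w : T.-tuple bool) : exists s, [/\ halts_within (oracle (H + E)) (nth false w) T alg_cmd (init n eps) s,
    width s = r & factored_rep (comp EntryU) (comp EntryV) T s (Hhat w)].
  have [a [run w0 w3 ax ac]] := @alg_runs R (oracle (H + E)) (nth false w) n eps k isT hlt hge.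
  have [s ht hs] := run _ (sim_init n eps).
  have [h1 h2 h3 h4] := hs.
  have ws : width s = r by rewrite /width h1.
  exists s; split=> //; first exact: hw_le tc ht.
  have sim2 (i l : nat) : sim (setN (setN s 1 i) 2 l) (setn (setn a 1 i) 2 l).
    by split=> //= j jl; rewrite /upd h1.
  (* The entry programs loop only on N3, which still holds [L] when N1 and N2 receive the
     indices. *)
  have bound (i l q : nat) : q \in [:: 3]%N -> (nr (setn (setn a 1 i) 2 l) q <= alg_iter n k)%N.
    by rewrite inE => /eqP ->; rewrite /= /upd /= w3.
  (* The factorisation x^(i+j) = x^i x^j, with the coefficients in the left factor. *)
  exists (\matrix_(i, l) (coef w l * x l ^+ i)), (\matrix_(i, l) x l ^+ i); split.
  - apply/matrixP => i j; rewrite !mxE /expsum -ws; apply: eq_bigr => l _.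
    by rewrite !mxE exprD mulrA.
  - move=> i l; have lr : (l < r)%N by rewrite -ws.
    have [s' e' hs'] := @comp_ok R (fun _ _ => 0) (fun=> false) [:: 3]%N (alg_iter n k) EntryU _ _ (sim2 i l) isT (@bound i l).
    exists s'; first exact: hw_le tU e'.
    have iL : (i < 2 ^ nr (setn (setn a 1 i) 2 l) 3)%N.
      by rewrite /= /upd /= w3; have := ltn_ord i; have := bitlen_gt n; rewrite expnS; lia.
    have [eU _] := @entry_ok R (fun _ _ => 0) (fun=> false) (setn (setn a 1 i) 2 l) i l x (coef w) erefl erefl iL (ax _ lr) (ac _ lr).
    by have [_ -> // _ _] := hs'; rewrite eU mxE.
  - move=> i l; have lr : (l < r)%N by rewrite -ws.
    have [s' e' hs'] := @comp_ok R (fun _ _ => 0) (fun=> false) [:: 3]%N (alg_iter n k) EntryV _ _ (sim2 i l) isT (@bound i l).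
    exists s'; first exact: hw_le tV e'.
    have iL : (i < 2 ^ nr (setn (setn a 1 i) 2 l) 3)%N.
      by rewrite /= /upd /= w3; have := ltn_ord i; have := bitlen_gt n; rewrite expnS; lia.
    have [_ eV] := @entry_ok R (fun _ _ => 0) (fun=> false) (setn (setn a 1 i) 2 l) i l x (coef w) erefl erefl iL (ax _ lr) (ac _ lr).
    by have [_ -> // _ _] := hs'; rewrite eV mxE.
have [out outP] := boolp.choice ex.
have rk := @alg_rank_log R n eps isT e0; rewrite -/k -/r in rk.
exists out, Hhat; split.
  move=> w; have [ht ws fr] := outP w; split=> //.
  - by move=> i j i' j' e; rewrite !mxE e.
  - by rewrite ws.
  - apply: le_trans rk; rewrite ler_nat -ws.
    have [U [V [-> _ _]]] := fr.
    by apply: leq_trans (mxrankM_maxl _ _) (rank_leq_col _).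
have r0 : (0 < r)%N by rewrite /r /alg_rank muln_gt0.
have nL : (n <= 2 ^ L)%N by rewrite expnS; have := bitlen_gt n; lia.
have := @sgd_run_prob R n r L (bitlen L) x (oracle (H + E)) r0 (bitlen_self L) (bitlen_gt L) nL _ _ tb.
move=> /le_trans; apply; apply: coin_prob_le => w hw.
exact: recovery_error hk ps e0 hge hw.
Qed.
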